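(* Let $L>0$, $k\in(0,1)$, $\omega=0$, $B=\pm\sqrt2$, and let $a=c<0$, $b=d>0$ with $a+b=\frac16$ and the pair of $L$-periodic functions $(\varphi,\psi)=(\varphi_k,B\varphi_k)$ be as defined in the context (the case of vanishing integration constants $A_1=A_2=0$). The operator $\mathcal{L}:H^2_{per}\times H^2_{per}\subset L^2_{per}\times L^2_{per}\to L^2_{per}\times L^2_{per}$ given by $$\mathcal{L}=\begin{pmatrix}1+c\partial_x^2 & b\omega\partial_x^2+\psi-\omega\\ b\omega\partial_x^2+\psi-\omega & 1+a\partial_x^2+\varphi\end{pmatrix}$$ (with $\omega=0$) has exactly one negative eigenvalue, which is simple, and zero is a simple eigenvalue with associated eigenfunction $(\varphi',B\varphi')$. Moreover, the remainder of the spectrum is constituted by a discrete set of eigenvalues.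
   Context: $L^2_{per}=L^2_{per}([0,L])$ and $H^2_{per}=H^2_{per}([0,L])$ are the $L$-periodic Lebesgue and Sobolev spaces. $K(k)$ is the complete elliptic integral of the first kind with modulus $k$, and $\mathrm{cn}(\cdot,k)$ is the Jacobi cnoidal function. The data are $$a=c=-\frac{1}{16}\frac{L^2}{K(k)^2\sqrt{k^4-k^2+1}},\qquad b=d=\frac16-a,$$ $$\varphi(x)=b_0+b_2\,\mathrm{cn}^2\left(\frac{2K(k)}{L}x,k\right),\qquad \psi=B\varphi,$$ $$b_0=-\frac12\,\frac{(32k^2-16)\,a\,K(k)^2+L^2}{L^2},\qquad b_2=\frac{24K(k)^2\,a\,k^2}{L^2}.$$ With this choice of $a$, $(\varphi,\psi)$ solves the traveling wave system $\psi+\varphi\psi+a\psi''=A_1$, $\varphi+\frac12\psi^2+c\varphi''=A_2$ with $A_1=A_2=0$. *)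

(* Defs.v *)
From mathcomp Require Import all_boot all_order all_algebra.
From mathcomp Require Import complex.
From mathcomp Require Import all_classical all_reals all_analysis.

Set Implicit Arguments.
Unset Strict Implicit.
Unset Printing Implicit Defensive.

Import Order.TTheory GRing.Theory Num.Theory.
Import numFieldNormedType.Exports.

Local Open Scope classical_set_scope.
Local Open Scope ring_scope.
Local Open Scope complex_scope.

(** Elliptic integrals and the cnoidal function, in terms of the modulus [k]. *)

(* The integral from 0 to [t], oriented: for t < 0 it is - int_t^0. *)
Definition ellF {R : realType} (k t : R) : R :=
  let f := fun s : R => (Num.sqrt (1 - k ^+ 2 * sin s ^+ 2))^-1 in
  if 0 <= t then \int[lebesgue_measure]_(s in `[0, t]) f s
  else - \int[lebesgue_measure]_(s in `[t, 0]) f s.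

Definition ellK {R : realType} (k : R) : R := ellF k (pi / 2).

(* Inverse function of [ellF k], which is a bijection of R when 0 < k < 1; the
   default value 0 of [xget] is then never used. *)
Definition jacobi_am {R : realType} (k u : R) : R :=
  xget 0 [set t : R | ellF k t = u].

Definition jacobi_cn {R : realType} (k u : R) : R := cos (jacobi_am k u).

(** The coefficient [a] and the wave profile. *)

Definition coef_a {R : realType} (L k : R) : R :=
  - (16^-1 * (L ^+ 2 / (ellK k ^+ 2 * Num.sqrt (k ^+ 4 - k ^+ 2 + 1)))).

Definition coef_b0 {R : realType} (L k a : R) : R :=
  - (2^-1 * (((32 * k ^+ 2 - 16) * a * ellK k ^+ 2 + L ^+ 2) / L ^+ 2)).

Definition coef_b2 {R : realType} (L k a : R) : R :=
  24 * ellK k ^+ 2 * a * k ^+ 2 / L ^+ 2.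

Definition cnoidal {R : realType} (L k a : R) (x : R) : R :=
  coef_b0 L k a + coef_b2 L k a * jacobi_cn k (2 * ellK k / L * x) ^+ 2.

(** Complex-valued periodic Lebesgue and Sobolev spaces.  Their elements are
    represented by functions; equality in the space is equality almost
    everywhere on a period ([eq_per] and [eq_per2] below). *)

Definition period_measure {R : realType} (L : R) :=
  mrestr (@lebesgue_measure R) (measurable_itv `[0 : R, L]).

Definition L2per {R : realType} (L : R) (f : R -> R[i]) : Prop :=
  [/\ periodic f L,
      (fun x => complex.Re (f x)) \in Lfun (period_measure L) 2%:E
    & (fun x => complex.Im (f x)) \in Lfun (period_measure L) 2%:E].

Definition eq_per {R : realType} (L : R) (f g : R -> R[i]) : Prop :=
  ae_eq (@lebesgue_measure R) `[0, L]%classic f g.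

Definition test_per {R : realType} (L : R) (theta : R -> R) : Prop :=
  periodic theta L /\ forall n x, derivable (derive1n n theta) x 1.

(* [g] is the [n]-th derivative of [f] in the sense of periodic distributions;
   real test functions suffice, the real and imaginary parts being separated. *)
Definition real_weak_derive {R : realType} (L : R) (n : nat) (f g : R -> R) :=
  forall theta : R -> R, test_per L theta ->
    \int[lebesgue_measure]_(x in `[0, L]) (f x * derive1n n theta x) =
    (-1) ^+ n * \int[lebesgue_measure]_(x in `[0, L]) (g x * theta x).

Definition weak_derive {R : realType} (L : R) (n : nat) (f g : R -> R[i]) :=
  real_weak_derive L n (fun x => complex.Re (f x)) (fun x => complex.Re (g x))
  /\
  real_weak_derive L n (fun x => complex.Im (f x)) (fun x => complex.Im (g x)).

Definition H2per {R : realType} (L : R) (f : R -> R[i]) : Prop :=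
  L2per L f /\
  forall n, (n <= 2)%N -> exists2 g, L2per L g & weak_derive L n f g.

(* For f in H^2_per the second derivative is unique up to [eq_per], so that the
   choice of a representative is immaterial. *)
Definition dxx {R : realType} (L : R) (f : R -> R[i]) : R -> R[i] :=
  xget (fun=> 0) [set g | L2per L g /\ weak_derive L 2 f g].

(** The product space L^2_per x L^2_per. *)

Notation cfun2 R := ((R -> R[i]) * (R -> R[i]))%type.

Definition L2per2 {R : realType} (L : R) : set (cfun2 R) :=
  [set u | L2per L u.1 /\ L2per L u.2].

Definition H2per2 {R : realType} (L : R) : set (cfun2 R) :=
  [set u | H2per L u.1 /\ H2per L u.2].

Definition eq_per2 {R : realType} (L : R) (u v : cfun2 R) : Prop :=
  eq_per L u.1 v.1 /\ eq_per L u.2 v.2.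

Definition zero2 {R : realType} : cfun2 R := (fun=> 0, fun=> 0).

Definition scale2 {R : realType} (l : R[i]) (u : cfun2 R) : cfun2 R :=
  (fun x => l * u.1 x, fun x => l * u.2 x).

Definition sub2 {R : realType} (u v : cfun2 R) : cfun2 R :=
  (fun x => u.1 x - v.1 x, fun x => u.2 x - v.2 x).

Definition norm2 {R : realType} (L : R) (u : cfun2 R) : R :=
  Num.sqrt (\int[lebesgue_measure]_(x in `[0, L])
              (Normc.normc (u.1 x) ^+ 2 + Normc.normc (u.2 x) ^+ 2)).

(** Spectral notions for an operator [A] in L^2_per x L^2_per with domain [D]. *)

Definition shift2 {R : realType} (A : cfun2 R -> cfun2 R) (l : R[i])
    (u : cfun2 R) : cfun2 R := sub2 (A u) (scale2 l u).

(* [A - l] is a bijection of [D] onto L^2_per x L^2_per, with bounded inverse *)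
Definition resolvent_set {R : realType} (L : R) (D : set (cfun2 R))
    (A : cfun2 R -> cfun2 R) : set R[i] :=
  [set l | [/\
    (forall u v, D u -> D v ->
       eq_per2 L (shift2 A l u) (shift2 A l v) -> eq_per2 L u v),
    (forall w, L2per2 L w -> exists2 u, D u & eq_per2 L (shift2 A l u) w)
  & (exists C : R, forall u, D u -> norm2 L u <= C * norm2 L (shift2 A l u))]].

Definition spectrum {R : realType} (L : R) (D : set (cfun2 R))
    (A : cfun2 R -> cfun2 R) : set R[i] := ~` resolvent_set L D A.

Definition eigenspace2 {R : realType} (L : R) (D : set (cfun2 R))
    (A : cfun2 R -> cfun2 R) (l : R[i]) : set (cfun2 R) :=
  [set u | D u /\ eq_per2 L (A u) (scale2 l u)].

Definition eigenfunction {R : realType} (L : R) (D : set (cfun2 R))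
    (A : cfun2 R -> cfun2 R) (l : R[i]) (u : cfun2 R) : Prop :=
  eigenspace2 L D A l u /\ ~ eq_per2 L u zero2.

Definition is_eigenvalue {R : realType} (L : R) (D : set (cfun2 R))
    (A : cfun2 R -> cfun2 R) (l : R[i]) : Prop :=
  exists u, eigenfunction L D A l u.

(* the eigenspace has dimension one over the complex numbers *)
Definition simple_eigenvalue {R : realType} (L : R) (D : set (cfun2 R))
    (A : cfun2 R -> cfun2 R) (l : R[i]) : Prop :=
  exists2 e, eigenfunction L D A l e &
    forall u, eigenspace2 L D A l u -> exists z, eq_per2 L u (scale2 z e).

(** The linearized operator; its domain is [H2per2 L]. *)

Definition lin_op {R : realType} (L a b c omega : R) (phi psi : R -> R)
    (u : cfun2 R) : cfun2 R :=
  let offdiag (f : R -> R[i]) (x : R) : R[i] :=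
    (b * omega)%:C * dxx L f x + (psi x)%:C * f x - omega%:C * f x in
  (fun x => u.1 x + c%:C * dxx L u.1 x + offdiag u.2 x,
   fun x => offdiag u.1 x + (u.2 x + a%:C * dxx L u.2 x + (phi x)%:C * u.2 x)).

(* Main.v *)
Require Import Defs.
From mathcomp Require Import all_boot all_order all_algebra.
From mathcomp Require Import complex.
From mathcomp Require Import all_classical all_reals all_analysis.
From mathcomp Require Import measurable_realfun.
From mathcomp Require Import ring lra.

Set Implicit Arguments.
Unset Strict Implicit.
Unset Printing Implicit Defensive.

Import Order.TTheory GRing.Theory Num.Theory.
Import numFieldNormedType.Exports.

Local Open Scope classical_set_scope.
Local Open Scope ring_scope.

(** The matrix (0 B; B 1) with B^2 = 2 has the eigenvectors (1, B) and (B, -1), for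
    the eigenvalues 2 and -1.  In the coordinates along them the operator splits
    into the two Hill operators - al f'' + (1 + 2 phi) f and - al f'' + (1 - phi) f
    on the circle, where al = - a > 0.  Since phi < 0 the second is larger than 1,
    so that everything which happens on ]-oo, 0] comes from the first.

    In terms of sn the first one is the Lame operator with potential 12 k^2 sn^2,
    of which three eigenfunctions are explicit: phi', that is sn cn dn, for the
    eigenvalue 0 ([wave1_solves]), and the even functions dn (1 - be sn^2) for an
    eigenvalue lf < 0 and an eigenvalue lg > 0 ([lame_even_solves]).  The one for lf
    is positive, phi' is odd about the middle of the period and positive on the first
    half, and the one for lg changes sign once there.  Oscillation theory then
    excludes all other eigenvalues in ]-oo, 0] and all other eigenfunctions: a
    periodic solution is the sum of an even and an odd one, the odd part is compared
    with phi' ([odd_solution_eq0]) and the even part with the two even Lame functions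
    ([even_solution_eq0]).

    The operator is defined through periodic distributions.  A function of H^2_per
    agrees almost everywhere with a second primitive of its weak second derivative
    ([weak2_regular]), because trigonometric polynomials are test functions and an
    integrable function orthogonal to all of them vanishes almost everywhere
    ([trig_orthogonal_ae0]).  Hence an equation (A - l) u = w is equivalent to two
    classical boundary value problems ([system_weak], [system_strong]).

    Off the eigenvalues such a problem is uniquely solvable with a bound: the
    monodromy matrix of the homogeneous first order system minus the identity is
    invertible ([fredholm_periodic]).  So l is in the resolvent set
    ([not_eigenvalue_resolvent]) and the whole spectrum consists of eigenvalues.
    These are real, by periodicity of a Wronskian ([hill_eigenvalue_real]), and a
    bounded interval contains finitely many of them: orthonormal eigenfunctions with
    bounded eigenvalues satisfy sum_i y_i(x)^2 <= K with K independent of their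
    number, which integration over the period turns into a bound of that number
    ([eigenvalue_count]).  Hence there is no limit point. *)

(** * Calculus on a segment *)

Section Calculus.
Context {R : realType}.
Implicit Types (f g F G : R -> R) (a b c x y : R).
Local Notation mu := (@lebesgue_measure R).

(** The relation [is_derive x 1 f d], set apart from the type class so that
    derivation rules apply to it as ordinary lemmas. *)
Definition deriv_at x f a : Prop := is_derive x 1 f a.

Lemma deriveD_pt f g x a b : deriv_at x f a -> deriv_at x g b ->
  deriv_at x (fun y => f y + g y) (a + b).
Proof. by move=> fa gb; exact: is_deriveD. Qed.

Lemma deriveB_pt f g x a b : deriv_at x f a -> deriv_at x g b ->
  deriv_at x (fun y => f y - g y) (a - b).
Proof. by move=> fa gb; exact: is_deriveB. Qed.

Lemma deriveM_pt f g x a b : deriv_at x f a -> deriv_at x g b ->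
  deriv_at x (fun y => f y * g y) (a * g x + f x * b).
Proof.
move=> fa gb; have := @is_deriveM _ _ f g x 1 a b fa gb.
by rewrite /GRing.scale/= addrC [g x * a]mulrC.
Qed.

Lemma deriveZ_pt f x a c : deriv_at x f a ->
  deriv_at x (fun y => c * f y) (c * a).
Proof. by move=> fa; exact: (@is_deriveZ _ _ _ f c). Qed.

Lemma derive_comp_pt f g x a b : deriv_at (g x) f a -> deriv_at x g b ->
  deriv_at x (fun y => f (g y)) (a * b).
Proof. by move=> fa gb; exact: (@is_derive1_comp _ f g). Qed.

Lemma deriv_at_cst c x : deriv_at x (fun=> c) 0.
Proof. exact: is_derive_cst. Qed.

Lemma deriv_at_id x : deriv_at x (fun y => y) 1.
Proof. exact: is_derive_id. Qed.

Lemma deriv_at_eq f x a b : deriv_at x f a -> a = b -> deriv_at x f b.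
Proof. by move=> fa <-. Qed.

Lemma deriveN_pt f x a : deriv_at x f a -> deriv_at x (fun y => - f y) (- a).
Proof. by move=> fa; exact: is_deriveN. Qed.

Lemma derive_affine_pt c b x : deriv_at x (fun y => c * y + b) c.
Proof.
have := deriveD_pt (deriveZ_pt c (deriv_at_id x)) (deriv_at_cst b x).
by rewrite addr0 mulr1.
Qed.

Lemma deriv_at_continuous f x a : deriv_at x f a -> {for x, continuous f}.
Proof. by move=> [fd _]; apply/differentiable_continuous/derivable1_diffP. Qed.

Lemma deriv_at_derive1 f x a : deriv_at x f a -> derive1 f x = a.
Proof. by move=> fa; rewrite derive1E; exact: derive_val. Qed.

Definition cont_on a b (f : R -> R) : Prop := {within `[a, b], continuous f}.

Lemma continuous_within a b f :
  (forall x, a <= x <= b -> {for x, continuous f}) ->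
  cont_on a b f.
Proof.
move=> fc; apply: continuous_in_subspaceT => x.
by rewrite inE/= in_itv/=; exact: fc.
Qed.

Lemma deriv_at_within a b f f' :
  (forall x, a <= x <= b -> deriv_at x f (f' x)) ->
  cont_on a b f.
Proof.
by move=> fd; apply: continuous_within => x /fd; exact: deriv_at_continuous.
Qed.

Lemma within_subitv a b c d f : c <= a -> b <= d ->
  cont_on c d f -> cont_on a b f.
Proof.
move=> ca bd; apply: continuous_subspaceW => x /=; rewrite !in_itv/=.
by move=> /andP[ax xb]; rewrite (le_trans ca ax) (le_trans xb bd).
Qed.

Lemma withinD a b f g : cont_on a b f ->
  cont_on a b g ->
  cont_on a b (fun x => f x + g x).
Proof. by move=> fc gc x; apply: continuousD; [exact: fc|exact: gc]. Qed.

Lemma withinB a b f g : cont_on a b f ->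
  cont_on a b g ->
  cont_on a b (fun x => f x - g x).
Proof. by move=> fc gc x; apply: continuousB; [exact: fc|exact: gc]. Qed.

Lemma withinM a b f g : cont_on a b f ->
  cont_on a b g ->
  cont_on a b (fun x => f x * g x).
Proof. by move=> fc gc x; apply: continuousM; [exact: fc|exact: gc]. Qed.

Lemma within_cst a b c : cont_on a b (fun=> c).
Proof. by move=> x; exact: cvg_cst. Qed.

Lemma within_eq a b f g : (forall x, a <= x <= b -> f x = g x) ->
  cont_on a b f -> cont_on a b g.
Proof.
move=> fg; apply: subspace_eq_continuous => x.
by rewrite inE/= in_itv/= => /fg.
Qed.

Lemma within_integrable a b f : cont_on a b f ->
  mu.-integrable `[a, b] (EFin \o f).
Proof.
by move=> fc; apply: continuous_compact_integrable => //; exact: segment_compact.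
Qed.

Lemma within_bounded a b f : cont_on a b f ->
  exists2 M, 0 <= M & forall x, a <= x <= b -> `|f x| <= M.
Proof.
move=> fc; have [ab|ba] := leP a b; last first.
  by exists 0 => // x /andP[ax xb]; move: (le_trans ax xb); rewrite leNgt ba.
have fc' : cont_on a b (fun x => `|f x|).
  by move=> x; apply: continuous_comp; [exact: fc|exact: norm_continuous].
have [c _ H] := EVT_max ab fc'.
by exists `|f c| => // x xab; apply: H; rewrite in_itv.
Qed.

Lemma FTC_segment a b F f : a <= b ->
  (forall x, a <= x <= b -> deriv_at x F (f x)) ->
  cont_on a b f ->
  \int[mu]_(x in `[a, b]) f x = F b - F a.
Proof.
rewrite le_eqVlt => /predU1P[<- _ _|ab Fd fc].
  by rewrite set_itv1 Rintegral_set1 subrr.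
have Fc x : a <= x <= b -> {for x, continuous F}.
  by move=> /Fd; exact: deriv_at_continuous.
rewrite /Rintegral (@continuous_FTC2 _ f F)//.
- split.
  + by move=> x; rewrite in_itv/= => /andP[ax xb]; have [] := Fd x; rewrite ?ltW.
  + by apply: cvg_at_right_filter; apply: Fc; rewrite lexx ltW.
  + by apply: cvg_at_left_filter; apply: Fc; rewrite lexx ltW.
- move=> x; rewrite in_itv/= => /andP[ax xb].
  by rewrite derive1E; have := Fd x; rewrite !ltW// => /(_ isT)/@derive_val.
Qed.

Lemma segment_ge0_le a b f f' : a <= b ->
  (forall x, a <= x <= b -> deriv_at x f (f' x)) ->
  (forall x, a < x < b -> 0 <= f' x) -> f a <= f b.
Proof.
move=> ab fd f0.
apply: (@ger0_derive1_le_cc R f a b) => //; rewrite ?in_itv/= ?lexx ?ab//.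
- move=> x; rewrite in_itv/= => /andP[ax xb].
  by have [] := fd x; rewrite ?ltW.
- move=> x; rewrite in_itv/= => /andP[ax xb].
  have xab : a <= x <= b by rewrite !ltW.
  by rewrite (deriv_at_derive1 (fd x xab)); apply: f0; rewrite ax xb.
- exact: (deriv_at_within fd).
Qed.

Lemma segment_gt0_lt a b f f' : a < b ->
  (forall x, a <= x <= b -> deriv_at x f (f' x)) ->
  (forall x, a < x < b -> 0 < f' x) -> f a < f b.
Proof.
move=> ab fd f0.
apply: (@gtr0_derive1_lt_cc R f a b) => //; rewrite ?in_itv/= ?lexx ?(ltW ab)//.
- move=> x; rewrite in_itv/= => /andP[ax xb].
  by have [] := fd x; rewrite ?ltW.
- move=> x; rewrite in_itv/= => /andP[ax xb].
  have xab : a <= x <= b by rewrite !ltW.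
  by rewrite (deriv_at_derive1 (fd x xab)); apply: f0; rewrite ax xb.
- exact: (deriv_at_within fd).
Qed.

Lemma segment_derive0_cst a b f : a <= b ->
  (forall x, a <= x <= b -> deriv_at x f 0) ->
  forall x, a <= x <= b -> f x = f a.
Proof.
move=> ab fd x /andP[ax xb].
have fd' y : a <= y <= x -> deriv_at y f 0.
  by move=> /andP[ay yx]; apply: fd; rewrite ay (le_trans yx).
apply/eqP; rewrite eq_le (segment_ge0_le ax fd')// andbT.
rewrite -lerN2.
apply: (@segment_ge0_le _ _ (fun x => - f x) (fun=> - 0)) => [//|y /fd' fy|y _].
  exact: deriveN_pt.
by rewrite oppr0.
Qed.

(** Composition with the projection onto [a, b] turns continuity on the segment into
    continuity on the line. *)
Definition clamp a b x := Num.max a (Num.min b x).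

Lemma clamp_id a b x : a <= x <= b -> clamp a b x = x.
Proof. by move=> /andP[ax xb]; rewrite /clamp min_r// max_r. Qed.

Lemma clamp_in a b x : a <= b -> a <= clamp a b x <= b.
Proof.
by move=> ab; rewrite /clamp le_max lexx/= ge_max ab ge_min lexx.
Qed.

Lemma continuous_clamp a b : continuous (clamp a b).
Proof.
move=> x; rewrite /clamp.
apply: (@continuous_max R R (cst a) (fun y => Num.min b y)).
  exact: cvg_cst.
by apply: (@continuous_min R R (cst b) id); [exact: cvg_cst|exact: cvg_id].
Qed.

Lemma continuous_comp_clamp a b f : a <= b -> cont_on a b f ->
  continuous (fun x => f (clamp a b x)).
Proof.
move=> ab /subspace_continuousP fc x.
have ci : `[a, b]%classic (clamp a b x) by rewrite /= in_itv/=; exact: clamp_in.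
move=> U /(fc _ ci) fU; have := @continuous_clamp a b x _ fU.
move: (nbhs_filter x) => FF; apply: (@filterS _ _ FF) => y /= yU.
by apply: yU; rewrite /= in_itv/=; exact: clamp_in.
Qed.

(** The derivative is two-sided at the end points as well, because [f] is first
    extended by constants. *)
Lemma primitive_exists a b f : a <= b -> cont_on a b f ->
  exists F, F a = 0 /\ forall x, a <= x <= b -> deriv_at x F (f x).
Proof.
move=> ab fc; pose g x := f (clamp a b x).
have gc : continuous g by exact: continuous_comp_clamp.
pose G x := \int[mu]_(t in `[a - 1, x]) g t.
have Gd x : a - 1 < x -> deriv_at x G (g x).
  move=> ax.
  have xx1 : x < x + 1 by rewrite ltrDl.
  have gi : mu.-integrable `[a - 1, x + 1] (EFin \o g).
    by apply: within_integrable; exact: continuous_subspaceT.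
  have [] := @continuous_FTC1_closed R g (a - 1) x (x + 1) xx1 gi ax (gc x).
  by rewrite derive1E => dG <-; split.
exists (fun x => G x - G a); split; first by rewrite subrr.
move=> x /andP[ax xb].
have := deriveB_pt (Gd x _) (deriv_at_cst (G a) x).
rewrite subr0 /g clamp_id ?ax//; apply.
by rewrite (lt_le_trans _ ax)// gtrDl ltrN10.
Qed.

Lemma parts_segment a b F f G g : a <= b ->
  (forall x, a <= x <= b -> deriv_at x F (f x)) ->
  (forall x, a <= x <= b -> deriv_at x G (g x)) ->
  cont_on a b f -> cont_on a b g ->
  \int[mu]_(x in `[a, b]) (F x * g x) =
    F b * G b - F a * G a - \int[mu]_(x in `[a, b]) (f x * G x).
Proof.
move=> ab Fd Gd fc gc.
have Fc := deriv_at_within Fd; have Gc := deriv_at_within Gd.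
have FGd x : a <= x <= b ->
    deriv_at x (fun x => F x * G x) (f x * G x + F x * g x).
  by move=> xab; exact: deriveM_pt (Fd _ xab) (Gd _ xab).
rewrite -(FTC_segment ab FGd); last by apply: withinD; exact: withinM.
rewrite RintegralD//; last 2 first.
- by apply: within_integrable; exact: withinM.
- by apply: within_integrable; exact: withinM.
by rewrite addrC addKr.
Qed.

Lemma Rintegral_itv_cst a b c : a <= b ->
  \int[mu]_(x in `[a, b]) c = c * (b - a).
Proof.
move=> ab; rewrite Rintegral_cst//= lebesgue_measure_itv/= lte_fin.
by move: ab; rewrite le_eqVlt => /predU1P[->|->//]; rewrite ltxx subrr.
Qed.

Lemma le_Rintegral_itv a b f g : mu.-integrable `[a, b] (EFin \o f) ->
  mu.-integrable `[a, b] (EFin \o g) ->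
  (forall x, a <= x <= b -> f x <= g x) ->
  \int[mu]_(x in `[a, b]) f x <= \int[mu]_(x in `[a, b]) g x.
Proof.
move=> fi gi fg; apply: le_Rintegral => // x /=; rewrite in_itv/=; exact: fg.
Qed.

Lemma eq_Rintegral_itv a b f g : (forall x, a <= x <= b -> f x = g x) ->
  \int[mu]_(x in `[a, b]) f x = \int[mu]_(x in `[a, b]) g x.
Proof.
by move=> fg; apply: eq_Rintegral => x; rewrite inE/= in_itv/=; exact: fg.
Qed.

Lemma Rintegral_itv_ge0 a b f : (forall x, a <= x <= b -> 0 <= f x) ->
  0 <= \int[mu]_(x in `[a, b]) f x.
Proof. by move=> f0; apply: Rintegral_ge0 => x /=; rewrite in_itv/=; exact: f0. Qed.

(** A continuous nonnegative function with zero integral vanishes, because its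
    primitive is nondecreasing with equal end values. *)
Lemma within_integral_eq0 a b f : a < b -> cont_on a b f ->
  (forall x, a <= x <= b -> 0 <= f x) ->
  \int[mu]_(x in `[a, b]) f x = 0 -> forall x, a <= x <= b -> f x = 0.
Proof.
move=> ab fc f0 fi.
have [F [Fa Fd]] := primitive_exists (ltW ab) fc.
have Fb : F b = 0 by move: fi; rewrite (FTC_segment (ltW ab) Fd fc) Fa subr0.
have Fz x : a <= x <= b -> F x = 0.
  move=> /andP[ax xb]; apply/eqP; rewrite eq_le; apply/andP; split.
  - rewrite -Fb; apply: (segment_ge0_le xb) => y /andP[xy yb].
      by apply: Fd; rewrite yb (le_trans ax).
    by apply: f0; rewrite (ltW yb) (le_trans ax)// ltW.
  - rewrite -Fa; apply: (segment_ge0_le ax) => y /andP[ay yx].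
      by apply: Fd; rewrite ay (le_trans yx).
    by apply: f0; rewrite (ltW ay) (le_trans _ xb)// ltW.
have fz x : a < x < b -> f x = 0.
  move=> /andP[ax xb]; have xab : a <= x <= b by rewrite !ltW.
  have : deriv_at x (cst 0 : R -> R) (f x).
    apply: (@near_eq_is_derive _ _ _ F); last exact: Fd.
    near=> y; rewrite /cst Fz//; apply/andP; split.
      by apply/ltW; near: y; exact: lt_nbhsr.
    by apply/ltW; near: y; exact: lt_nbhsl.
  by move=> [_ <-]; rewrite derive_cst.
move=> x xab; apply/eqP; rewrite eq_le f0// andbT leNgt; apply/negP => fx.
have [xa|xa] := eqVneq x a.
  subst x; have /continuous_within_itvP := fc; move=> /(_ ab)[_ + _].
  move=> /cvgr_gt/(_ _ fx) H; have : \forall y \near a^'+, False; last first.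
    by move=> /filter_ex[].
  near=> y; have : 0 < f y by near: y.
  by rewrite fz ?ltxx//; apply/andP; split; near: y; [exact: nbhs_right_gt|exact: nbhs_right_lt].
have [xb|xb] := eqVneq x b.
  subst x; have /continuous_within_itvP := fc; move=> /(_ ab)[_ _ +].
  move=> /cvgr_gt/(_ _ fx) H; have : \forall y \near b^'-, False; last first.
    by move=> /filter_ex[].
  near=> y; have : 0 < f y by near: y.
  by rewrite fz ?ltxx//; apply/andP; split; near: y; [exact: nbhs_left_gt|exact: nbhs_left_lt].
by move: fx; rewrite fz ?ltxx// !lt_neqAle xb eq_sym xa.
Unshelve. all: by end_near. Qed.

End Calculus.

(** * The Jacobi amplitude *)

Section Amplitude.
Context {R : realType}.
Variable k : R.
Hypothesis hk : 0 < k < 1.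
Implicit Types x t u : R.
Local Notation mu := (@lebesgue_measure R).

Definition delta2 (t : R) : R := 1 - k ^+ 2 * sin t ^+ 2.

Lemma sqr_modulus_lt1 : 0 < k ^+ 2 < 1.
Proof. by case/andP: hk => k0 k1; rewrite exprn_gt0//= expr_lt1// ltW. Qed.

Lemma sin2_le1 t : sin t ^+ 2 <= 1.
Proof. by rewrite -(cos2Dsin2 t) lerDr sqr_ge0. Qed.

Lemma delta2_gt0 t : 0 < delta2 t.
Proof.
have /andP[k0 k1] := sqr_modulus_lt1; have := sin2_le1 t.
have := sqr_ge0 (sin t); rewrite /delta2; nra.
Qed.

Lemma delta2_le1 t : delta2 t <= 1.
Proof.
have /andP[k0 k1] := sqr_modulus_lt1; have := sqr_ge0 (sin t).
by rewrite /delta2; nra.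
Qed.

Definition delta (t : R) : R := Num.sqrt (delta2 t).

Lemma delta_gt0 t : 0 < delta t.
Proof. by rewrite sqrtr_gt0 delta2_gt0. Qed.

Lemma sqr_delta t : delta t ^+ 2 = 1 - k ^+ 2 * sin t ^+ 2.
Proof. by rewrite sqr_sqrtr// ltW// delta2_gt0. Qed.

Lemma delta_le1 t : delta t <= 1.
Proof. by rewrite -sqrtr1 ler_sqrt// delta2_le1. Qed.

Lemma continuous_delta2 : continuous delta2.
Proof.
move=> x; apply: (@deriv_at_continuous _ _ _ (0 - k ^+ 2 *
  (cos x * sin x + sin x * cos x))).
apply: deriveB_pt; first exact: deriv_at_cst.
apply: deriveZ_pt; apply: (@deriveM_pt _ sin sin); exact: is_derive_sin.
Qed.

Lemma continuous_deltaV : continuous (fun t => (delta t)^-1).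
Proof.
move=> x; apply: cvgV; first by rewrite gt_eqF// delta_gt0.
by apply: continuous_comp; [exact: continuous_delta2|exact: sqrt_continuous].
Qed.

(** On each bounded interval the integral of [ellF] is a difference of values of
   one primitive, whatever the sign of the upper end. *)
Lemma ellF_derive x : deriv_at x (ellF k) (delta x)^-1.
Proof.
pose N := `|x| + 1; have N0 : - N <= N by rewrite /N; have := normr_ge0 x; lra.
have fc a b : cont_on a b (fun t => (delta t)^-1).
  by apply: continuous_subspaceT; exact: continuous_deltaV.
have [G [_ Gd]] := primitive_exists N0 (fc _ _).
have FG t : - N <= t <= N -> G t - G 0 = ellF k t.
  move=> /andP[Nt tN]; rewrite /ellF -/delta2 -/delta; case: ifPn => [t0|].
    symmetry; apply: FTC_segment => // s /andP[s0 st].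
    by apply: Gd; apply/andP; split; [have := normr_ge0 x; rewrite /N; lra|lra].
  rewrite -ltNge => t0; rewrite -opprB; congr (- _); symmetry.
  apply: FTC_segment => //; first exact: ltW.
  move=> s /andP[s0 st].
  by apply: Gd; apply/andP; split; [lra|have := normr_ge0 x; rewrite /N; lra].
have xN : - N < x < N.
  by rewrite -ltr_norml /N ltrDl.
apply: (@near_eq_is_derive _ _ _ (fun t => G t - G 0)).
  case/andP: xN => Nx xN; near=> t; apply: FG; apply/andP; split.
    by apply/ltW; near: t; exact: lt_nbhsr.
  by apply/ltW; near: t; exact: lt_nbhsl.
rewrite -[(delta x)^-1]subr0; apply: deriveB_pt; last exact: deriv_at_cst.
by apply: Gd; case/andP: xN => ? ?; rewrite !ltW.
Unshelve. all: by end_near. Qed.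

Lemma continuous_ellF : continuous (ellF k).
Proof. by move=> x; exact: deriv_at_continuous (ellF_derive x). Qed.

Lemma ellF0 : ellF k 0 = 0 :> R.
Proof. by rewrite /ellF lexx set_itv1 Rintegral_set1. Qed.

Lemma ellF_lt : {homo ellF k : x y / x < y}.
Proof.
move=> x y xy; apply: (segment_gt0_lt xy) => [t _|t _]; first exact: ellF_derive.
by rewrite invr_gt0 delta_gt0.
Qed.

Lemma ellF_le_mono : {mono ellF k : x y / x <= y}.
Proof. exact: (le_mono ellF_lt). Qed.

Lemma ellF_inj : injective (ellF k).
Proof. exact: (inc_inj ellF_le_mono). Qed.

Lemma cst_derive0 (f : R -> R) : (forall x, deriv_at x f 0) ->
  forall x y, f x = f y.
Proof.
move=> fd; suff H x y : x <= y -> f y = f x.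
  by move=> x y; case: (leP x y) => [/H|/ltW/H].
move=> xy; apply: (segment_derive0_cst xy (fun t _ => fd t)).
by rewrite xy lexx.
Qed.

(** Both sides of the symmetries of [ellF] have the same derivative. *)
Lemma ellFN x : ellF k (- x) = - ellF k x.
Proof.
have H t : deriv_at t (fun s => ellF k (-1 * s + 0) + ellF k s) 0.
  have E : (delta (-1 * t + 0))^-1 * -1 + (delta t)^-1 = 0.
    by rewrite /delta /delta2 addr0 mulN1r sinN sqrrN; lra.
  apply: deriv_at_eq E; apply: deriveD_pt; last exact: ellF_derive.
  exact: derive_comp_pt (ellF_derive _) (derive_affine_pt (- 1) 0 t).
have := cst_derive0 H x 0.
by rewrite mulr0 !addr0 ellF0 addr0 mulN1r => /eqP; rewrite addr_eq0 => /eqP.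
Qed.

Lemma ellFDpi x : ellF k (x + pi) = ellF k x + ellF k pi.
Proof.
have H t : deriv_at t (fun s => ellF k (1 * s + pi) - ellF k s) 0.
  have E : (delta (1 * t + pi))^-1 * 1 - (delta t)^-1 = 0.
    by rewrite /delta /delta2 mul1r sinDpi sqrrN; lra.
  rewrite -E; apply: deriveB_pt; last exact: ellF_derive.
  by apply: derive_comp_pt; [exact: ellF_derive|exact: derive_affine_pt].
have := cst_derive0 H x 0.
by rewrite mul1r mulr0 add0r ellF0 subr0 => <-; rewrite subrKC.
Qed.

Lemma ellF_pi : ellF k pi = 2 * ellK k.
Proof.
have := ellFDpi (- (pi / 2)); rewrite ellFN -/(ellK k).
have -> : - (pi / 2) + pi = pi / 2 :> R by lra.
by rewrite -/(ellK k); lra.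
Qed.

Lemma ellF_ge x : 0 <= x -> x <= ellF k x.
Proof.
move=> x0; have H t : deriv_at t (fun s => ellF k s - s) ((delta t)^-1 - 1).
  by apply: deriveB_pt; [exact: ellF_derive|exact: deriv_at_id].
have := @segment_ge0_le _ 0 x _ _ x0 (fun t _ => H t).
rewrite ellF0 subr0 subr_ge0; apply => t _.
by rewrite subr_ge0 invf_ge1 ?delta_gt0 ?delta_le1.
Qed.

(** The integrand is at least 1, so that [ellF] is unbounded. *)
Lemma ellF_surj u : exists t, ellF k t = u.
Proof.
suff H v : 0 <= v -> exists t, ellF k t = v.
  have [u0|u0] := leP 0 u; first exact: H.
  have [|t tu] := H (- u); first by rewrite oppr_ge0 ltW.
  by exists (- t); rewrite ellFN tu opprK.
move=> v0; have [||t _ <-] := @IVT R (ellF k) 0 v v v0; last by exists t.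
  by apply: continuous_subspaceT; exact: continuous_ellF.
rewrite ellF0 ge_min v0/= le_max (ellF_ge v0) orbT//.
Qed.

Lemma jacobi_amK : cancel (jacobi_am k) (ellF k).
Proof.
by move=> u; have := @xgetPex _ (0 : R) [set t | ellF k t = u] (ellF_surj u).
Qed.

Lemma ellFK : cancel (ellF k) (jacobi_am k).
Proof. by move=> t; apply: ellF_inj; rewrite jacobi_amK. Qed.

Lemma jacobi_am_derive u : deriv_at u (jacobi_am k) (delta (jacobi_am k u)).
Proof.
rewrite -{1}(jacobi_amK u) -[delta _]invrK.
apply: (@is_derive_inverse R (ellF k)).
- by near=> x; exact: ellFK.
- by near=> x; exact: continuous_ellF.
- exact: ellF_derive.
- by rewrite invr_eq0 gt_eqF// delta_gt0.
Unshelve. all: by end_near. Qed.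

Lemma jacobi_am0 : jacobi_am k 0 = 0.
Proof. by rewrite -[RHS](ellFK 0) ellF0. Qed.

Lemma jacobi_amK_half : jacobi_am k (ellK k) = pi / 2.
Proof. by rewrite ellFK. Qed.

Lemma jacobi_amD2K u : jacobi_am k (u + 2 * ellK k) = jacobi_am k u + pi.
Proof. by apply: ellF_inj; rewrite ellFDpi ellF_pi !jacobi_amK. Qed.

Lemma jacobi_amN u : jacobi_am k (- u) = - jacobi_am k u.
Proof. by apply: ellF_inj; rewrite ellFN !jacobi_amK. Qed.

Lemma jacobi_am_lt : {homo jacobi_am k : x y / x < y}.
Proof.
move=> x y xy; rewrite ltNge; apply/negP.
by rewrite -ellF_le_mono !jacobi_amK leNgt xy.
Qed.

Lemma ellK_gt0 : 0 < ellK k.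
Proof. by rewrite -ellF0; apply: ellF_lt; rewrite divr_gt0// pi_gt0. Qed.

(** Polynomials in sn, cn and dn are closed under differentiation, and the relations
    between the squares reduce them to a normal form; all computations with Jacobi
    functions below rest on this. *)
Definition jacobi_sn u : R := sin (jacobi_am k u).
Definition jacobi_dn u : R := delta (jacobi_am k u).

Lemma jacobi_cn2 u : jacobi_cn k u ^+ 2 = 1 - jacobi_sn u ^+ 2.
Proof. by rewrite /jacobi_cn /jacobi_sn -(cos2Dsin2 (jacobi_am k u)) addrK. Qed.

Lemma jacobi_dn2 u : jacobi_dn u ^+ 2 = 1 - k ^+ 2 * jacobi_sn u ^+ 2.
Proof. exact: sqr_delta. Qed.

Lemma jacobi_dn_gt0 u : 0 < jacobi_dn u.
Proof. exact: delta_gt0. Qed.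

Lemma jacobi_sn_derive u :
  deriv_at u jacobi_sn (jacobi_cn k u * jacobi_dn u).
Proof.
by apply: derive_comp_pt; [exact: is_derive_sin|exact: jacobi_am_derive].
Qed.

Lemma jacobi_cn_derive u :
  deriv_at u (jacobi_cn k) (- (jacobi_sn u * jacobi_dn u)).
Proof.
rewrite -mulNr.
by apply: derive_comp_pt; [exact: is_derive_cos|exact: jacobi_am_derive].
Qed.

Lemma jacobi_dn_derive u :
  deriv_at u jacobi_dn (- (k ^+ 2 * (jacobi_sn u * jacobi_cn k u))).
Proof.
have d0 := jacobi_dn_gt0 u.
have dnE v : jacobi_dn v = Num.sqrt (1 - k ^+ 2 * (jacobi_sn v * jacobi_sn v)).
  by rewrite -expr2.
have H : deriv_at u (fun u => 1 - k ^+ 2 * (jacobi_sn u * jacobi_sn u))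
   (0 - k ^+ 2 * (jacobi_cn k u * jacobi_dn u * jacobi_sn u
                  + jacobi_sn u * (jacobi_cn k u * jacobi_dn u))).
  apply: deriveB_pt; first exact: deriv_at_cst.
  by apply: deriveZ_pt; apply: deriveM_pt; exact: jacobi_sn_derive.
have s0 : 0 < 1 - k ^+ 2 * (jacobi_sn u * jacobi_sn u).
  by rewrite -expr2 -jacobi_dn2 exprn_gt0.
have S : deriv_at (1 - k ^+ 2 * (jacobi_sn u * jacobi_sn u)) Num.sqrt
    (2 * jacobi_dn u)^-1 by rewrite dnE; exact: is_derive1_sqrt.
rewrite (_ : jacobi_dn = fun v => Num.sqrt (1 - k ^+ 2 * (jacobi_sn v * jacobi_sn v)));
  last exact/funext.
apply: deriv_at_eq; first exact: (@derive_comp_pt _ Num.sqrt (fun v =>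
  1 - k ^+ 2 * (jacobi_sn v * jacobi_sn v)) u _ _ S H).
by field; rewrite gt_eqF.
Qed.

End Amplitude.

(** * Comparison of solutions of linear second order equations *)

Section Sturm.
Context {R : realType}.
Implicit Types (a b c x z : R) (q y f : R -> R).
Local Notation mu := (@lebesgue_measure R).

(** The derivatives are two-sided at the end points too; every solution on a segment
    has such an extension, and one-sided rules are avoided. *)
Definition solves a b q y y1 : Prop := forall x, a <= x <= b ->
  deriv_at x y (y1 x) /\ deriv_at x y1 (q x * y x).

Lemma solves_sub a b c d q y y1 : c <= a -> b <= d ->
  solves c d q y y1 -> solves a b q y y1.
Proof.
by move=> ca bd s x /andP[ax xb]; apply: s; rewrite (le_trans ca) ?(le_trans xb).
Qed.

Lemma solves_eq a b q q' y y1 : (forall x, a <= x <= b -> q x = q' x) ->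
  solves a b q y y1 -> solves a b q' y y1.
Proof. by move=> qq s x xab; rewrite -qq//; exact: s. Qed.

Lemma solves_within a b q y y1 : solves a b q y y1 ->
  cont_on a b y.
Proof. by move=> s; apply: (@deriv_at_within _ _ _ _ y1) => x /s[]. Qed.

Lemma solves_within1 a b q y y1 : solves a b q y y1 ->
  cont_on a b y1.
Proof.
by move=> s; apply: (@deriv_at_within _ _ _ _ (fun x => q x * y x)) => x /s[].
Qed.

Lemma solves_comb a b q (c d : R) y y1 (z z1 : R -> R) :
  solves a b q y y1 -> solves a b q z z1 ->
  solves a b q (fun x => c * y x + d * z x) (fun x => c * y1 x + d * z1 x).
Proof.
move=> sy sz x xab; have [yd y1d] := sy x xab; have [zd z1d] := sz x xab.
split; first by apply: deriveD_pt; exact: deriveZ_pt.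
apply: deriv_at_eq; first by apply: deriveD_pt; apply: deriveZ_pt; eassumption.
by ring.
Qed.

Lemma solvesN a b q y y1 : solves a b q y y1 ->
  solves a b q (fun x => - y x) (fun x => - y1 x).
Proof.
move=> s x /s[yd y1d]; split; first exact: deriveN_pt.
by rewrite mulrN; exact: deriveN_pt.
Qed.

Lemma deriv_at_reflect c y x d : deriv_at (c - x) y d ->
  deriv_at x (fun t => y (c - t)) (- d).
Proof.
move=> yd; apply: (@deriv_at_eq _ _ _ (d * (0 - 1))); last by ring.
apply: (@derive_comp_pt _ y (fun t => c - t)) => //.
by apply: deriveB_pt; [exact: deriv_at_cst|exact: deriv_at_id].
Qed.

Lemma solves_reflect a b c q y y1 : solves (c - b) (c - a) q y y1 ->
  solves a b (fun x => q (c - x)) (fun x => y (c - x)) (fun x => - y1 (c - x)).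
Proof.
move=> s x /andP[ax xb]; have [|yd y1d] := s (c - x); first lra.
split; first exact: deriv_at_reflect.
by rewrite -[q _ * _]opprK; apply: deriveN_pt; exact: deriv_at_reflect.
Qed.

(** Gronwall: y ^ 2 + y' ^ 2 grows at most exponentially. *)
Lemma solves_unique0 a b q y y1 : cont_on a b q ->
  solves a b q y y1 -> y a = 0 -> y1 a = 0 -> forall x, a <= x <= b -> y x = 0.
Proof.
move=> /within_bounded[M M0 qM] s ya y1a x /andP[ax xb].
pose E t := - ((y t * y t + y1 t * y1 t) * expR (- (1 + M) * t + 0)).
pose E' t := - ((y1 t * y t + y t * y1 t + (q t * y t * y1 t + y1 t * (q t * y t)))
  * expR (- (1 + M) * t + 0) +
  (y t * y t + y1 t * y1 t) * (expR (- (1 + M) * t + 0) * - (1 + M))).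
have Ed t : a <= t <= x -> deriv_at t E (E' t).
  move=> /andP[at_ tx]; have [|yd y1d] := s t; first by rewrite at_ (le_trans tx).
  apply: deriveN_pt; apply: deriveM_pt.
    by apply: deriveD_pt; exact: deriveM_pt.
  by apply: derive_comp_pt; [exact: is_derive_expR|exact: derive_affine_pt].
have : E a <= E x.
  apply: (segment_ge0_le ax Ed) => t /andP[at_ tx].
  have := qM t; rewrite (ltW at_) (le_trans (ltW tx) xb) => /(_ isT).
  rewrite ler_norml => /andP[q1 q2].
  rewrite /E'; set e := expR _; have e0 : 0 < e by exact: expR_gt0.
  have -> : - ((y1 t * y t + y t * y1 t +
      (q t * y t * y1 t + y1 t * (q t * y t))) * e +
      (y t * y t + y1 t * y1 t) * (e * - (1 + M))) =
      e * ((y t - y1 t) ^+ 2 + (M * (y t ^+ 2 + y1 t ^+ 2) -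
        q t * (y t * y1 t *+ 2))) by ring.
  apply: mulr_ge0; first exact: ltW.
  apply: addr_ge0; first exact: sqr_ge0.
  have [p|p] := leP 0 (y t * y1 t *+ 2).
    have := sqr_ge0 (y t - y1 t); nra.
  have := sqr_ge0 (y t + y1 t); nra.
rewrite /E ya y1a mulr0 addr0 mul0r oppr0 oppr_ge0 pmulr_lle0 ?expR_gt0//.
move=> H; apply/eqP; rewrite -sqrf_eq0; apply/eqP.
have := sqr_ge0 (y x); have := sqr_ge0 (y1 x); nra.
Qed.

Lemma first_zero a b y : a <= b -> cont_on a b y ->
  y a != 0 -> y b = 0 -> exists x, [/\ a < x <= b, y x = 0 &
    forall t, a <= t < x -> y t != 0].
Proof.
move=> ab yc ya yb.
pose Z := [set x | a <= x <= b /\ y x = 0].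
have Zb : Z b by split; rewrite ?ab ?lexx.
have hZ : has_inf Z by split; [exists b|exists a => x [/andP[]]].
pose m := inf Z.
have mb : m <= b by exact: ge_inf hZ.2 _ Zb.
have am : a <= m by apply: lb_le_inf hZ.1 _ => x [/andP[]].
have ym : y m = 0.
  apply/eqP/negPn/negP => ym0.
  have gc := continuous_comp_clamp ab yc.
  have : \forall t \near m, y (clamp a b t) != 0.
    by apply: (cvgr_neq0 (y (clamp a b m)) (gc m)); rewrite clamp_id ?am.
  move=> /nbhs_ballP[e /= e0 He].
  have [t [/andP[at_ tb] yt] tm] := inf_adherent e0 hZ.
  have mt : m <= t by apply: ge_inf hZ.2 _ _; split; rewrite ?at_ ?tb.
  have /He : ball m e t.
    by rewrite /ball/= ler0_norm ?subr_le0// opprB ltrBlDl.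
  by rewrite clamp_id ?at_ ?tb// yt eqxx.
exists m; split => //.
- rewrite mb andbT lt_neqAle am andbT.
  by apply: contra_neq ya => ->.
- move=> t /andP[at_ tm]; apply/eqP => yt.
  have /(ge_inf hZ.2) : Z t by split; rewrite // at_ (le_trans (ltW tm)).
  by rewrite leNgt tm.
Qed.

Lemma deriv_neq0_near a y d : deriv_at a y d -> y a = 0 -> d != 0 ->
  exists2 e, 0 < e & forall x, a < x < a + e -> y x != 0.
Proof.
move=> [yd yv] ya d0.
have : h^-1 *: (y (h *: (1 : R) + a) - y a) @[h --> 0^'] --> d.
  by rewrite -yv; exact: yd.
move=> /cvgr_neq0 /(_ d0).
move=> [e /= e0 He]; exists e => // x /andP[ax xe].
have := He (x - a); rewrite /= sub0r normrN gtr0_norm ?subr_gt0// ltrBlDl.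
move=> /(_ xe); rewrite subr_eq0 => /(_ (negbT (gt_eqF ax))).
have -> : (x - a) *: (1 : R) + a = x by rewrite /GRing.scale/= mulr1 subrK.
rewrite ya subr0; apply: contra_neq => ->.
by rewrite scaler0.
Qed.

(** The zero at the left end, if there is one, is skipped: it is simple, hence
    isolated. *)
Lemma first_node a b q y y1 : a < b -> solves a b q y y1 ->
  (y a != 0) || (y1 a != 0) -> y b = 0 ->
  exists x, [/\ a < x <= b, y x = 0 & forall t, a < t < x -> y t != 0].
Proof.
move=> ab s ya yb; have yc := solves_within s.
have [ya0|ya0] := eqVneq (y a) 0; last first.
  have [x [xab yx xy]] := first_zero (ltW ab) yc ya0 yb.
  by exists x; split => // t /andP[at_ tx]; apply: xy; rewrite tx ltW.
move: ya; rewrite ya0 eqxx/= => y1a.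
have [|yd _] := s a; first by rewrite lexx ltW.
have [e e0 He] := deriv_neq0_near yd ya0 y1a.
pose c := a + e / 2.
have ac : a < c by rewrite ltrDl divr_gt0.
have yc0 t : a < t <= c -> y t != 0.
  by move=> /andP[at_ tc]; apply: He; rewrite at_/= (le_lt_trans tc)// /c; lra.
have cb : c <= b.
  rewrite leNgt; apply/negP => bc; have := yc0 b.
  by rewrite ab ltW// yb eqxx => /(_ isT).
have [|||x [/andP[cx xb] yx xy]] := @first_zero c b y cb.
- exact: within_subitv (ltW ac) (lexx b) yc.
- by apply: yc0; rewrite ac lexx.
- exact: yb.
exists x; split => //; first by rewrite xb (lt_trans ac).
move=> t /andP[at_ tx]; have [tc|ct] := leP t c; first by apply: yc0; rewrite at_.
by apply: xy; rewrite tx ltW.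
Qed.

Lemma neq0_cst_sign a b y : a < b -> cont_on a b y ->
  (forall t, a < t < b -> y t != 0) ->
  (forall t, a < t < b -> 0 < y t) \/ (forall t, a < t < b -> y t < 0).
Proof.
move=> ab yc y0.
have H s t : a < s < b -> a < t < b -> 0 < y s -> y t < 0 -> False.
  move=> /andP[as_ sb] /andP[at_ tb] ys yt.
  have [st|ts] := leP s t.
    have [||x] := @IVT R y s t 0 st.
    - exact: within_subitv (ltW as_) (ltW tb) yc.
    - by rewrite ge_min (ltW yt) orbT le_max (ltW ys).
    rewrite in_itv/= => /andP[sx xt] yx.
    by have := y0 x; rewrite (lt_le_trans as_ sx) (le_lt_trans xt)// yx eqxx => /(_ isT).
  have [||x] := @IVT R y t s 0 (ltW ts).
  - exact: within_subitv (ltW at_) (ltW sb) yc.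
  - by rewrite ge_min (ltW yt) le_max (ltW ys) orbT.
  rewrite in_itv/= => /andP[tx xs] yx.
  by have := y0 x; rewrite (lt_le_trans at_ tx) (le_lt_trans xs)// yx eqxx => /(_ isT).
pose m := (a + b) / 2; have mab : a < m < b by rewrite /m; lra.
have /orP[ym|ym] : (y m < 0) || (0 < y m) by rewrite -neq_lt y0.
- right => t tab; have := y0 t tab; rewrite neq_lt => /orP[//|yt].
  by case: (H t m tab mab yt ym).
- left => t tab; have := y0 t tab; rewrite neq_lt => /orP[yt|//].
  by case: (H m t mab tab ym yt).
Qed.

Lemma deriv_pos_left_le0 a b y y1 : a < b ->
  (forall x, a <= x <= b -> deriv_at x y (y1 x)) ->
  cont_on a b y1 ->
  (forall t, a < t < b -> 0 < y t) -> y b = 0 -> y1 b <= 0.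
Proof.
move=> ab yd y1c y0 yb; rewrite leNgt; apply/negP => y1b.
have /continuous_within_itvP := y1c; move=> /(_ ab)[_ _ +].
move=> /cvgr_gt/(_ _ y1b) [e /= e0 He].
pose c := Num.max ((a + b) / 2) (b - e / 2).
have ac : a < c by rewrite /c lt_max; apply/orP; left; lra.
have cb : c < b by rewrite /c gt_max; apply/andP; split; lra.
have ce : b - e < c by rewrite /c lt_max; apply/orP; right; lra.
have : y c < y b.
  apply: (@segment_gt0_lt _ c b y y1) => //.
    by move=> x /andP[cx xb]; apply: yd; rewrite xb (le_trans (ltW ac)).
  move=> x /andP[cx xb]; apply: He => //=.
  by rewrite gtr0_norm ?subr_gt0//; lra.
by rewrite yb ltNge ltW// y0// ac.
Qed.

Definition wronskian (y y1 f f1 : R -> R) x : R := y x * f1 x - y1 x * f x.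

Lemma wronskian_deriv a b q1 q2 y y1 f f1 : solves a b q1 y y1 ->
  solves a b q2 f f1 -> forall x, a <= x <= b ->
  deriv_at x (wronskian y y1 f f1) (y x * f x * (q2 x - q1 x)).
Proof.
move=> sy sf x xab; have [yd y1d] := sy x xab; have [fd f1d] := sf x xab.
apply: deriv_at_eq; first by apply: deriveB_pt; apply: deriveM_pt; eassumption.
by ring.
Qed.

(** Sturm comparison: as long as both functions are positive the Wronskian
    decreases strictly from 0, whereas at a zero of [y] it is nonnegative. *)
Lemma sturm_comparison a b q1 q2 y y1 f f1 : a < b ->
  solves a b q1 y y1 -> solves a b q2 f f1 ->
  (forall x, a < x < b -> q2 x < q1 x) ->
  wronskian y y1 f f1 a = 0 ->
  (forall x, a < x < b -> 0 < f x) -> 0 <= f b ->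
  (forall x, a < x < b -> y x != 0) -> y b = 0 -> False.
Proof.
move=> ab + sf q12 + f0 fb y0; wlog yp : y y1 y0 / forall x, a < x < b -> 0 < y x.
  move=> H sy W0 yb; have [yp|yn] := neq0_cst_sign ab (solves_within sy) y0.
    exact: (H y y1).
  apply: (H (fun x => - y x) (fun x => - y1 x)).
  - by move=> x /y0; rewrite oppr_eq0.
  - by move=> x /yn; rewrite oppr_gt0.
  - exact: solvesN.
  - by move: W0; rewrite /wronskian !mulNr -opprD => ->; rewrite oppr0.
  - by rewrite yb oppr0.
move=> sy W0 yb.
have y1b : y1 b <= 0.
  apply: (deriv_pos_left_le0 ab _ (solves_within1 sy) yp yb).
  by move=> x /sy[].
have : - wronskian y y1 f f1 a < - wronskian y y1 f f1 b.
  apply: (@segment_gt0_lt _ _ _ (fun x => - wronskian y y1 f f1 x)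
    (fun x => - (y x * f x * (q2 x - q1 x)))) => //.
    by move=> x xab; apply: deriveN_pt; exact: (wronskian_deriv sy sf).
  move=> x xab; rewrite -mulrN opprB mulr_gt0 ?subr_gt0 ?q12//.
  by rewrite mulr_gt0 ?yp ?f0.
rewrite W0 /wronskian yb mul0r sub0r opprK oppr0 ltNge.
by rewrite mulr_le0_ge0.
Qed.

(** What the oscillation argument has to know of the operator - al y'' + V y on
    [0, 2 l], with [V] symmetric about [l].  The eigenvalues are [lf] with the
    positive [f], 0 with the odd function [p], and [lg] with [g]; by symmetry only
    the half [0, l] matters, where an even solution satisfies Neumann conditions
    and an odd one Dirichlet conditions.  The last field says that [g] changes its
    sign at most once on [0, l], from plus to minus. *)
Record ground_state_data (al l lf lg : R) (V f f1 p p1 g g1 : R -> R) : Prop :=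
  GroundStateData {
  gs_al : 0 < al;
  gs_l : 0 < l;
  gs_lg : 0 < lg;
  gs_V : cont_on 0 (2 * l) V;
  gs_Vsym : forall x, V (2 * l - x) = V x;
  gs_f : solves 0 (2 * l) (fun x => (V x - lf) / al) f f1;
  gs_fsym : forall x, f (2 * l - x) = f x;
  gs_f0 : forall x, 0 < f x;
  gs_f10 : f1 0 = 0;
  gs_f1l : f1 l = 0;
  gs_p : solves 0 (2 * l) (fun x => V x / al) p p1;
  gs_psym : forall x, p (2 * l - x) = - p x;
  gs_pl : p 0 = 0;
  gs_p0 : forall x, 0 < x < l -> 0 < p x;
  gs_p10 : p1 0 != 0;
  gs_g : solves 0 (2 * l) (fun x => (V x - lg) / al) g g1;
  gs_g10 : g1 0 = 0;
  gs_g1l : g1 l = 0;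
  gs_gsign : forall x t, 0 <= x -> x < t -> t <= l -> 0 <= g t -> 0 < g x }.

Section GroundState.
Variables (al l lf lg : R) (V f f1 p p1 g g1 : R -> R).
Hypothesis H : ground_state_data al l lf lg V f f1 p p1 g g1.
Let al0 := gs_al H.
Let l0 := gs_l H.
Let ll2 : l <= 2 * l. Proof. by have := l0; lra. Qed.

Let Qc lam : cont_on 0 (2 * l) (fun x => (V x - lam) / al).
Proof.
apply: withinM; last exact: within_cst.
by apply: withinB; [exact: gs_V H|exact: within_cst].
Qed.

Lemma half_solves lam y y1 :
  solves 0 (2 * l) (fun x => (V x - lam) / al) y y1 ->
  solves 0 l (fun x => (V x - lam) / al) y y1.
Proof. exact: solves_sub. Qed.

Let Qcl lam : cont_on 0 l (fun x => (V x - lam) / al).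
Proof. exact: within_subitv (lexx _) ll2 (@Qc lam). Qed.

Let within_reflect c (u : R -> R) : cont_on 0 c u ->
  cont_on 0 c (fun x => u (c - x)).
Proof.
move=> uc; have [c0|c0] := leP 0 c; last first.
  by apply: continuous_within => x /andP[x0 /(le_trans x0)]; rewrite leNgt c0.
have ucc := continuous_comp_clamp c0 uc.
apply: (@within_eq _ _ _ (fun x => u (clamp 0 c (c - x)))).
  by move=> x /andP[x0 xc]; rewrite clamp_id// subr_ge0 xc gerBl.
apply: continuous_subspaceT => x.
apply: (@continuous_comp _ _ _ (fun x => c - x) (fun x => u (clamp 0 c x))).
  exact: deriv_at_continuous (deriveB_pt (deriv_at_cst c x) (deriv_at_id x)).
exact: ucc.
Qed.

(** If [lam] were not [lf], the Wronskian with [f] would be strictly monotone on [0, l],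
    but it vanishes at both ends. *)
Lemma neumann_positive_eigenvalue lam y y1 :
  solves 0 l (fun x => (V x - lam) / al) y y1 -> y1 0 = 0 -> y1 l = 0 ->
  (forall t, 0 < t < l -> 0 < y t) -> lam = lf.
Proof.
move=> sy y10 y1l yp; have sf := half_solves (gs_f H).
pose W := wronskian y y1 f f1; have Wd := wronskian_deriv sy sf.
have W0 : W 0 = 0 by rewrite /W /wronskian y10 (gs_f10 H) mulr0 mul0r subrr.
have Wl : W l = 0 by rewrite /W /wronskian y1l (gs_f1l H) mulr0 mul0r subrr.
have E t : y t * f t * ((V t - lf) / al - (V t - lam) / al) =
    y t * (f t * ((lam - lf) / al)) by field; rewrite gt_eqF.
case: (ltgtP lam lf) => [lt|lt|//].
- have : - W 0 < - W l.
    apply: (segment_gt0_lt l0 (fun t tl => deriveN_pt (Wd t tl))) => t tl.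
    rewrite E -mulrN mulr_gt0 ?yp// -mulrN mulr_gt0 ?(gs_f0 H)// -mulNr.
    by rewrite divr_gt0// oppr_gt0 subr_lt0.
  by rewrite W0 Wl ltxx.
- have : W 0 < W l.
    apply: (segment_gt0_lt l0 Wd) => t tl; rewrite E mulr_gt0 ?yp//.
    by rewrite mulr_gt0 ?(gs_f0 H)// divr_gt0// subr_gt0.
  by rewrite W0 Wl ltxx.
Qed.

(** An even solution solves a Neumann problem on [0, l].  Without zero there, it is
    positive up to its sign and belongs to [lf].  A solution with a zero is compared
    with [g], which oscillates more: on [0, x1] with the first zero x1 if [g] is
    nonnegative at x1, and otherwise, after reflection, on the part right of the
    last zero, where [g] is negative. *)
Lemma even_solution_eq0 lam y y1 :
  solves 0 l (fun x => (V x - lam) / al) y y1 -> y1 0 = 0 -> y1 l = 0 ->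
  lam != lf -> lam < lg -> forall x, 0 <= x <= l -> y x = 0.
Proof.
move=> sy y10 y1l lamf lamg.
have sg := half_solves (gs_g H).
pose rf (u : R -> R) x := u (l - x).
have sr lm u u1 : solves 0 l (fun x => (V x - lm) / al) u u1 ->
    solves 0 l (fun x => (V (l - x) - lm) / al) (rf u) (fun x => - u1 (l - x)).
  move=> su; apply: (@solves_reflect 0 l l (fun x => (V x - lm) / al)).
  by rewrite subrr subr0.
have Qcr lm : cont_on 0 l (fun x => (V (l - x) - lm) / al).
  exact: (within_reflect (@Qcl lm)).
apply: contrapT => /existsNP[x /not_implyP[xl /eqP yx]].
have y0 : y 0 != 0.
  apply: contra_neq yx => y0.
  exact: (solves_unique0 (@Qcl lam) sy y0 y10).
have yl : y l != 0.
  apply: contra_neq yx => yl.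
  have := solves_unique0 (@Qcr lam) (sr _ _ _ sy).
  rewrite /rf subr0 yl y1l oppr0 => /(_ erefl erefl (l - x)).
  by rewrite subKr; apply; lra.
have lamx lm t : lam < lm -> (V t - lm) / al < (V t - lam) / al.
  by move=> ?; rewrite ltr_pM2r ?invr_gt0//; lra.
have [[z [zl yz]]|nz] := pselect (exists z, 0 <= z <= l /\ y z = 0); last first.
  have ynz t : 0 <= t <= l -> y t != 0.
    by move=> tl; apply/eqP => yt; apply: nz; exists t.
  have inner t : 0 < t < l -> 0 <= t <= l by move=> /andP[? ?]; rewrite !ltW.
  have [yp|yn] := neq0_cst_sign l0 (solves_within sy) (fun t tl => ynz t (inner t tl)).
    by move/eqP: lamf; apply; exact: neumann_positive_eigenvalue sy y10 y1l yp.
  move/eqP: lamf; apply; apply: (neumann_positive_eigenvalue (solvesN sy)).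
  - by rewrite y10 oppr0.
  - by rewrite y1l oppr0.
  - by move=> t /yn; rewrite oppr_gt0.
have z0 : 0 < z.
  case/andP: zl => z0 _; rewrite lt_neqAle z0 andbT.
  by apply: contra_neq y0 => e; move: yz; rewrite -e.
have zl' : z <= l by case/andP: zl.
have [x1 [/andP[x10 x1z] yx1 ynz]] :=
  first_node z0 (solves_sub (lexx 0) zl' sy) (introT orP (or_introl y0)) yz.
have x1l : x1 <= l by exact: le_trans zl'.
have [gx1|gx1] := leP 0 (g x1).
  apply: (@sturm_comparison 0 x1 _ _ y y1 g g1 x10
    (solves_sub (lexx 0) x1l sy) (solves_sub (lexx 0) x1l sg)) => //.
  - by move=> t _; exact: lamx.
  - by rewrite /wronskian y10 (gs_g10 H) mulr0 mul0r subrr.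
  - by move=> t /andP[t0 tx]; apply: (gs_gsign H _ tx) => //; exact: ltW.
have x1l' : x1 < l.
  by rewrite lt_neqAle x1l andbT; apply: contra_neq yl => <-.
have lx1 : 0 < l - x1 by rewrite subr_gt0.
have lx1l : l - x1 <= l by rewrite gerBl ltW.
have ryx1 : rf y (l - x1) = 0 by rewrite /rf subKr.
have ry0 : (rf y 0 != 0) || (- y1 (l - 0) != 0) by rewrite /rf subr0 yl.
have [x2 [/andP[x20 x2x1] yx2 ynz2]] :=
  first_node lx1 (solves_sub (lexx 0) lx1l (sr _ _ _ sy)) ry0 ryx1.
have x2l : x2 <= l by exact: le_trans lx1l.
have gneg t : 0 <= t <= x2 -> g (l - t) < 0.
  move=> /andP[t0 tx2]; rewrite ltNge; apply/negP => gt.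
  have [e|ne] := eqVneq x1 (l - t).
    by move: gt; rewrite -e leNgt gx1.
  have : 0 < g x1.
    apply: (gs_gsign H (ltW x10) _ _ gt); last by rewrite gerBl.
    by rewrite lt_neqAle ne/= lerBrDr -lerBrDl (le_trans tx2).
  by rewrite ltNge ltW.
apply: (@sturm_comparison 0 x2 _ _ (rf y) (fun x => - y1 (l - x))
    (fun x => - rf g x) (fun x => - - g1 (l - x)) x20
    (solves_sub (lexx 0) x2l (sr _ _ _ sy))
    (solvesN (solves_sub (lexx 0) x2l (sr _ _ _ sg)))) => //.
- by move=> t _; exact: lamx.
- by rewrite /wronskian subr0 y1l (gs_g1l H) !oppr0 mulr0 mul0r subrr.
- by move=> t /andP[t0 tx]; rewrite oppr_gt0 gneg// (ltW t0) ltW.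
- by rewrite oppr_ge0 ltW// gneg// lexx ltW.
Qed.

(** For [lam] < 0 a solution oscillates less than [p], which vanishes at 0 and stays
    positive until [l]. *)
Lemma odd_solution_eq0 lam y y1 :
  solves 0 (2 * l) (fun x => (V x - lam) / al) y y1 -> y 0 = 0 -> y l = 0 ->
  lam < 0 -> forall x, 0 <= x <= 2 * l -> y x = 0.
Proof.
move=> sy y0 yl lam0; apply: (solves_unique0 (@Qc lam) sy y0).
apply: contrapT => /eqP y10.
have nt : (y 0 != 0) || (y1 0 != 0) by rewrite y10 orbT.
have [x1 [/andP[x10 x1l] yx1 ynz]] := first_node l0 (half_solves sy) nt yl.
have x1l2 : x1 <= 2 * l by exact: le_trans ll2.
have pl : p l = 0.
  have := gs_psym H l; have -> : 2 * l - l = l by ring.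
  by move=> /eqP; rewrite -addr_eq0 -mulr2n mulrn_eq0 => /eqP.
apply: (@sturm_comparison 0 x1 _ _ y y1 p p1 x10
    (solves_sub (lexx 0) x1l2 sy) (solves_sub (lexx 0) x1l2 (gs_p H))) => //.
- by move=> t _; rewrite ltr_pM2r ?invr_gt0//; lra.
- by rewrite /wronskian y0 (gs_pl H) mulr0 mul0r subrr.
- by move=> t /andP[t0 tx]; apply: (gs_p0 H); rewrite t0 (lt_le_trans tx).
- have [->|x1n] := eqVneq x1 l; first by rewrite pl.
  by apply/ltW/(gs_p0 H); rewrite x10 lt_neqAle x1n.
Qed.

Definition even_part (y : R -> R) x := (y x + y (2 * l - x)) / 2.
Definition odd_part (y : R -> R) x := (y x - y (2 * l - x)) / 2.

Lemma parts_solve lam y y1 :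
  solves 0 (2 * l) (fun x => (V x - lam) / al) y y1 ->
  solves 0 (2 * l) (fun x => (V x - lam) / al) (even_part y) (odd_part y1) /\
  solves 0 (2 * l) (fun x => (V x - lam) / al) (odd_part y) (even_part y1).
Proof.
move=> sy.
have sr : solves 0 (2 * l) (fun x => (V x - lam) / al)
    (fun x => y (2 * l - x)) (fun x => - y1 (2 * l - x)).
  apply: (@solves_eq _ _ (fun x => (V (2 * l - x) - lam) / al)).
    by move=> x _; rewrite (gs_Vsym H).
  by apply: (@solves_reflect 0 (2 * l) (2 * l) (fun x => (V x - lam) / al));
    rewrite subrr subr0.
split.
- have := solves_comb 2^-1 2^-1 sy sr.
  by congr (solves _ _ _ _ _); apply/funext => x;
    rewrite /even_part /odd_part; field.
- have := solves_comb 2^-1 (- 2^-1) sy sr.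
  by congr (solves _ _ _ _ _); apply/funext => x;
    rewrite /even_part /odd_part; field.
Qed.

Lemma even_odd_sum y x : y x = even_part y x + odd_part y x.
Proof. by rewrite /even_part /odd_part; field. Qed.

Lemma even_part_vanish y : (forall x, 0 <= x <= l -> even_part y x = 0) ->
  forall x, 0 <= x <= 2 * l -> even_part y x = 0.
Proof.
move=> e0 x /andP[x0 xl]; have [xl'|xl'] := leP x l; first by rewrite e0 ?x0.
have <- : even_part y (2 * l - x) = even_part y x.
  by rewrite /even_part subKr addrC.
by apply: e0; lra.
Qed.

Section Periodic.
Variables (lam : R) (y y1 : R -> R).
Hypothesis sy : solves 0 (2 * l) (fun x => (V x - lam) / al) y y1.
Hypothesis yper : y 0 = y (2 * l).
Hypothesis y1per : y1 0 = y1 (2 * l).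

Let se := (parts_solve sy).1.
Let so := (parts_solve sy).2.

Let e10 : odd_part y1 0 = 0. Proof. by rewrite /odd_part subr0 y1per; field. Qed.
Let e1l : odd_part y1 l = 0.
Proof. by rewrite /odd_part (_ : 2 * l - l = l); [field|ring]. Qed.
Let o0 : odd_part y 0 = 0. Proof. by rewrite /odd_part subr0 yper; field. Qed.
Let ol : odd_part y l = 0.
Proof. by rewrite /odd_part (_ : 2 * l - l = l); [field|ring]. Qed.

Lemma negative_solution_eq0 : lam < 0 -> lam != lf ->
  forall x, 0 <= x <= 2 * l -> y x = 0.
Proof.
move=> lam0 lamf x xl; rewrite even_odd_sum (odd_solution_eq0 so o0 ol lam0 xl).
rewrite addr0; apply: even_part_vanish xl.
apply: (even_solution_eq0 (half_solves se) e10 e1l lamf).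
exact: lt_trans (gs_lg H).
Qed.

Lemma ground_solution : lam < 0 -> lam = lf ->
  exists c, forall x, 0 <= x <= 2 * l -> y x = c * f x.
Proof.
move=> lam0 lamf; pose c := even_part y 0 / f 0.
have f0 := gs_f0 H 0.
exists c => x xl; rewrite even_odd_sum (odd_solution_eq0 so o0 ol lam0 xl) addr0.
apply/eqP; rewrite -subr_eq0; apply/eqP.
have sf : solves 0 (2 * l) (fun x => (V x - lam) / al) f f1.
  by rewrite lamf; exact: gs_f H.
have := solves_unique0 (@Qc lam) (solves_comb 1 (- c) se sf).
rewrite e10 (gs_f10 H) !mulr0 addr0.
have -> : 1 * even_part y 0 + - c * f 0 = 0.
  by rewrite /c mul1r mulNr divfK ?subrr// gt_eqF.
by move=> /(_ erefl erefl x xl); rewrite mul1r mulNr.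
Qed.

(** The even part vanishes since 0 is below [lg] and is not [lf]; the odd part
    is determined by its derivative at 0. *)
Lemma kernel_solution : lam = 0 -> lf != 0 ->
  exists c, forall x, 0 <= x <= 2 * l -> y x = c * p x.
Proof.
move=> lam0 lf0; pose c := even_part y1 0 / p1 0.
exists c => x xl; rewrite even_odd_sum (even_part_vanish _ xl) ?add0r; last first.
  by apply: (even_solution_eq0 (half_solves se) e10 e1l); rewrite lam0 1?eq_sym ?(gs_lg H).
apply/eqP; rewrite -subr_eq0; apply/eqP.
have sp : solves 0 (2 * l) (fun x => (V x - lam) / al) p p1.
  by apply: solves_eq (gs_p H) => t _; rewrite lam0 subr0.
have := solves_unique0 (@Qc lam) (solves_comb 1 (- c) so sp).
rewrite o0 (gs_pl H) !mulr0 addr0.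
have -> : 1 * even_part y1 0 + - c * p1 0 = 0.
  by rewrite /c mul1r mulNr divfK ?subrr// (gs_p10 H).
by move=> /(_ erefl erefl x xl); rewrite mul1r mulNr.
Qed.

End Periodic.
End GroundState.

End Sturm.

(** * The linearized operator at the cnoidal wave as a Lame operator *)

Section Lame.
Context {R : realType}.
Variables (L k : R).
Hypotheses (hL : 0 < L) (hk : 0 < k < 1).
Implicit Types (x t lam be : R).

Let k0 : 0 < k. Proof. by case/andP: hk. Qed.
Let k20 : 0 < k ^+ 2. Proof. by case/andP: (sqr_modulus_lt1 hk). Qed.
Let k21 : k ^+ 2 < 1. Proof. by case/andP: (sqr_modulus_lt1 hk). Qed.
Let K0 : 0 < ellK k. Proof. exact: ellK_gt0. Qed.

Definition wave_r : R := Num.sqrt (k ^+ 4 - k ^+ 2 + 1).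
Local Notation r := wave_r.
Definition wave_scale : R := 2 * ellK k / L.
Local Notation kap := wave_scale.
Definition wave : R -> R := cnoidal L k (coef_a L k).
Definition wave_al : R := - coef_a L k.
Local Notation al := wave_al.

Local Notation sn x := (jacobi_sn k (kap * x)).
Local Notation cn x := (jacobi_cn k (kap * x)).
Local Notation dn x := (jacobi_dn k (kap * x)).

Lemma wave_r_gt0 : 0 < r.
Proof.
rewrite sqrtr_gt0 (_ : k ^+ 4 = (k ^+ 2) ^+ 2); last by rewrite -exprM.
by have := k21; have := sqr_ge0 (k ^+ 2); lra.
Qed.

Lemma sqr_wave_r : r ^+ 2 = k ^+ 4 - k ^+ 2 + 1.
Proof. by rewrite sqr_sqrtr// ltW//; move: wave_r_gt0; rewrite sqrtr_gt0. Qed.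

Lemma wave_scale_gt0 : 0 < kap.
Proof. by rewrite divr_gt0// mulr_gt0. Qed.

(** The definition of [coef_a] makes - al d^2/dx^2 equal to (4 r)^-1 times minus the
    second derivative with respect to the Jacobi argument. *)
Lemma wave_alE : al = (4 * r * kap ^+ 2)^-1.
Proof.
rewrite /al /coef_a -/r opprK /wave_scale.
by field; rewrite !gt_eqF// ?wave_r_gt0.
Qed.

Lemma wave_al_gt0 : 0 < al.
Proof.
rewrite wave_alE invr_gt0; apply: mulr_gt0.
  by rewrite mulr_gt0// wave_r_gt0.
by rewrite exprn_gt0// wave_scale_gt0.
Qed.

Lemma waveE x : wave x = ((2 * k ^+ 2 - 1) / r - 1) / 2
  - 3 * k ^+ 2 / (2 * r) * cn x ^+ 2.
Proof.
rewrite /wave /cnoidal /coef_b0 /coef_b2 /coef_a -/r -/kap.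
by field; rewrite !gt_eqF// ?wave_r_gt0.
Qed.

Lemma wave_lt0 x : wave x < 0.
Proof.
have r0 := wave_r_gt0.
have h1 : (2 * k ^+ 2 - 1) / r < 1.
  rewrite ltr_pdivrMr// mul1r.
  have [h|h] := leP (2 * k ^+ 2 - 1) 0; first exact: le_lt_trans r0.
  rewrite -(@ltr_pXn2r _ 2) ?nnegrE ?ltW// sqr_wave_r.
  rewrite (_ : k ^+ 4 = (k ^+ 2) ^+ 2); last by rewrite -exprM.
  by have := k20; have := k21; nra.
have h2 : 0 <= 3 * k ^+ 2 / (2 * r) * cn x ^+ 2.
  by rewrite mulr_ge0 ?sqr_ge0// divr_ge0 ?mulr_ge0 ?(ltW r0)// ltW.
by rewrite waveE; lra.
Qed.

Definition wave_pot x : R := 1 + 2 * wave x.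

Lemma wave_pot_shift lam x : (wave_pot x - lam) / al =
  kap ^+ 2 * (12 * k ^+ 2 * sn x ^+ 2 - 4 * (1 + k ^+ 2) - 4 * r * lam).
Proof.
rewrite wave_alE /wave_pot waveE jacobi_cn2 invrK.
by field; rewrite gt_eqF ?wave_r_gt0.
Qed.

Lemma scale_comp_derive (f : R -> R) x d : deriv_at (kap * x) f d ->
  deriv_at x (fun y => f (kap * y)) (kap * d).
Proof.
move=> fd; rewrite mulrC; apply: (@derive_comp_pt _ f (fun y => kap * y)) => //.
by rewrite -[X in deriv_at _ _ X]mulr1; apply: deriveZ_pt; exact: deriv_at_id.
Qed.

Let snd x : deriv_at x (fun y => sn y) (kap * (cn x * dn x)).
Proof. by apply: scale_comp_derive; exact: jacobi_sn_derive. Qed.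
Let cnd x : deriv_at x (fun y => cn y) (kap * - (sn x * dn x)).
Proof. by apply: scale_comp_derive; exact: jacobi_cn_derive. Qed.
Let dnd x : deriv_at x (fun y => dn y) (kap * - (k ^+ 2 * (sn x * cn x))).
Proof. by apply: scale_comp_derive; exact: jacobi_dn_derive. Qed.

Definition wave1 x : R := 3 * k ^+ 2 / r * kap * (sn x * cn x * dn x).
Definition wave2 x : R := 3 * k ^+ 2 / r * kap ^+ 2 *
  (cn x ^+ 2 * dn x ^+ 2 - sn x ^+ 2 * dn x ^+ 2 - k ^+ 2 * (sn x ^+ 2 * cn x ^+ 2)).

Lemma wave_derive x : deriv_at x wave (wave1 x).
Proof.
have -> : wave = fun x => ((2 * k ^+ 2 - 1) / r - 1) / 2
  - 3 * k ^+ 2 / (2 * r) * (cn x * cn x).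
  by apply/funext => y; rewrite waveE expr2.
apply: deriv_at_eq.
  apply: deriveB_pt; first exact: deriv_at_cst.
  by apply: deriveZ_pt; apply: deriveM_pt; exact: cnd.
by rewrite /wave1; field; rewrite gt_eqF ?wave_r_gt0.
Qed.

Lemma wave1_derive x : deriv_at x wave1 (wave2 x).
Proof.
rewrite /wave1; apply: deriv_at_eq.
  apply: deriveZ_pt; apply: deriveM_pt; last exact: dnd.
  by apply: deriveM_pt; [exact: snd|exact: cnd].
by rewrite /wave2; ring.
Qed.

Ltac derive_jacobi := repeat first
  [ exact: snd | exact: cnd | exact: dnd | exact: deriv_at_cst
  | apply: deriveM_pt | apply: deriveB_pt | apply: deriveD_pt ].

Lemma wave1_solves a b : solves a b (fun x => wave_pot x / al) wave1 wave2.
Proof.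
move=> x _; split; first exact: wave1_derive.
have := wave_pot_shift 0 x; rewrite subr0 mulr0 subr0 => ->.
have -> : wave2 = fun x => 3 * k ^+ 2 / r * kap ^+ 2 * (cn x * cn x * (dn x * dn x)
    - sn x * sn x * (dn x * dn x) - k ^+ 2 * (sn x * sn x * (cn x * cn x))).
  by apply/funext => y; rewrite /wave2 !expr2.
apply: deriv_at_eq; first by derive_jacobi.
rewrite /wave1; set C := _ / r.
set s := sn x; set c := cn x; set d := dn x.
transitivity (C * kap ^+ 3 * (s * c * d) *
  (- 4 * (d ^+ 2 + k ^+ 2 * c ^+ 2 - k ^+ 2 * s ^+ 2))); first by ring.
by rewrite /c /d jacobi_cn2 jacobi_dn2// -/s; ring.
Qed.

(** Among the Lame functions of degree 3 these are dn times a polynomial in sn^2: the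
    ansatz dn (1 - be sn^2) solves the equation when [be] is a root of
    be^2 - (2 + 4 k^2) be + 5 k^2.  The smaller root is less than 1, which makes the
    function positive; the larger one gives the eigenvalue lg. *)
Definition lame_even be x : R := dn x * (1 - be * (sn x * sn x)).
Definition lame_even1 be x : R := - kap * (sn x * cn x *
  (k ^+ 2 * (1 - be * (sn x * sn x)) + 2 * be * (dn x * dn x))).
Definition lame_value be : R := (2 * be - 3 * k ^+ 2 - 4) / (4 * r).

Lemma lame_even_solves be a b : be ^+ 2 - (2 + 4 * k ^+ 2) * be + 5 * k ^+ 2 = 0 ->
  solves a b (fun x => (wave_pot x - lame_value be) / al)
    (lame_even be) (lame_even1 be).
Proof.
move=> hbe x _; split.
  rewrite /lame_even /lame_even1; apply: deriv_at_eq; first by derive_jacobi.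
  by cbv beta; ring.
rewrite wave_pot_shift.
have -> : 4 * r * lame_value be = 2 * be - 3 * k ^+ 2 - 4.
  by rewrite /lame_value; field; rewrite gt_eqF ?wave_r_gt0.
rewrite /lame_even1; apply: deriv_at_eq; first by derive_jacobi.
rewrite /lame_even; set s := sn x; set c := cn x; set d := dn x.
transitivity (- kap ^+ 2 * d * ((c ^+ 2 - s ^+ 2) *
   (k ^+ 2 * (1 - be * s ^+ 2) + 2 * be * d ^+ 2)
   - 6 * be * k ^+ 2 * s ^+ 2 * c ^+ 2)); first by ring.
rewrite /c /d jacobi_cn2 jacobi_dn2// -/s -/d.
have E : be ^+ 2 = (2 + 4 * k ^+ 2) * be - 5 * k ^+ 2 by lra.
transitivity (kap ^+ 2 * d * ((12 * k ^+ 2 * s ^+ 2 - k ^+ 2 - 2 * be)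
  - be * s ^+ 2 * (12 * k ^+ 2 * s ^+ 2 - k ^+ 2)
  + 2 * be ^+ 2 * s ^+ 2)); last by ring.
by rewrite E; ring.
Qed.

Definition lame_w : R := Num.sqrt (4 * k ^+ 4 - k ^+ 2 + 1).
Local Notation w := lame_w.

Let k4 : k ^+ 4 = (k ^+ 2) ^+ 2. Proof. by rewrite -exprM. Qed.

Lemma sqr_lame_w : w ^+ 2 = 4 * (k ^+ 2) ^+ 2 - k ^+ 2 + 1.
Proof.
rewrite sqr_sqrtr k4//.
by have := k20; have := k21; have := sqr_ge0 (k ^+ 2); lra.
Qed.

Let w0 : 0 <= w. Proof. exact: sqrtr_ge0. Qed.

Definition be_minus : R := 1 + 2 * k ^+ 2 - w.
Definition be_plus : R := 1 + 2 * k ^+ 2 + w.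

Lemma be_minus_root :
  be_minus ^+ 2 - (2 + 4 * k ^+ 2) * be_minus + 5 * k ^+ 2 = 0.
Proof.
transitivity (w ^+ 2 - (1 + 2 * k ^+ 2) ^+ 2 + 5 * k ^+ 2).
  by rewrite /be_minus; ring.
by rewrite sqr_lame_w; ring.
Qed.

Lemma be_plus_root :
  be_plus ^+ 2 - (2 + 4 * k ^+ 2) * be_plus + 5 * k ^+ 2 = 0.
Proof.
transitivity (w ^+ 2 - (1 + 2 * k ^+ 2) ^+ 2 + 5 * k ^+ 2).
  by rewrite /be_plus; ring.
by rewrite sqr_lame_w; ring.
Qed.

Lemma be_minus_lt1 : be_minus < 1.
Proof.
suff : 2 * k ^+ 2 < w by rewrite /be_minus; lra.
rewrite -(@ltr_pXn2r _ 2) ?nnegrE ?mulr_ge0 ?(ltW k20) ?(ltW k0) ?w0//.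
rewrite exprMn sqr_lame_w.
by have := k21; lra.
Qed.

Lemma lame_value_minus_lt0 : lame_value be_minus < 0.
Proof.
rewrite /lame_value pmulr_llt0 ?invr_gt0 ?mulr_gt0 ?wave_r_gt0//.
by rewrite /be_minus; have := k21; have := w0; lra.
Qed.

Lemma lame_value_plus_gt0 : 0 < lame_value be_plus.
Proof.
rewrite /lame_value divr_gt0 ?mulr_gt0 ?wave_r_gt0//.
suff : 2 - k ^+ 2 < 2 * w by rewrite /be_plus; lra.
have k2 := k20; have k2' := k21.
rewrite -(@ltr_pXn2r _ 2) ?nnegrE ?mulr_ge0 ?w0//; last by lra.
by rewrite exprMn sqr_lame_w; nra.
Qed.

Definition half_period : R := L / 2.
Local Notation l := half_period.

Let kapl : kap * l = ellK k.
Proof. by rewrite /wave_scale /half_period; field; rewrite gt_eqF. Qed.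

Let sn0 : sn 0 = 0.
Proof. by rewrite mulr0 /jacobi_sn jacobi_am0// sin0. Qed.
Let cn0 : cn 0 = 1.
Proof. by rewrite mulr0 /jacobi_cn jacobi_am0// cos0. Qed.
Let dn0 : dn 0 = 1.
Proof.
by rewrite mulr0 /jacobi_dn jacobi_am0// /delta /delta2 sin0 expr0n mulr0 subr0 sqrtr1.
Qed.
Let cnl : cn l = 0.
Proof. by rewrite kapl /jacobi_cn jacobi_amK_half// cos_pihalf. Qed.

Let am_reflect x : jacobi_am k (kap * (2 * l - x)) = pi - jacobi_am k (kap * x).
Proof.
rewrite mulrBr mulrCA kapl addrC jacobi_amD2K// jacobi_amN// addrC//.
Qed.

Let sn_reflect x : sn (2 * l - x) = sn x.
Proof. by rewrite /jacobi_sn am_reflect addrC sinDpi sinN opprK. Qed.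
Let cn_reflect x : cn (2 * l - x) = - cn x.
Proof. by rewrite /jacobi_cn am_reflect addrC cosDpi cosN. Qed.
Let dn_reflect x : dn (2 * l - x) = dn x.
Proof.
have := sn_reflect x; rewrite /jacobi_sn => snE.
by rewrite /jacobi_dn /delta /delta2 snE.
Qed.

Lemma wave_reflect x : wave (2 * l - x) = wave x.
Proof. by rewrite !waveE cn_reflect sqrrN. Qed.

Lemma wave_periodic x : wave (x + L) = wave x.
Proof.
rewrite !waveE mulrDr (_ : kap * L = 2 * ellK k).
  by rewrite /jacobi_cn jacobi_amD2K// cosDpi sqrrN.
by rewrite /wave_scale; field; rewrite gt_eqF.
Qed.

Let am_in x : 0 <= x <= l -> 0 <= jacobi_am k (kap * x) <= pi / 2.
Proof.
move=> /andP[x0 xl]; rewrite -(jacobi_am0 hk) -(jacobi_amK_half hk) -kapl.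
rewrite -(mulr0 kap) !(le_mono (jacobi_am_lt hk)).
by rewrite !(ler_pM2l wave_scale_gt0) x0.
Qed.

Let sn_ge0 x : 0 <= x <= l -> 0 <= sn x.
Proof.
move=> /am_in/andP[a0 al]; apply: sin_ge0_pi; rewrite a0/=.
by apply: le_trans al _; have := @pi_ge0 R; lra.
Qed.

Let sn_lt x t : 0 <= x -> x < t -> t <= l -> sn x < sn t.
Proof.
move=> x0 xt tl; have pi0 := @pi_ge0 R.
have /am_in/andP[a1 a2] : 0 <= x <= l by rewrite x0 (le_trans (ltW xt)).
have /am_in/andP[b1 b2] : 0 <= t <= l by rewrite tl (le_trans x0)// ltW.
rewrite /jacobi_sn ltr_sin ?in_itv/= ?a2 ?b2 ?andbT; [|lra|lra].
by apply: jacobi_am_lt => //; rewrite ltr_pM2l ?wave_scale_gt0.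
Qed.

Lemma wave1_gt0 x : 0 < x < l -> 0 < wave1 x.
Proof.
move=> /andP[x0 xl]; have ax0 : 0 < jacobi_am k (kap * x).
  by rewrite -(jacobi_am0 hk); apply: jacobi_am_lt => //; rewrite mulr_gt0 ?wave_scale_gt0.
have axl : jacobi_am k (kap * x) < pi / 2.
  rewrite -(jacobi_amK_half hk) -kapl; apply: jacobi_am_lt => //.
  by rewrite ltr_pM2l ?wave_scale_gt0.
have pi0 := @pi_gt0 R.
rewrite /wave1 !mulr_gt0 ?invr_gt0 ?wave_r_gt0 ?wave_scale_gt0 ?jacobi_dn_gt0//.
  by apply: sin_gt0_pihalf; rewrite ax0.
by apply: cos_gt0_pihalf; rewrite axl andbT; lra.
Qed.

Lemma wave_pot_cont a b : cont_on a b wave_pot.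
Proof.
apply: withinD; first exact: within_cst.
apply: withinM; first exact: within_cst.
by apply: (@deriv_at_within _ _ _ _ wave1) => x _; exact: wave_derive.
Qed.

Definition ground_state : R -> R := lame_even be_minus.

Lemma wave_ground_state : ground_state_data al l
  (lame_value be_minus) (lame_value be_plus) wave_pot
  ground_state (lame_even1 be_minus) wave1 wave2
  (lame_even be_plus) (lame_even1 be_plus).
Proof.
split.
- exact: wave_al_gt0.
- by rewrite divr_gt0.
- exact: lame_value_plus_gt0.
- exact: wave_pot_cont.
- by move=> x; rewrite /wave_pot wave_reflect.
- exact: lame_even_solves be_minus_root.
- by move=> x; rewrite /ground_state /lame_even dn_reflect sn_reflect.
- move=> x; rewrite /ground_state /lame_even mulr_gt0 ?jacobi_dn_gt0// -expr2.
  have := be_minus_lt1; have := sin2_le1 (jacobi_am k (kap * x)).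
  rewrite -/(jacobi_sn k (kap * x)) => s1 b1; have := sqr_ge0 (sn x).
  rewrite le_eqVlt => /predU1P[<-|s0]; first by rewrite mulr0 subr0.
  suff : 0 < (1 - be_minus) * sn x ^+ 2 by lra.
  by rewrite mulr_gt0// subr_gt0.
- by rewrite /lame_even1 sn0 !mul0r mulr0.
- by rewrite /lame_even1 cnl mulr0 mul0r mulr0.
- exact: wave1_solves.
- by move=> x; rewrite /wave1 sn_reflect cn_reflect dn_reflect; ring.
- by rewrite /wave1 sn0 !mul0r mulr0.
- exact: wave1_gt0.
- rewrite /wave2 sn0 cn0 dn0 expr0n/= expr1n !mul0r mulr0 !subr0 !mulr1.
  by rewrite gt_eqF// !mulr_gt0 ?invr_gt0 ?wave_r_gt0 ?exprn_gt0 ?wave_scale_gt0//.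
- exact: lame_even_solves be_plus_root.
- by rewrite /lame_even1 sn0 !mul0r mulr0.
- by rewrite /lame_even1 cnl mulr0 mul0r mulr0.
- move=> x t x0 xt tl; rewrite /lame_even !pmulr_rge0 ?pmulr_rgt0 ?jacobi_dn_gt0//.
  have st := sn_lt x0 xt tl.
  have sx : 0 <= sn x by apply: sn_ge0; rewrite x0 (le_trans (ltW xt)).
  have be0 : 0 < be_plus by rewrite /be_plus; have := k20; have := w0; lra.
  have : sn x * sn x < sn t * sn t by nra.
  by rewrite -(ltr_pM2l be0); lra.
Qed.

End Lame.

(** * Square integrable functions on a period *)

Section SquareIntegrable.
Context {R : realType}.
Variable L : R.
Implicit Types (f g h : R -> R) (x : R).
Local Notation mu := (@lebesgue_measure R).
Local Notation I := (`[0, L]%classic : set R).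

(** [period_measure] is Lebesgue measure restricted to a period, but as a measure on
    the whole line. *)
Lemma integral_period_measure (f : R -> \bar R) :
  measurable_fun [set: R] f ->
  (forall x, 0 <= f x)%E ->
  (\int[period_measure L]_x f x = \int[mu]_(x in I) f x)%E.
Proof.
move=> mf f0.
have mI : measurable I by exact: measurable_itv.
have -> : [set: R] = I `|` ~` I by rewrite setUv.
rewrite ge0_integral_setU//=; last 3 first.
- exact: measurableC.
- by rewrite setUv.
- exact/disj_setPCl.
rewrite (@eq_measure_integral _ _ _ _ mu); last first.
  by move=> A mA AI; rewrite /period_measure/= /mrestr setIidl.
rewrite [X in (_ + X)%E](_ : _ = 0%E) ?adde0//.
apply: null_set_integral => //.
- exact: measurableC.
- exact: measurable_funTS.
- by rewrite /period_measure/= /mrestr setICl measure0.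
Qed.

(** Membership of a real function in the space of square integrable functions on a
    period, in terms of integrability only. *)
Definition L2r f : Prop := measurable_fun setT f /\
  mu.-integrable I (EFin \o (fun x => f x ^+ 2)).

Lemma L2r_LfunP f : f \in Lfun (period_measure L) 2%:E <-> L2r f.
Proof.
have powE x : `|f x| `^ 2 = f x ^+ 2 by rewrite powR_mulrn// real_normK ?num_real.
split.
- move=> fL; have mf : measurable_fun setT f.
    by move: fL; rewrite inE => /andP[]; rewrite inE.
  split => //; have mf2 : measurable_fun setT (EFin \o (fun x => f x ^+ 2)).
    by apply/measurable_EFinP; exact: measurable_funX.
  have /integrableP[_] := Lfun2_integrable_sqr fL.
  rewrite integral_period_measure//; last exact: measurableT_comp.
  move=> foo; apply/integrableP; split => //.
  exact: measurable_funTS.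
- move=> [mf /integrableP[_ foo]]; rewrite inE; apply/andP; split; rewrite inE//=.
  rewrite /finite_norm unlock /= poweR_lty//.
  under eq_integral do rewrite powE.
  rewrite integral_period_measure; last 2 first.
  - by apply/measurable_EFinP; exact: measurable_funX.
  - by move=> x; rewrite lee_fin sqr_ge0.
  apply: le_lt_trans foo.
  by under [leRHS]eq_integral do rewrite /= ger0_norm ?sqr_ge0//.
Qed.

Lemma integrable_itv_le f g : measurable_fun setT f ->
  mu.-integrable I (EFin \o g) -> (forall x, 0 <= x <= L -> `|f x| <= g x) ->
  mu.-integrable I (EFin \o f).
Proof.
move=> mf gi fg; apply: (le_integrable _ _ _ gi) => //.
  by apply/measurable_EFinP; exact: measurable_funTS.
move=> x /=; rewrite in_itv/= lee_fin => xL.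
by rewrite (le_trans (fg x xL)) ?ler_norm.
Qed.

Lemma integrable_itv_cst c : mu.-integrable I (EFin \o (fun=> c)).
Proof. by apply: within_integrable; exact: within_cst. Qed.

Lemma integrable_itvD f g : mu.-integrable I (EFin \o f) ->
  mu.-integrable I (EFin \o g) -> mu.-integrable I (EFin \o (fun x => f x + g x)).
Proof. by move=> fi gi; have := integrableD _ fi gi; exact. Qed.

Lemma integrable_itvB f g : mu.-integrable I (EFin \o f) ->
  mu.-integrable I (EFin \o g) -> mu.-integrable I (EFin \o (fun x => f x - g x)).
Proof. by move=> fi gi; have := integrableB _ fi gi; exact. Qed.

Lemma integrable_itvZ c f : mu.-integrable I (EFin \o f) ->
  mu.-integrable I (EFin \o (fun x => c * f x)).
Proof. by move=> fi; have := integrableZl _ c fi; exact. Qed.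

Lemma integrable_itvM f g : mu.-integrable I (EFin \o f) -> cont_on 0 L g ->
  mu.-integrable I (EFin \o (fun x => f x * g x)).
Proof.
move=> fi gc; have [M M0 gM] := within_bounded gc.
have := @integrableMl _ _ _ mu I (measurable_itv _) _ g fi; apply.
  by apply: subspace_continuous_measurable_fun => //; exact: gc.
exists M; split; first exact: num_real.
move=> y My x /=; rewrite in_itv/= => xL; apply: le_trans (ltW My); exact: gM.
Qed.

Lemma L2r_integrable f : L2r f -> mu.-integrable I (EFin \o f).
Proof.
move=> [mf fi]; apply: (@integrable_itv_le _ (fun x => 1 + f x ^+ 2)) => //.
  by apply: integrable_itvD => //; exact: integrable_itv_cst.
move=> x _; rewrite ler_norml; apply/andP; split; have := sqr_ge0 (f x).
  by have := sqr_ge0 (f x + 1); lra.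
by have := sqr_ge0 (f x - 1); lra.
Qed.

Lemma L2rD f g : L2r f -> L2r g -> L2r (fun x => f x + g x).
Proof.
move=> [mf fi] [mg gi]; split; first exact: measurable_funD.
apply: (@integrable_itv_le _ (fun x => 2 * f x ^+ 2 + 2 * g x ^+ 2)).
- by apply: measurable_funX; exact: measurable_funD.
- by apply: integrable_itvD; exact: integrable_itvZ.
- move=> x _; rewrite ger0_norm ?sqr_ge0//.
  by have := sqr_ge0 (f x - g x); lra.
Qed.

Lemma L2rM_bounded f (b : R -> R) (M : R) : L2r f -> measurable_fun setT b ->
  (forall x, 0 <= x <= L -> `|b x| <= M) -> L2r (fun x => b x * f x).
Proof.
move=> [mf fi] mb bM; split; first exact: measurable_funM.
apply: (@integrable_itv_le _ (fun x => M ^+ 2 * f x ^+ 2)).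
- by apply: measurable_funX; exact: measurable_funM.
- exact: integrable_itvZ.
- move=> x xL; rewrite ger0_norm ?sqr_ge0// exprMn ler_wpM2r ?sqr_ge0//.
  rewrite -(real_normK (num_real (b x))) ler_pXn2r ?nnegrE ?bM//.
  exact: le_trans (bM x xL).
Qed.

Lemma L2r_bounded f M : measurable_fun setT f ->
  (forall x, 0 <= x <= L -> `|f x| <= M) -> L2r f.
Proof.
move=> mf fM; split => //.
apply: (@integrable_itv_le _ (fun=> M ^+ 2)).
- exact: measurable_funX.
- exact: integrable_itv_cst.
- move=> x xL; rewrite ger0_norm ?sqr_ge0//.
  rewrite -(real_normK (num_real (f x))) ler_pXn2r ?nnegrE ?fM//.
  exact: le_trans (fM x xL).
Qed.

Lemma L2rZ c f : L2r f -> L2r (fun x => c * f x).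
Proof. by move=> fi; apply: (@L2rM_bounded _ (fun=> c) `|c|). Qed.

Lemma L2r0 : L2r (fun=> 0).
Proof. by apply: (@L2r_bounded _ 0) => // x _; rewrite normr0. Qed.

Lemma ae_eq_Rintegral f g : mu.-integrable I (EFin \o f) ->
  mu.-integrable I (EFin \o g) -> ae_eq mu I f g ->
  \int[mu]_(x in I) f x = \int[mu]_(x in I) g x.
Proof.
move=> fi gi fg; rewrite /Rintegral; congr fine; apply: ae_eq_integral => //.
- by case/integrableP: fi.
- by case/integrableP: gi.
- exact: ae_eq_comp.
Qed.

End SquareIntegrable.

(** * Integration by parts against an integrable derivative *)

Section AbsolutelyContinuous.
Context {R : realType}.
Variable L : R.
Hypothesis hL : 0 < L.
Implicit Types (f g h : R -> R) (x : R).
Local Notation mu := (@lebesgue_measure R).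
Local Notation I := (`[0, L]%classic : set R).

Lemma integrable_sub_itv h x : x <= L -> mu.-integrable I (EFin \o h) ->
  mu.-integrable `[0, x] (EFin \o h).
Proof.
move=> xL; apply: integrableS => //; apply: subset_itvl; by rewrite bnd_simp.
Qed.

Lemma Rintegral_sub_le h x : 0 <= x <= L -> mu.-integrable I (EFin \o h) ->
  `|\int[mu]_(t in `[0, x]) h t| <= \int[mu]_(t in I) `|h t|.
Proof.
move=> /andP[x0 xL] hi; have hx := integrable_sub_itv xL hi.
apply: le_trans (le_normr_Rintegral _ hx) _ => //.
have hni : mu.-integrable I (EFin \o (fun t => `|h t|)).
  by have := integrable_norm hi.
rewrite /Rintegral fine_le//; last 1 first.
- apply: ge0_subset_integral => //.
  + by case/integrableP: hni.
  + by apply: subset_itvl; rewrite bnd_simp.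
- by apply: integrable_fin_num => //; exact: integrable_sub_itv hni.
- exact: integrable_fin_num.
Qed.

Lemma cont_on_primitive h : mu.-integrable I (EFin \o h) ->
  cont_on 0 L (fun x => \int[mu]_(t in `[0, x]) h t).
Proof. exact: parameterized_integral_continuous (ltW hL). Qed.

(** By density: both sides are continuous in [h] for the L1 norm, and for continuous
    [h] this is the usual rule. *)
Lemma parts_integrable h th th' : mu.-integrable I (EFin \o h) ->
  (forall x, 0 <= x <= L -> deriv_at x th (th' x)) -> cont_on 0 L th' ->
  \int[mu]_(x in I) ((\int[mu]_(t in `[0, x]) h t) * th' x) =
  (\int[mu]_(t in I) h t) * th L - \int[mu]_(x in I) (h x * th x).
Proof.
move=> hi thd th'c; have thc := deriv_at_within thd.
have [M M0 thM] := within_bounded thc; have [M' M'0 thM'] := within_bounded th'c.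
pose T (u : R -> R) := \int[mu]_(x in I) ((\int[mu]_(t in `[0, x]) u t) * th' x) -
  ((\int[mu]_(t in I) u t) * th L - \int[mu]_(x in I) (u x * th x)).
have Tc g : continuous g -> T g = 0.
  move=> gc; have gw a b : cont_on a b g by exact: continuous_subspaceT.
  have [G [G0 Gd]] := primitive_exists (ltW hL) (gw _ _).
  have GE x : 0 <= x <= L -> \int[mu]_(t in `[0, x]) g t = G x.
    move=> /andP[x0 xL]; rewrite (@FTC_segment _ 0 x G g)// ?G0 ?subr0//.
    by move=> t /andP[t0 tx]; apply: Gd; rewrite t0 (le_trans tx).
  rewrite /T GE ?lexx ?(ltW hL)// (@eq_Rintegral_itv _ _ _ _ (fun x => G x * th' x)).
    rewrite (parts_segment (ltW hL) Gd thd (gw _ _) th'c) G0 mul0r subr0.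
    by rewrite subrr.
  by move=> x xL; rewrite GE.
have TB g : mu.-integrable I (EFin \o g) -> continuous g ->
    `|T h| <= (M' * L + M + M) * \int[mu]_(t in I) `|h t - g t|.
  move=> gi gc; set D := \int[mu]_(t in I) _.
  have di : mu.-integrable I (EFin \o (fun t => h t - g t)) by exact: integrable_itvB.
  have dn : mu.-integrable I (EFin \o (fun t => `|h t - g t|)).
    by have := integrable_norm di.
  have D0 : 0 <= D by apply: Rintegral_itv_ge0.
  have Hc := cont_on_primitive hi; have Gc := cont_on_primitive gi.
  have Dc := cont_on_primitive di.
  have DE x : 0 <= x <= L -> \int[mu]_(t in `[0, x]) h t -
      \int[mu]_(t in `[0, x]) g t = \int[mu]_(t in `[0, x]) (h t - g t).
    by move=> /andP[_ xL]; rewrite RintegralB//; exact: integrable_sub_itv.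
  have -> : T h = \int[mu]_(x in I) ((\int[mu]_(t in `[0, x]) (h t - g t)) * th' x)
      - ((\int[mu]_(t in I) (h t - g t)) * th L
         - \int[mu]_(x in I) ((h x - g x) * th x)).
    transitivity (T h - T g); first by rewrite (Tc g gc) subr0.
    rewrite /T.
    rewrite -[\int[mu]_(t in I) (h t - g t)]DE ?lexx ?(ltW hL)//.
    rewrite (@eq_Rintegral_itv _ _ _ (fun x => (\int[mu]_(t in `[0, x]) (h t - g t)) * th' x)
      (fun x => (\int[mu]_(t in `[0, x]) h t) * th' x - (\int[mu]_(t in `[0, x]) g t) * th' x)).
      rewrite RintegralB//; last 2 first.
      - by apply: within_integrable; exact: withinM.
      - by apply: within_integrable; exact: withinM.
      rewrite (@eq_Rintegral_itv _ _ _ (fun x => (h x - g x) * th x)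
        (fun x => h x * th x - g x * th x)); last by move=> x _; rewrite mulrBl.
      rewrite RintegralB//; [|exact: integrable_itvM|exact: integrable_itvM].
      by ring.
    by move=> x xL; rewrite -DE// mulrBl.
  have b1 : `|\int[mu]_(x in I) ((\int[mu]_(t in `[0, x]) (h t - g t)) * th' x)| <=
      M' * L * D.
    have ci : mu.-integrable I (EFin \o (fun x =>
        (\int[mu]_(t in `[0, x]) (h t - g t)) * th' x)).
      by apply: within_integrable; exact: withinM.
    apply: le_trans (le_normr_Rintegral _ ci) _ => //.
    apply: (@le_trans _ _ (\int[mu]_(x in I) (D * M'))).
      apply: le_Rintegral_itv.
      - by have := integrable_norm ci.
      - exact: integrable_itv_cst.
      - move=> x xL; rewrite normrM ler_pM//; last exact: thM'.
        exact: Rintegral_sub_le.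
    by rewrite (Rintegral_itv_cst _ (ltW hL)) subr0 [D * _]mulrC mulrAC.
  have b2 : `|(\int[mu]_(t in I) (h t - g t)) * th L| <= M * D.
    have LL : 0 <= L <= L by rewrite lexx ltW.
    rewrite normrM mulrC; apply: ler_pM => //; first exact: thM.
    exact: Rintegral_sub_le.
  have b3 : `|\int[mu]_(x in I) ((h x - g x) * th x)| <= M * D.
    have ci : mu.-integrable I (EFin \o (fun x => (h x - g x) * th x)).
      exact: integrable_itvM.
    apply: le_trans (le_normr_Rintegral _ ci) _ => //.
    rewrite -RintegralZl//; apply: le_Rintegral_itv.
    - by have := integrable_norm ci.
    - exact: integrable_itvZ.
    - by move=> x xL; rewrite normrM mulrC ler_wpM2r// thM.
  rewrite -addrA mulrDl mulrDl; apply: le_trans (ler_normB _ _) _.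
  by apply: lerD b1 _; apply: le_trans (ler_normB _ _) _; exact: lerD b2 b3.
have Ioo : (mu I < +oo)%E.
  by rewrite lebesgue_measure_itv/=; case: ifP => _; rewrite ltry.
have [//|g_ [gc gi gcv]] := @approximation_continuous_integrable R I h _ Ioo hi.
suff : T h = 0 by rewrite /T => /eqP; rewrite subr_eq0 => /eqP.
apply/eqP; rewrite -normr_le0 leNgt; apply/negP => T0.
set C := M' * L + M + M in TB.
have C0 : 0 < C + 1 by rewrite /C; have := mulr_ge0 M'0 (ltW hL); lra.
move: gcv => /fine_cvgP[_ /cvgr_lt/(_ _ (divr_gt0 T0 C0))[n _ Hn]].
have := Hn n (leqnn n); have := TB _ (gi n) (gc n).
rewrite /Rintegral /=; set D := fine _ => le1.
have D0 : 0 <= D by apply: fine_ge0; apply: integral_ge0 => x _; rewrite lee_fin.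
rewrite ltr_pdivlMr// => lt1.
by have := le_lt_trans le1 (le_lt_trans _ lt1); lra.
Qed.

End AbsolutelyContinuous.

(** * Trigonometric test functions *)

Section Trigonometric.
Context {R : realType}.
Variable L : R.
Hypothesis hL : 0 < L.
Implicit Types (f g h H : R -> R) (x p a : R).
Local Notation mu := (@lebesgue_measure R).
Local Notation I := (`[0, L]%classic : set R).

Definition frequency : R := 2 * pi / L.
Local Notation w := frequency.

Lemma frequency_gt0 : 0 < w.
Proof. by rewrite divr_gt0// mulr_gt0// pi_gt0. Qed.

Definition wave_mode (n : nat) p x : R := cos (n%:R * w * x + p).

Lemma cos_affine_deriv a c p x :
  deriv_at x (fun y => a * cos (c * y + p)) (a * c * cos (c * x + (p + pi / 2))).
Proof.
apply: deriv_at_eq.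
  apply: deriveZ_pt; apply: derive_comp_pt; first exact: is_derive_cos.
  exact: derive_affine_pt.
by rewrite addrA cosDpihalf; ring.
Qed.

Lemma cos_affine_derive1n a c p n :
  derive1n n (fun y => a * cos (c * y + p)) =
  (fun y => a * c ^+ n * cos (c * y + (p + n%:R * (pi / 2)))).
Proof.
elim: n => [|n IH]; first by apply/funext => y; rewrite derive1n0 expr0 mulr1 mul0r addr0.
rewrite derive1nS IH; apply/funext => y.
rewrite (deriv_at_derive1 (cos_affine_deriv _ _ _ _)) exprSr -natr1.
by congr (_ * cos _); ring.
Qed.

Lemma cosDn2pi (n : nat) x : cos (x + n%:R * (2 * pi)) = cos x.
Proof.
elim: n => [|n IH]; first by rewrite mul0r addr0.
have -> : x + n.+1%:R * (2 * pi) = x + n%:R * (2 * pi) + pi *+ 2.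
  by rewrite -natr1; ring.
by rewrite cosD2pi.
Qed.

Lemma wave_mode_test a (n : nat) p : test_per L (fun x => a * wave_mode n p x).
Proof.
split.
  move=> x; rewrite /wave_mode.
  have -> : n%:R * w * (x + L) + p = n%:R * w * x + p + n%:R * (2 * pi).
    by rewrite /w; field; rewrite gt_eqF.
  by rewrite cosDn2pi.
move=> m x; rewrite /wave_mode cos_affine_derive1n.
by have [] := cos_affine_deriv (a * (n%:R * w) ^+ m) (n%:R * w) (p + m%:R * (pi / 2)) x.
Qed.

Lemma wave_mode0 p x : wave_mode 0 p x = cos p.
Proof. by rewrite /wave_mode !mul0r add0r. Qed.

Lemma wave_mode_cont a b n p : cont_on a b (wave_mode n p).
Proof.
apply: (@deriv_at_within _ _ _ _ (fun x => 1 * (n%:R * w) *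
  cos (n%:R * w * x + (p + pi / 2)))) => x _.
have := cos_affine_deriv 1 (n%:R * w) p x; congr deriv_at.
by apply/funext => y; rewrite mul1r.
Qed.

(** By the product-to-sum formulas the span of the modes is an algebra. *)
Inductive trig_poly : (R -> R) -> Prop :=
| trig_mode a n p : trig_poly (fun x => a * wave_mode n p x)
| trig_add f g : trig_poly f -> trig_poly g -> trig_poly (fun x => f x + g x).

Lemma trig_poly_mulmode f a n p : trig_poly f ->
  trig_poly (fun x => f x * (a * wave_mode n p x)).
Proof.
elim=> {f} [b m q|f g _ IHf _ IHg]; last first.
  have -> : (fun x => (f x + g x) * (a * wave_mode n p x)) =
    (fun x => f x * (a * wave_mode n p x) + g x * (a * wave_mode n p x)).
    by apply/funext => x; rewrite mulrDl.
  exact: trig_add.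
have prod (s t : R) : cos s * cos t = (cos (s + t) + cos (s - t)) / 2.
  by rewrite cosD cosB; field.
wlog nm : n m a b p q / (n <= m)%N.
  move=> W; have [/W//|/ltnW mn] := leqP n m.
  have -> : (fun x => b * wave_mode m q x * (a * wave_mode n p x)) =
    (fun x => a * wave_mode n p x * (b * wave_mode m q x)).
    by apply/funext => x; rewrite mulrC.
  exact: W.
have -> : (fun x => b * wave_mode m q x * (a * wave_mode n p x)) =
    (fun x => a * b / 2 * wave_mode (m + n) (q + p) x +
              a * b / 2 * wave_mode (m - n) (q - p) x).
  apply/funext => x; rewrite /wave_mode.
  have -> : (m + n)%:R * w * x + (q + p) = (m%:R * w * x + q) + (n%:R * w * x + p).
    by rewrite natrD; ring.
  have -> : (m - n)%:R * w * x + (q - p) = (m%:R * w * x + q) - (n%:R * w * x + p).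
    by rewrite natrB//; ring.
  have := prod (m%:R * w * x + q) (n%:R * w * x + p); set c1 := cos (_ * _ * _ + q).
  set c2 := cos (_ * _ * _ + p) => E.
  by transitivity (a * b * (c1 * c2)); [ring|rewrite E; field].
by apply: trig_add; exact: trig_mode.
Qed.

Lemma trig_poly_mul f g : trig_poly f -> trig_poly g ->
  trig_poly (fun x => f x * g x).
Proof.
move=> tf; elim=> {g} [a n p|g h _ IHg _ IHh]; first exact: trig_poly_mulmode.
have -> : (fun x => f x * (g x + h x)) = (fun x => f x * g x + f x * h x).
  by apply/funext => x; rewrite mulrDr.
exact: trig_add.
Qed.

Lemma trig_poly_cst a : trig_poly (fun=> a).
Proof.
have := trig_mode a 0 0; congr trig_poly; apply/funext => x.
by rewrite wave_mode0 cos0 mulr1.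
Qed.

Lemma trig_poly_exp f n : trig_poly f -> trig_poly (fun x => f x ^+ n).
Proof.
move=> tf; elim: n => [|n IH].
  by have := trig_poly_cst 1; congr trig_poly; apply/funext => x; rewrite expr0.
have := trig_poly_mul tf IH; congr trig_poly; apply/funext => x.
by rewrite exprS.
Qed.

Lemma trig_poly_cont f a b : trig_poly f -> cont_on a b f.
Proof.
elim=> [c n p|g h _ gc _ hc]; last exact: withinD.
by apply: withinM; [exact: within_cst|exact: wave_mode_cont].
Qed.

Lemma trig_poly_orthogonal h f : mu.-integrable I (EFin \o h) ->
  (forall n p, \int[mu]_(x in I) (h x * wave_mode n p x) = 0) ->
  trig_poly f -> \int[mu]_(x in I) (h x * f x) = 0.
Proof.
move=> hi h0; elim=> [c n p|f1 f2 t1 IH1 t2 IH2].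
  rewrite (@eq_Rintegral_itv _ _ _ _ (fun x => c * (h x * wave_mode n p x))).
    rewrite RintegralZl ?h0 ?mulr0//; apply: integrable_itvM => //.
    exact: wave_mode_cont.
  by move=> x _; rewrite mulrCA.
rewrite (@eq_Rintegral_itv _ _ _ _ (fun x => h x * f1 x + h x * f2 x)).
  by rewrite RintegralD// ?IH1 ?IH2 ?addr0//; apply: integrable_itvM => //;
    exact: trig_poly_cont.
by move=> x _; rewrite mulrDr.
Qed.

(** Powers of 1 + cos (w (x - x0)) - cos (w d) concentrate on the interval of
    radius d about x0: the base is at least 1 there, and at most 1 in absolute
    value elsewhere on the period.  If [H] were positive on that interval, its
    integrals against these powers would grow without bound, whereas they vanish. *)
Lemma trig_orthogonal_le0 H x0 : cont_on 0 L H ->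
  (forall n p, \int[mu]_(x in I) (H x * wave_mode n p x) = 0) ->
  0 < x0 < L -> H x0 <= 0.
Proof.
move=> Hc H0 /andP[x00 x0L]; rewrite leNgt; apply/negP => Hx0.
have Hi := within_integrable Hc.
have [M M0 HM] := within_bounded Hc.
pose e := H x0 / 2; have e0 : 0 < e by rewrite divr_gt0.
have [d d0 [dl dr Hd]] : exists2 d, 0 < d & [/\ d <= x0, x0 + d <= L &
    forall x, `|x - x0| < d -> e <= H x].
  have cc := continuous_comp_clamp (ltW hL) Hc.
  have : \forall x \near x0, e < H (clamp 0 L x).
    apply: (cvgr_gt (H (clamp 0 L x0)) (cc x0)).
    by rewrite clamp_id ?ltW// /e; lra.
  move=> [r /= r0 Hr]; pose d := Num.min r (Num.min x0 (L - x0)).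
  have [dr d1 d2] : [/\ d <= r, d <= x0 & d <= L - x0].
    by rewrite /d !ge_min !lexx !orbT.
  exists d; first by rewrite /d !lt_min r0 x00 subr_gt0.
  split => //; first lra.
  move=> x xd; have /Hr : `|x0 - x| < r by rewrite distrC (lt_le_trans xd).
  rewrite clamp_id => [/ltW//|].
  by move: xd; rewrite ltr_norml => /andP[? ?]; apply/andP; split; lra.
have w0 := frequency_gt0; have pi0 := @pi_gt0 R.
have wL : w * L = 2 * pi by rewrite /w divfK// gt_eqF.
pose b x := 1 + (cos (w * (x - x0)) - cos (w * d)).
have bE : b = fun x => (1 - cos (w * d)) + 1 * wave_mode 1 (- (w * x0)) x.
  apply/funext => x; rewrite /b /wave_mode !mul1r -mulrBr; ring.
have tb : trig_poly b.
  by rewrite bE; apply: trig_add; [exact: trig_poly_cst|exact: trig_mode].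
have bc : cont_on 0 L b by exact: trig_poly_cont.
have bout x : 0 <= x <= L -> d <= `|x - x0| -> `|b x| <= 1.
  move=> /andP[x0' xL'] dx.
  have cle : cos (w * (x - x0)) <= cos (w * d).
    set t := `|x - x0| in dx.
    have -> : cos (w * (x - x0)) = cos (w * t).
      rewrite /t; have [?|?] := leP 0 (x - x0); first by rewrite ger0_norm.
      by rewrite ltr0_norm// mulrN cosN.
    have tL : t <= L - d by rewrite /t ler_norml; apply/andP; split; lra.
    have [tp|tp] := leP (w * t) pi.
      have [->//|wdt] := eqVneq (w * d) (w * t).
      have dt : w * d <= w * t by rewrite ler_wpM2l// ltW.
      have wd0 : 0 < w * d by rewrite mulr_gt0.
      by rewrite ltW// ltr_cos ?in_itv/= ?lt_neqAle ?wdt//; apply/andP; split; lra.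
    have -> : cos (w * t) = cos (2 * pi - w * t).
      by rewrite -[LHS]cosN -[in LHS](cosDn2pi 1) mul1r addrC.
    have wd : w * d <= 2 * pi - w * t.
      by rewrite -wL -mulrBr ler_wpM2l ?(ltW w0)//; lra.
    have [->//|wdt] := eqVneq (w * d) (2 * pi - w * t).
    have wd0 : 0 < w * d by rewrite mulr_gt0.
    by rewrite ltW// ltr_cos ?in_itv/= ?lt_neqAle ?wdt//; apply/andP; split; lra.
  have := cos_geN1 (w * (x - x0)); have := cos_le1 (w * d).
  by rewrite /b ler_norml => ? ?; apply/andP; split; lra.
have bin x : `|x - x0| < d -> 1 <= b x.
  move=> xd; rewrite /b lerDl subr_ge0.
  have -> : cos (w * (x - x0)) = cos (w * `|x - x0|).
    have [?|?] := leP 0 (x - x0); first by rewrite ger0_norm.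
    by rewrite ltr0_norm// mulrN cosN.
  have xx : 0 <= `|x - x0| by [].
  have dL : w * d <= pi.
    have -> : pi = w * (L / 2) by rewrite mulrA wL; field.
    by rewrite ler_wpM2l ?(ltW w0)//; lra.
  have wlt : w * `|x - x0| < w * d by rewrite ltr_pM2l.
  have wx0 : 0 <= w * `|x - x0| by rewrite mulr_ge0 ?(ltW w0).
  by rewrite ltW// ltr_cos ?in_itv//=; apply/andP; split; lra.
pose q x := Num.max (b x - 1) 0.
have qc : cont_on 0 L q.
  have cc := continuous_comp_clamp (ltW hL) bc.
  apply: (@within_eq _ _ _ (fun x => Num.max (b (clamp 0 L x) - 1) 0)).
    by move=> x xL; rewrite clamp_id.
  apply: continuous_subspaceT => x.
  apply: (@continuous_max R R (fun x => b (clamp 0 L x) - 1) (fun=> 0)).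
    by apply: cvgB; [exact: cc|exact: cvg_cst].
  exact: cvg_cst.
have qi := within_integrable qc.
have low n x : 0 <= x <= L -> n%:R * e * q x - M <= H x * b x ^+ n.
  move=> xL; have := HM x xL; rewrite ler_norml => /andP[HM1 HM2].
  have [xd|xd] := ltP `|x - x0| d.
    have b1 := bin x xd; have eH := Hd x xd.
    have qE : q x = b x - 1 by rewrite /q max_l// subr_ge0.
    have bern : 1 + n%:R * (b x - 1) <= b x ^+ n.
      elim: n => [|n IH]; first by rewrite mul0r addr0 expr0.
      have n0 : 0 <= n%:R :> R by [].
      have p0 : 0 <= n%:R * (b x - 1) by rewrite mulr_ge0// subr_ge0.
      rewrite exprS -natr1; have : 0 <= b x * (b x ^+ n - (1 + n%:R * (b x - 1))).
        by rewrite mulr_ge0 ?subr_ge0//; lra.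
      have : 0 <= (b x - 1) * (n%:R * (b x - 1)) by rewrite mulr_ge0 ?subr_ge0.
      by nra.
    have p0 : 0 <= n%:R * (b x - 1) by rewrite mulr_ge0// subr_ge0.
    rewrite qE; have : e * (1 + n%:R * (b x - 1)) <= H x * b x ^+ n.
      by apply: ler_pM => //; [exact: ltW|lra].
    by lra.
  have b1 := bout x xL xd.
  have -> : q x = 0 by rewrite /q max_r// subr_le0; move: b1; rewrite ler_norml => /andP[].
  rewrite mulr0 sub0r lerNl -mulNr; apply: le_trans (ler_norm _) _.
  by rewrite normrM normrN normrX -[leRHS]mulr1 ler_pM ?HM ?exprn_ile1.
have Q0 : 0 < \int[mu]_(x in I) q x.
  rewrite lt_neqAle; apply/andP; split; last first.
    by apply: Rintegral_itv_ge0 => x _; rewrite /q le_max lexx orbT.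
  apply/eqP => Qz; have := within_integral_eq0 hL qc _ (esym Qz).
  have q0 x : 0 <= q x by rewrite /q le_max lexx orbT.
  move=> /(_ (fun x _ => q0 x) x0); rewrite !ltW// => /(_ isT).
  rewrite /q /b subrr mulr0 cos0 addrC addKr => qz.
  have : cos (w * d) < 1.
    have wd0 : 0 < w * d by rewrite mulr_gt0.
    rewrite -cos0 ltr_cos ?in_itv/= ?lexx ?(ltW pi0) ?(ltW wd0)//=.
    have -> : pi = w * (L / 2) by rewrite mulrA wL; field.
    by rewrite ler_wpM2l ?(ltW w0)//; lra.
  by rewrite -subr_gt0; move: qz; rewrite /Num.max; case: ifPn => [|_ ->]; rewrite ?ltxx//; lra.
have key n : n%:R * e * (\int[mu]_(x in I) q x) <= M * L.
  have tn := trig_poly_orthogonal Hi H0 (trig_poly_exp n tb).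
  have bnc := @trig_poly_cont _ 0 L (trig_poly_exp n tb).
  have : \int[mu]_(x in I) (n%:R * e * q x - M) <= \int[mu]_(x in I) (H x * b x ^+ n).
    apply: le_Rintegral_itv => //.
    - by apply: integrable_itvB; [exact: integrable_itvZ|exact: integrable_itv_cst].
    - exact: integrable_itvM.
    - exact: low.
  rewrite tn RintegralB//; last 2 first.
  - exact: integrable_itvZ.
  - exact: integrable_itv_cst.
  by rewrite RintegralZl// Rintegral_itv_cst ?(ltW hL)// subr0 subr_le0.
set Q := \int[mu]_(x in I) q x in Q0 key.
have eQ : 0 < e * Q by rewrite mulr_gt0.
pose n := (Num.truncn (M * L / (e * Q))).+1.
have := key n; rewrite -mulrA -ler_pdivlMr// leNgt.
by rewrite /n Num.Theory.truncnS_gt.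
Qed.

Lemma trig_orthogonal_eq0 H : cont_on 0 L H ->
  (forall n p, \int[mu]_(x in I) (H x * wave_mode n p x) = 0) ->
  forall x, 0 < x < L -> H x = 0.
Proof.
move=> Hc H0 x xL; apply/eqP; rewrite eq_le (trig_orthogonal_le0 Hc H0 xL)/=.
rewrite -oppr_le0; apply: (@trig_orthogonal_le0 (fun x => - H x)) => // [|n p].
  apply: (@within_eq _ _ _ (fun x => 0 - H x)) => [y _|]; first by rewrite sub0r.
  by apply: withinB => //; exact: within_cst.
rewrite (@eq_Rintegral_itv _ _ _ _ (fun x => -1 * (H x * wave_mode n p x))).
  rewrite RintegralZl ?H0 ?mulr0//; apply: integrable_itvM.
    exact: within_integrable.
  exact: wave_mode_cont.
by move=> y _; rewrite mulN1r mulNr.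
Qed.

Lemma wave_mode_primitive n p : exists a q, forall x,
  deriv_at x (fun x => a * wave_mode n.+1 q x) (wave_mode n.+1 p x).
Proof.
exists (n.+1%:R * w)^-1, (p - pi / 2) => x.
apply: deriv_at_eq; first exact: cos_affine_deriv.
rewrite mulVf ?mul1r ?subrK// mulf_neq0 ?pnatr_eq0// gt_eqF// frequency_gt0//.
Qed.

Lemma ae_neq (x0 : R) : {ae mu, forall x, x != x0}.
Proof.
exists [set x0]; split => //; first exact: lebesgue_measure_set1.
by move=> x /= /negP; rewrite negbK => /eqP.
Qed.

(** du Bois-Reymond: by parts, the primitive of [h] minus its mean is orthogonal
    to every mode, so it is constant. *)
Lemma trig_orthogonal_ae0 h : mu.-integrable I (EFin \o h) ->
  (forall n p, \int[mu]_(x in I) (h x * wave_mode n p x) = 0) ->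
  ae_eq mu I h (fun=> 0).
Proof.
move=> hi h0; pose H x := \int[mu]_(t in `[0, x]) h t.
have Hc : cont_on 0 L H by exact: cont_on_primitive.
have HL : H L = 0.
  rewrite -(h0 0%N 0); apply: eq_Rintegral_itv => x _.
  by rewrite wave_mode0 cos0 mulr1.
pose m := (\int[mu]_(x in I) H x) / L.
have Hmc : cont_on 0 L (fun x => H x - m).
  by apply: withinB => //; exact: within_cst.
have Hm : forall x, 0 < x < L -> H x - m = 0.
  apply: trig_orthogonal_eq0 => // -[|n] p.
    rewrite (@eq_Rintegral_itv _ _ _ _ (fun x => cos p * (H x - m))); last first.
      by move=> x _; rewrite wave_mode0 mulrC.
    rewrite RintegralZl//; last exact: within_integrable.
    rewrite RintegralB//; last 2 first.
    - exact: within_integrable.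
    - exact: integrable_itv_cst.
    by rewrite (Rintegral_itv_cst _ (ltW hL)) subr0 divfK ?gt_eqF// subrr mulr0.
  have [a [q aqd]] := wave_mode_primitive n p.
  have mc := @wave_mode_cont 0 L n.+1 p.
  rewrite (@eq_Rintegral_itv _ _ _ _ (fun x => H x * wave_mode n.+1 p x -
    m * wave_mode n.+1 p x)); last by move=> x _; rewrite mulrBl.
  have mi : mu.-integrable I (EFin \o wave_mode n.+1 p) by exact: within_integrable.
  rewrite RintegralB//; last 2 first.
  - by apply: within_integrable; exact: withinM.
  - exact: integrable_itvZ.
  rewrite RintegralZl// (@FTC_segment _ _ _ (fun x => a * wave_mode n.+1 q x)
    (wave_mode n.+1 p) (ltW hL))//.
  have [per _] := wave_mode_test a n.+1 q.
  have -> : a * wave_mode n.+1 q L = a * wave_mode n.+1 q 0.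
    by have := per 0; rewrite add0r.
  rewrite subrr mulr0 subr0.
  rewrite (@parts_integrable _ _ hL h (fun x => a * wave_mode n.+1 q x))//.
  rewrite -/(H L) HL mul0r sub0r.
  rewrite (@eq_Rintegral_itv _ _ _ _ (fun x => a * (h x * wave_mode n.+1 q x))).
    rewrite RintegralZl ?h0 ?mulr0 ?oppr0//; apply: integrable_itvM => //.
    exact: wave_mode_cont.
  by move=> x _; rewrite mulrCA.
have gi : mu.-integrable setT (EFin \o (h \_ I)).
  rewrite -restrict_EFin.
  by have := (integrable_mkcond (mu := mu) (D := I) (EFin \o h) _).1; apply.
have gl : locally_integrable [set: R] (h \_ I) by exact: integrable_locally.
have giy (y : R) : mu.-integrable [set` Interval (BLeft 0) (BRight y)] (EFin \o (h \_ I)).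
  exact: integrableS gi.
have ae1 := FTC1 giy gl.
have ae2 := ae_neq 0; have ae3 := ae_neq L.
move: ae1 ae2 ae3; apply: filterS3; first exact: (ae_filter_ringOfSetsType mu).
move=> x /= H1 /eqP x0 /eqP xL.
rewrite in_itv/= => /andP[x0' xL'].
have {}x0 : 0 < x by rewrite lt_neqAle x0' andbT; apply/eqP => e; exact: x0.
have {}xL : x < L by rewrite lt_neqAle xL' andbT; apply/eqP.
have [//|_ d2] := H1.
have hx : (h \_ I) x = h x by rewrite patchE mem_set//= in_itv/= x0' xL'.
rewrite -hx -d2.
have : deriv_at x (fun y => \int[mu]_(t in `[0, y]) (h \_ I) t) 0.
  apply: (@near_eq_is_derive R R R (fun=> m)).
  near=> y.
  have y0 : 0 < y by near: y; exact: lt_nbhsr.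
  have yL : y < L by near: y; exact: lt_nbhsl.
  have := Hm y; rewrite y0 yL => /(_ isT)/subr0_eq <-.
  apply: eq_Rintegral_itv => t /andP[t0 ty].
  by rewrite patchE mem_set//= in_itv/= t0 (le_trans ty (ltW yL)).
by move=> /deriv_at_derive1.
Unshelve. all: by end_near. Qed.

Lemma test_orthogonal_ae0 h : mu.-integrable I (EFin \o h) ->
  (forall th, test_per L th -> \int[mu]_(x in I) (h x * th x) = 0) ->
  ae_eq mu I h (fun=> 0).
Proof.
move=> hi h0; apply: trig_orthogonal_ae0 => // n p; apply: h0.
by have := wave_mode_test 1 n p; congr test_per; apply/funext => x; rewrite mul1r.
Qed.

(** * Weak derivatives and their classical representatives *)

Lemma test_per_deriv th n x : test_per L th ->
  deriv_at x (derive1n n th) (derive1n n.+1 th x).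
Proof.
by move=> [_ /(_ n x) d]; split; [exact: d|rewrite derive1nS derive1E].
Qed.

Lemma test_per_cont th n a b : test_per L th -> cont_on a b (derive1n n th).
Proof.
move=> t; apply: (@deriv_at_within _ _ _ _ (derive1n n.+1 th)) => x _.
exact: test_per_deriv.
Qed.

Lemma test_per_periodic th n x : test_per L th ->
  derive1n n th (x + L) = derive1n n th x.
Proof.
move=> t; elim: n x => [|n IH] x; first by case: t => /(_ x).
have d1 := test_per_deriv n (x + L) t; have d2 := test_per_deriv n x t.
have e : (fun y => derive1n n th (1 * y + L)) = derive1n n th.
  by apply/funext => y; rewrite mul1r IH.
have := derive_comp_pt _ (derive_affine_pt 1 L x).
move=> /(_ (derive1n n th) (derive1n n.+1 th (x + L))).
rewrite mul1r e mulr1 => /(_ d1) [_ <-].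
by case: d2 => _ <-.
Qed.

Lemma test_per_end th n : test_per L th -> derive1n n th L = derive1n n th 0.
Proof. by move=> /(test_per_periodic n 0); rewrite add0r. Qed.

Lemma weak_derive_unique n f g g' : mu.-integrable I (EFin \o g) ->
  mu.-integrable I (EFin \o g') -> real_weak_derive L n f g ->
  real_weak_derive L n f g' -> ae_eq mu I g g'.
Proof.
move=> gi g'i dg dg'.
have : ae_eq mu I (fun x => g x - g' x) (fun=> 0).
  apply: test_orthogonal_ae0; first exact: integrable_itvB.
  move=> th tth; rewrite (@eq_Rintegral_itv _ _ _ _ (fun x => g x * th x - g' x * th x)).
    have tc : cont_on 0 L th by exact: (@test_per_cont th 0).
    rewrite RintegralB//; [|exact: integrable_itvM|exact: integrable_itvM].
    have := dg th tth; rewrite (dg' th tth) => /(mulrI (unitrX n (unitrN1 R))) ->.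
    by rewrite subrr.
  by move=> x _; rewrite mulrBl.
by apply: filterS => x gg' xI; apply/eqP; rewrite -subr_eq0 gg'.
Qed.

(** The classical form of being in H^2_per with second derivative [g]; the equalities
    of end values are what makes the boundary terms of integrations by parts cancel. *)
Definition periodic_primitive2 (c0 c1 : R) g F F1 : Prop := [/\
  forall x, 0 <= x <= L -> F1 x = c1 + \int[mu]_(t in `[0, x]) g t,
  forall x, 0 <= x <= L -> F x = c0 + \int[mu]_(t in `[0, x]) F1 t,
  F1 L = F1 0 & F L = F 0].

Let LL : 0 <= L <= L. Proof. by rewrite lexx ltW. Qed.
Let L00 : 0 <= (0 : R) <= L. Proof. by rewrite lexx ltW. Qed.

Lemma primitive_parts c g F th : mu.-integrable I (EFin \o g) ->
  (forall x, 0 <= x <= L -> F x = c + \int[mu]_(t in `[0, x]) g t) ->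
  F L = F 0 -> test_per L th ->
  \int[mu]_(x in I) (F x * derive1 th x) = - \int[mu]_(x in I) (g x * th x).
Proof.
move=> gi FE FL t.
have thd x : 0 <= x <= L -> deriv_at x th (derive1 th x).
  by move=> _; exact: (test_per_deriv 0).
have tc : cont_on 0 L (derive1 th) by exact: (@test_per_cont th 1).
have thL : th L = th 0 by exact: (@test_per_end th 0).
have g0 : \int[mu]_(t in I) g t = 0.
  move: FL; rewrite !FE// set_itv1 Rintegral_set1 addr0 => /eqP.
  by rewrite -[X in _ == X]addr0 (inj_eq (addrI c)) => /eqP.
rewrite (@eq_Rintegral_itv _ _ _ _ (fun x => c * derive1 th x +
  (\int[mu]_(t in `[0, x]) g t) * derive1 th x)); last first.
  by move=> x xL; rewrite FE// mulrDl.
have gc := cont_on_primitive hL gi.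
have ti := within_integrable tc.
rewrite RintegralD//; last 2 first.
- exact: integrable_itvZ.
- by apply: within_integrable; exact: withinM.
rewrite (parts_integrable hL gi thd tc) g0 mul0r sub0r.
by rewrite RintegralZl// (FTC_segment (ltW hL) thd tc) thL subrr mulr0 add0r.
Qed.

Lemma primitive_cont c g F : mu.-integrable I (EFin \o g) ->
  (forall x, 0 <= x <= L -> F x = c + \int[mu]_(t in `[0, x]) g t) ->
  cont_on 0 L F.
Proof.
move=> gi FE; apply: (@within_eq _ _ _ (fun x => c + \int[mu]_(t in `[0, x]) g t)).
  by move=> x /FE.
by apply: withinD; [exact: within_cst|exact: cont_on_primitive].
Qed.

Lemma periodic_primitive2_weak c0 c1 g F F1 : mu.-integrable I (EFin \o g) ->
  periodic_primitive2 c0 c1 g F F1 ->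
  real_weak_derive L 1 F F1 /\ real_weak_derive L 2 F g.
Proof.
move=> gi [F1E FE F1L FL].
have F1i := within_integrable (primitive_cont gi F1E).
have w1 : real_weak_derive L 1 F F1.
  by move=> th t; rewrite expr1 mulN1r (primitive_parts F1i FE FL t).
split => // th t.
have t' : test_per L (derive1 th).
  split; first by move=> x; exact: (test_per_periodic 1).
  by move=> n x; rewrite -derive1Sn; case: t => _; apply.
have -> : derive1n 2 th = derive1n 1 (derive1 th) by [].
rewrite (w1 _ t') expr1 mulN1r sqrrN expr1n mul1r.
by rewrite (primitive_parts gi F1E F1L t) opprK.
Qed.

(** F is g integrated twice.  The two constants of integration make F1 and f - F have
    mean zero; then f - F is orthogonal to every mode, since each nonconstant mode is
    the second derivative of a mode. *)
Lemma weak2_regular f g : mu.-integrable I (EFin \o f) ->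
  mu.-integrable I (EFin \o g) -> real_weak_derive L 2 f g ->
  exists c0 c1 F F1, periodic_primitive2 c0 c1 g F F1 /\ ae_eq mu I f F.
Proof.
move=> fi gi fg.
have g0 : \int[mu]_(x in I) g x = 0.
  have t1 : test_per L (fun x => 1 * wave_mode 0 0 x) by exact: wave_mode_test.
  have e1 : (fun x => 1 * wave_mode 0 0 x) = (fun=> 1).
    by apply/funext => x; rewrite wave_mode0 cos0 mul1r.
  rewrite e1 in t1; have := fg _ t1; rewrite sqrrN expr1n mul1r.
  have -> : derive1n 2 (fun=> 1 : R) = fun=> 0.
    apply/funext => x; rewrite derive1nS derive1n1.
    have -> : derive1 (fun=> 1 : R) = fun=> 0.
      by apply/funext => y; exact: deriv_at_derive1 (deriv_at_cst _ _).
    exact: deriv_at_derive1 (deriv_at_cst _ _).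
  rewrite (@eq_Rintegral_itv _ _ _ (fun x => g x * 1) g); last by move=> x _; rewrite mulr1.
  move=> <-; rewrite (@eq_Rintegral_itv _ _ _ _ (fun=> 0)).
    by rewrite (Rintegral_itv_cst _ (ltW hL)) mul0r.
  by move=> x _; rewrite mulr0.
pose G x := \int[mu]_(t in `[0, x]) g t.
have Gc : cont_on 0 L G by exact: cont_on_primitive.
pose c1 := - ((\int[mu]_(x in I) G x) / L).
pose F1 x := c1 + G x.
have F1c : cont_on 0 L F1 by apply: withinD => //; exact: within_cst.
have F1i := within_integrable F1c.
have F10 : \int[mu]_(x in I) F1 x = 0.
  rewrite RintegralD//; last 2 first.
  - exact: integrable_itv_cst.
  - exact: within_integrable.
  by rewrite (Rintegral_itv_cst _ (ltW hL)) subr0 mulNr divfK ?gt_eqF// addNr.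
pose V x := \int[mu]_(t in `[0, x]) F1 t.
have Vc : cont_on 0 L V by exact: cont_on_primitive.
have Vi := within_integrable Vc.
pose c0 := (\int[mu]_(x in I) (f x - V x)) / L.
have PP : periodic_primitive2 c0 c1 g (fun x => c0 + V x) F1.
  split => //.
  - by rewrite /F1 /G set_itv1 Rintegral_set1 g0.
  - by rewrite /V set_itv1 Rintegral_set1 F10.
exists c0, c1, (fun x => c0 + V x), F1; split => //.
have [_ FW] := periodic_primitive2_weak gi PP.
have Fc : cont_on 0 L (fun x => c0 + V x) by apply: withinD => //; exact: within_cst.
have Fi := within_integrable Fc.
have hi : mu.-integrable I (EFin \o (fun x => f x - (c0 + V x))).
  exact: integrable_itvB.
suff : ae_eq mu I (fun x => f x - (c0 + V x)) (fun=> 0).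
  by apply: filterS => x ff xI; apply/eqP; rewrite -subr_eq0 ff.
apply: trig_orthogonal_ae0 => // -[|n] p.
  rewrite (@eq_Rintegral_itv _ _ _ _ (fun x => cos p * ((f x - V x) - c0))); last first.
    by move=> x _; rewrite wave_mode0 mulrC; ring.
  have fVi : mu.-integrable I (EFin \o (fun x => f x - V x)) by exact: integrable_itvB.
  have ci : mu.-integrable I (EFin \o (fun=> c0)) by exact: integrable_itv_cst.
  rewrite RintegralZl//; last exact: integrable_itvB.
  rewrite RintegralB// (Rintegral_itv_cst _ (ltW hL)) subr0 divfK ?gt_eqF//.
  by rewrite subrr mulr0.
have [a [q aqd]] := wave_mode_primitive n p.
have [b [r brd]] := wave_mode_primitive n q.
have tt := wave_mode_test (a * b) n.+1 r.
have dd : derive1n 2 (fun x => a * b * wave_mode n.+1 r x) = wave_mode n.+1 p.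
  rewrite derive1nS derive1n1.
  have -> : derive1 (fun x => a * b * wave_mode n.+1 r x) =
      fun x => a * wave_mode n.+1 q x.
    apply/funext => x; apply: deriv_at_derive1.
    have := deriveZ_pt a (brd x); congr deriv_at.
    by apply/funext => y; rewrite mulrA.
  by apply/funext => x; exact: deriv_at_derive1.
have := fg _ tt; have := FW _ tt; rewrite dd => <- E.
rewrite (@eq_Rintegral_itv _ _ _ _ (fun x => f x * wave_mode n.+1 p x -
  (c0 + V x) * wave_mode n.+1 p x)); last by move=> x _; rewrite mulrBl.
have mc := @wave_mode_cont 0 L n.+1 p.
rewrite RintegralB//; [|exact: integrable_itvM|exact: integrable_itvM].
by rewrite E subrr.
Qed.

End Trigonometric.

(** * Periodic solutions of linear systems: the Fredholm alternative *)

Section Volterra.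
Context {R : realType}.
Variable L : R.
Hypothesis hL : 0 < L.
Implicit Types (f g h : R -> R) (x : R).
Local Notation mu := (@lebesgue_measure R).
Local Notation I := (`[0, L]%classic : set R).

Lemma cont_on_sum (J : finType) (f : J -> R -> R) a b :
  (forall j, cont_on a b (f j)) -> cont_on a b (fun x => \sum_j f j x).
Proof.
move=> fc; suff H (s : seq J) : cont_on a b (fun x => \sum_(j <- s) f j x) by exact: H.
elim: s => [|j s IH].
  by apply: (@within_eq _ _ _ (fun=> 0)) => [x _|]; [rewrite big_nil|exact: within_cst].
apply: (@within_eq _ _ _ (fun x => f j x + \sum_(j <- s) f j x)) => [x _|].
  by rewrite big_cons.
exact: withinD.
Qed.

Lemma Rintegral_itv_sum (J : finType) (f : J -> R -> R) a b :
  (forall j, mu.-integrable `[a, b] (EFin \o f j)) ->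
  \int[mu]_(x in `[a, b]) (\sum_j f j x) = \sum_j \int[mu]_(x in `[a, b]) f j x.
Proof.
move=> fi.
suff H (s : seq J) : mu.-integrable `[a, b] (EFin \o (fun x => \sum_(j <- s) f j x)) /\
    \int[mu]_(x in `[a, b]) (\sum_(j <- s) f j x) =
    \sum_(j <- s) \int[mu]_(x in `[a, b]) f j x by exact: (H _).2.
elim: s => [|j s [IHi IH]].
  have -> : (fun x => \sum_(j <- [::]) f j x) = (fun=> 0 : R).
    by apply/funext => x; rewrite big_nil.
  split; first by apply: within_integrable; exact: within_cst.
  by rewrite big_nil /Rintegral integral0.
have -> : (fun x => \sum_(j <- j :: s) f j x) = (fun x => f j x + \sum_(j <- s) f j x).
  by apply/funext => x; rewrite big_cons.
split; first by have := integrableD _ (fi j) IHi; exact.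
by rewrite RintegralD// big_cons IH.
Qed.

Lemma half_power_small (C e : R) : 0 < e -> exists n, C * 2^-1 ^+ n < e.
Proof.
move=> e0; pose n := (Num.truncn (C / e)).+1; exists n.
have Cn : C < e * n%:R.
  by rewrite mulrC -ltr_pdivrMr// /n Num.Theory.truncnS_gt.
rewrite exprVn ltr_pdivrMr ?exprn_gt0//; apply: lt_trans Cn _.
rewrite ltr_pM2l// -natrX ltr_nat; exact: ltn_expl.
Qed.

(** A quantitative Weierstrass test; a geometric bound with ratio 1/2 is all that the
    Picard iteration needs. *)
Lemma uniform_series (D : nat -> R -> R) B : 0 <= B ->
  (forall n, cont_on 0 L (D n)) ->
  (forall n x, 0 <= x <= L -> `|D n x| <= B * 2^-1 ^+ n) ->
  exists S, cont_on 0 L S /\ forall n x, 0 <= x <= L ->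
    `|S x - \sum_(k < n) D k x| <= 2 * B * 2^-1 ^+ n.
Proof.
move=> B0 Dc DB; pose E n x := D n (clamp 0 L x).
have Ec n : continuous (E n) by exact: continuous_comp_clamp (ltW hL) (Dc n).
have EB n x : `|E n x| <= B * 2^-1 ^+ n by apply: DB; exact: clamp_in (ltW hL).
have tail n m x : `|\sum_(n <= k < n + m) E k x| <= 2 * B * 2^-1 ^+ n.
  suff : `|\sum_(n <= k < n + m) E k x| <= 2 * B * 2^-1 ^+ n - 2 * B * 2^-1 ^+ (n + m).
    move=> /le_trans; apply; rewrite gerBl mulr_ge0 ?exprn_ge0 ?mulr_ge0//.
  elim: m => [|m IH]; first by rewrite addn0 big_geq// normr0 subrr.
  rewrite addnS big_nat_recr ?leq_addr//=.
  apply: le_trans (ler_normD _ _) _; have := EB (n + m)%N x; rewrite exprS.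
  by lra.
pose u x : R^nat := fun n => \sum_(0 <= k < n) E k x.
have uc x : cvgn (u x).
  have gc : cvgn (series (geometric B (2^-1 : R))).
    by apply: is_cvg_geometric_series; rewrite gtr0_norm// invf_lt1// ltr1n.
  apply: (normed_cvg (u_ := fun n => E n x)).
  apply: (series_le_cvg _ _ _ gc) => n /=.
  - exact: normr_ge0.
  - by rewrite /geometric/= mulr_ge0// exprn_ge0.
  - exact: EB.
pose S x := limn (u x).
have SB n x : `|S x - u x n| <= 2 * B * 2^-1 ^+ n.
  have cv : `|u x m - u x n| @[m --> \oo] --> `|S x - u x n|.
    apply: cvg_norm; apply: cvgB; last exact: cvg_cst.
    exact: uc.
  apply: (cvgr_to_le cv); exists n => // m /= nm; rewrite /u.
  rewrite -(subnKC nm) [X in X - _](big_cat_nat (n := n))//= ?leq_addr//.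
  by rewrite addrAC subrr add0r tail.
exists S; split.
- apply: continuous_subspaceT => x; apply/cvgrPdist_lt => e e0.
  have [n ne] := half_power_small (2 * B) (divr_gt0 e0 (ltr0n R 3)).
  have unc : {for x, continuous (fun y => u y n)}.
    rewrite /u; elim: n {ne} => [|n IH].
      have -> : (fun y => \sum_(0 <= k < 0) E k y) = (fun=> 0).
        by apply/funext => y; rewrite big_geq.
      exact: cvg_cst.
    have -> : (fun y => \sum_(0 <= k < n.+1) E k y) =
        (fun y => \sum_(0 <= k < n) E k y + E n y).
      by apply/funext => y; rewrite big_nat_recr.
    by apply: cvgD; [exact: IH|exact: Ec].
  have /cvgrPdist_lt/(_ (e / 3)) := unc; rewrite divr_gt0// => /(_ isT) H.
  near=> y.
  have H1 := le_lt_trans (SB n x) ne; have H2 := le_lt_trans (SB n y) ne.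
  have H3 : `|u x n - u y n| < e / 3 by near: y; exact: H.
  have -> : S x - S y = (S x - u x n) + (u x n - u y n) - (S y - u y n) by ring.
  apply: le_lt_trans (ler_normB _ _) _.
  by have := ler_normD (S x - u x n) (u x n - u y n); lra.
- move=> n x xL; have := SB n x; rewrite /u.
  by rewrite big_mkord; under eq_bigr do rewrite /E clamp_id//.
Unshelve. all: by end_near. Qed.

Section System.
Variables (N : nat) (P : 'I_N -> 'I_N -> R -> R).
Hypothesis Pc : forall i j, cont_on 0 L (P i j).
Implicit Types (Y G W : 'I_N -> R -> R).

Definition apply_system Y (i : 'I_N) x : R := \sum_j P i j x * Y j x.

Lemma apply_system_cont Y i : (forall j, cont_on 0 L (Y j)) ->
  cont_on 0 L (apply_system Y i).
Proof. by move=> Yc; apply: cont_on_sum => j; exact: withinM. Qed.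

(** The solution of Y' = P Y + G' with the initial value of G is the fixed point of
    Y |-> G + volterra Y. *)
Definition volterra Y (i : 'I_N) x : R := \int[mu]_(s in `[0, x]) apply_system Y i s.

Lemma volterra_cont Y i : (forall j, cont_on 0 L (Y j)) ->
  cont_on 0 L (volterra Y i).
Proof.
move=> Yc; apply: cont_on_primitive => //; apply: within_integrable.
exact: apply_system_cont.
Qed.

Lemma volterraB Y Z i x : (forall j, cont_on 0 L (Y j)) ->
  (forall j, cont_on 0 L (Z j)) -> 0 <= x <= L ->
  volterra Y i x - volterra Z i x = volterra (fun j x => Y j x - Z j x) i x.
Proof.
move=> Yc Zc /andP[_ xL]; rewrite /volterra -RintegralB//; last 2 first.
- by apply: integrable_sub_itv xL _; apply: within_integrable; exact: apply_system_cont.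
- by apply: integrable_sub_itv xL _; apply: within_integrable; exact: apply_system_cont.
apply: eq_Rintegral_itv => s _; rewrite /apply_system -sumrB.
by apply: eq_bigr => j _; rewrite mulrBr.
Qed.

Lemma system_bound : exists2 M, 0 < M & forall i Y B x, 0 <= x <= L ->
  (forall j, `|Y j x| <= B) -> `|apply_system Y i x| <= M * B.
Proof.
have /choice[m Hm] (ij : 'I_N * 'I_N) :
    exists m, 0 <= m /\ forall x, 0 <= x <= L -> `|P ij.1 ij.2 x| <= m.
  by have [m m0 Hm] := within_bounded (@Pc ij.1 ij.2); exists m.
exists (1 + \sum_i \sum_j m (i, j)).
  rewrite ltr_pwDl// sumr_ge0// => i _; rewrite sumr_ge0// => j _.
  by case: (Hm (i, j)).
move=> i Y B x xL YB; apply: (@le_trans _ _ (\sum_j m (i, j) * B)).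
  apply: le_trans (ler_norm_sum _ _ _) _; apply: ler_sum => j _.
  by rewrite normrM ler_pM//; case: (Hm (i, j)) => _; apply.
have B0 : 0 <= B by apply: le_trans (YB i).
rewrite -mulr_suml ler_wpM2r// [in leRHS](bigD1 i)//= addrCA lerDl addr_ge0//.
rewrite sumr_ge0// => k _; rewrite sumr_ge0// => j _.
by case: (Hm (k, j)).
Qed.

(** Picard iteration: measured with the weight exp (2 M x), the Volterra operator
    halves the sup norm. *)
Lemma volterra_solvable : exists2 C, 0 <= C & forall G A,
  (forall i, cont_on 0 L (G i)) ->
  (forall i x, 0 <= x <= L -> `|G i x| <= A) ->
  exists Y, [/\ forall i, cont_on 0 L (Y i),
    forall i x, 0 <= x <= L -> Y i x = G i x + volterra Y i x &
    forall i x, 0 <= x <= L -> `|Y i x| <= C * A].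
Proof.
have [M M0 HM] := system_bound.
pose E x := expR (2 * M * x + 0); have E0 x : 0 < E x by exact: expR_gt0.
have Ed x : deriv_at x (fun x => E x / (2 * M)) (E x).
  apply: (@deriv_at_eq _ _ _ (E x * (2 * M) * (2 * M)^-1 + E x * 0)).
    apply: deriveM_pt; last exact: deriv_at_cst.
    by apply: derive_comp_pt; [exact: is_derive_expR|exact: derive_affine_pt].
  by field; rewrite gt_eqF.
have Ec a b : cont_on a b E.
  apply: (@deriv_at_within _ _ _ _ (fun x => E x * (2 * M))) => x _.
  by apply: derive_comp_pt; [exact: is_derive_expR|exact: derive_affine_pt].
have halve Y B : (forall j, cont_on 0 L (Y j)) ->
    (forall j x, 0 <= x <= L -> `|Y j x| <= B * E x) ->
    forall i x, 0 <= x <= L -> `|volterra Y i x| <= B / 2 * E x.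
  move=> Yc YB i x /andP[x0 xL].
  have B0 : 0 <= B.
    have := YB i 0; rewrite lexx (ltW hL) => /(_ isT).
    by move=> /(le_trans (normr_ge0 _)); rewrite pmulr_lge0.
  have ai : mu.-integrable `[0, x] (EFin \o apply_system Y i).
    by apply: integrable_sub_itv xL _; apply: within_integrable; exact: apply_system_cont.
  apply: le_trans (le_normr_Rintegral _ ai) _ => //.
  have MB : mu.-integrable `[0, x] (EFin \o (fun s => M * B * E s)).
    by apply: within_integrable; apply: withinM => //; exact: within_cst.
  apply: (@le_trans _ _ (\int[mu]_(s in `[0, x]) (M * B * E s))).
    apply: le_Rintegral_itv => //; first by have := integrable_norm ai.
    move=> s /andP[s0 sx]; have sL : 0 <= s <= L by rewrite s0 (le_trans sx).
    rewrite -mulrA; apply: HM => // j; exact: YB.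
  rewrite RintegralZl//; last exact: within_integrable.
  rewrite (FTC_segment x0 (fun t _ => Ed t))// -mulrBl.
  have -> : M * B * ((E x - E 0) / (2 * M)) = B / 2 * (E x - E 0).
    by field; rewrite gt_eqF.
  by rewrite ler_wpM2l ?divr_ge0// gerBl ltW.
exists (2 * E L); first by rewrite mulr_ge0// ltW.
move=> G A Gc GA.
case: (ltnP 0 N) => [N0|]; last first.
  rewrite leqn0 => /eqP N0; exists G.
  by split=> i; suff: False by []; case: i => m; rewrite N0.
have A0 : 0 <= A.
  have := GA (Ordinal N0) 0; rewrite lexx (ltW hL) => /(_ isT).
  exact: le_trans.
pose D n := iter n volterra G.
have Dc n : forall i, cont_on 0 L (D n i).
  elim: n => [|n IH] i; first exact: Gc.
  exact: volterra_cont.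
have E1 x : 0 <= x -> 1 <= E x.
  by move=> x0; rewrite /E addr0 -expR0 ler_expR mulr_ge0// mulr_ge0// ltW.
have DB n : forall i x, 0 <= x <= L -> `|D n i x| <= A * 2^-1 ^+ n * E x.
  elim: n => [|n IH] i x xL.
    rewrite expr0 mulr1; apply: le_trans (GA i x xL) _.
    by rewrite ler_peMr// E1//; case/andP: xL.
  by rewrite exprSr mulrA; exact: halve.
have EL x : 0 <= x <= L -> E x <= E L.
  by move=> /andP[_ xL]; rewrite ler_expR lerD2r ler_wpM2l// mulr_ge0// ltW.
have DB' n i x : 0 <= x <= L -> `|D n i x| <= A * E L * 2^-1 ^+ n.
  move=> xL; apply: le_trans (DB n i x xL) _; rewrite mulrAC ler_wpM2r//.
  by rewrite ler_wpM2l// EL.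
have AE0 : 0 <= A * E L by rewrite mulr_ge0// ltW.
have /choice[Y HY] i : exists S, cont_on 0 L S /\ forall n x, 0 <= x <= L ->
    `|S x - \sum_(k < n) D k i x| <= 2 * (A * E L) * 2^-1 ^+ n.
  apply: (@uniform_series (fun n => D n i) (A * E L)) => // n x xL.
  exact: DB'.
have Yc i : cont_on 0 L (Y i) by case: (HY i).
pose S n i x := \sum_(k < n) D k i x.
have Sc n i : cont_on 0 L (S n i) by apply: cont_on_sum => k; exact: Dc.
have SS n i x : 0 <= x <= L -> S n.+1 i x = G i x + volterra (S n) i x.
  move=> xL; rewrite /S big_ord_recl; congr (_ + _).
  have xL' : x <= L by case/andP: xL.
  rewrite /volterra [RHS](@eq_Rintegral_itv _ _ _ _
    (fun s => \sum_(k < n) apply_system (D k) i s)); last first.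
    move=> s _; rewrite /apply_system exchange_big/=; apply: eq_bigr => j _.
    by rewrite mulr_sumr.
  rewrite Rintegral_itv_sum// => k; apply: integrable_sub_itv xL' _.
  by apply: within_integrable; exact: apply_system_cont.
exists Y; split => //.
- move=> i x xL; apply/eqP; rewrite -subr_eq0 -normr_le0 leNgt; apply/negP.
  set r := `|_| => r0.
  have [n] := half_power_small (2 * (2 * (A * E L) * E L)) r0.
  rewrite ltNge => /negP; apply.
  have [_ /(_ n.+1 x xL) H1] := HY i.
  have H2 : `|volterra (S n) i x - volterra (Y) i x| <=
      2 * (A * E L) * 2^-1 ^+ n / 2 * E x.
    rewrite volterraB//; apply: halve => //.
      by move=> j; exact: withinB.
    move=> j s sL; rewrite distrC; have [_ /(_ n s sL) H] := HY j.
    apply: le_trans H _; apply: ler_peMr; last by apply: E1; case/andP: sL.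
    by apply: mulr_ge0; [exact: mulr_ge0|rewrite exprn_ge0].
  rewrite -/(S n.+1 i x) in H1.
  have -> : r = `|(Y i x - S n.+1 i x) + (volterra (S n) i x - volterra Y i x)|.
    by rewrite /r SS//; congr `|_|; ring.
  apply: le_trans (ler_normD _ _) _.
  have p0 : 0 <= 2^-1 ^+ n :> R by rewrite exprn_ge0.
  have q0 : 0 <= A * E L * 2^-1 ^+ n by rewrite mulr_ge0.
  have EE := EL x xL; have E1L := E1 L (ltW hL).
  have H3 : A * E L * 2^-1 ^+ n * E x <= A * E L * 2^-1 ^+ n * E L by rewrite ler_wpM2l.
  have H4 : A * E L * 2^-1 ^+ n <= A * E L * 2^-1 ^+ n * E L by rewrite ler_peMr.
  by move: H1; rewrite exprS; lra.
- move=> i x xL; have [_ /(_ 0%N x xL)] := HY i.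
  by rewrite big_ord0 subr0 expr0 mulr1 mulrA mulrAC.
Qed.

Definition periodic_solution W Y : Prop := [/\ forall i, cont_on 0 L (Y i),
  forall i x, 0 <= x <= L -> Y i x = Y i 0 +
    \int[mu]_(s in `[0, x]) (apply_system Y i s + W i s) &
  forall i, Y i L = Y i 0].

(** If the homogeneous system has no periodic solution but 0, its monodromy
    matrix minus the identity is invertible, which lets initial values be chosen
    so that the solution of the inhomogeneous system closes up. *)
Lemma fredholm_periodic :
  (forall Y, periodic_solution (fun _ _ => 0) Y ->
    forall i x, 0 <= x <= L -> Y i x = 0) ->
  exists2 C, 0 <= C & forall W, (forall i, mu.-integrable I (EFin \o W i)) ->
    exists Y, periodic_solution W Y /\ forall i x, 0 <= x <= L ->
      `|Y i x| <= C * \sum_j \int[mu]_(s in I) `|W j s|.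
Proof.
move=> hom; have [C C0 HC] := volterra_solvable.
have LL : 0 <= L <= L by rewrite lexx ltW.
have L00 : 0 <= (0 : R) <= L by rewrite lexx ltW.
have v0 Y i : volterra Y i 0 = 0 by rewrite /volterra set_itv1 Rintegral_set1.
have /choice[Phi HPhi] (k : 'I_N) : exists Y, [/\ forall i, cont_on 0 L (Y i),
    forall i x, 0 <= x <= L -> Y i x = (i == k)%:R + volterra Y i x &
    forall i x, 0 <= x <= L -> `|Y i x| <= C].
  have [||Y [Yc YE YB]] := HC (fun i _ => (i == k)%:R) 1.
  - by move=> i; exact: within_cst.
  - by move=> i x _; case: (_ == _); rewrite ?normr1 ?normr0.
  by exists Y; split => // i x xL; rewrite -[C]mulr1 YB.
pose mono : 'M[R]_N := \matrix_(k, i) (Phi k i L - (i == k)%:R).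
pose comb (v : 'rV[R]_N) i x := \sum_k v 0 k * Phi k i x.
have comb_c v i : cont_on 0 L (comb v i).
  apply: cont_on_sum => k; apply: withinM; first exact: within_cst.
  by case: (HPhi k).
have comb_int v i x : 0 <= x <= L -> comb v i x = v 0 i + volterra (comb v) i x.
  move=> xL; have xL' : x <= L by case/andP: xL.
  rewrite /volterra (@eq_Rintegral_itv _ _ _ _
    (fun s => \sum_k v 0 k * apply_system (Phi k) i s)); last first.
    move=> s _; rewrite /apply_system /comb; under eq_bigr do rewrite mulr_sumr.
    rewrite exchange_big/=; apply: eq_bigr => k _; rewrite mulr_sumr.
    by apply: eq_bigr => j _; rewrite mulrCA.
  have ai k : mu.-integrable `[0, x] (EFin \o apply_system (Phi k) i).
    apply: integrable_sub_itv xL' _; apply: within_integrable.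
    by apply: apply_system_cont; case: (HPhi k).
  rewrite Rintegral_itv_sum; last first.
    by move=> k; have := integrableZl _ (v 0 k) (ai k); exact.
  under [X in _ + X]eq_bigr do rewrite RintegralZl//.
  have -> : v 0 i = \sum_k v 0 k * (i == k)%:R.
    rewrite (bigD1 i)//= eqxx mulr1 big1 ?addr0// => k ki.
    by rewrite eq_sym (negbTE ki) mulr0.
  rewrite -big_split/=; apply: eq_bigr => k _; rewrite -mulrDr; congr (_ * _).
  by case: (HPhi k) => _ -> .
have comb0 v i : comb v i 0 = v 0 i by rewrite comb_int// v0 addr0.
have combL v i : comb v i L = v 0 i + (v *m mono) 0 i.
  rewrite mxE -(comb0 v) /comb -big_split/=; apply: eq_bigr => k _.
  rewrite mxE mulrBr; case: (HPhi k) => _ /(_ i 0 L00) -> _.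
  by rewrite v0 addr0 addrCA subrr addr0.
have munit : mono \in unitmx.
  rewrite -row_free_unit; apply: inj_row_free => v vm.
  apply/rowP => i; rewrite mxE -(comb0 v); apply: (hom (comb v)) => //.
  split => // [j x xL|j].
  - rewrite comb0 comb_int//; congr (_ + _).
    by apply: eq_Rintegral_itv => s _; rewrite addr0.
  - by rewrite combL comb0 vm mxE addr0.
pose S := \sum_j \sum_k `|invmx mono j k|.
have S0 : 0 <= S by rewrite sumr_ge0// => j _; rewrite sumr_ge0.
exists (C + N%:R * (C * S * C)); first by rewrite addr_ge0 ?mulr_ge0.
move=> W Wi; pose A := \sum_j \int[mu]_(s in I) `|W j s|.
have W0 j : 0 <= \int[mu]_(s in I) `|W j s| by exact: Rintegral_itv_ge0.
have A0 : 0 <= A by rewrite sumr_ge0.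
have [||Z [Zc ZE ZB]] := HC (fun i x => \int[mu]_(s in `[0, x]) W i s) A.
- by move=> i; exact: cont_on_primitive.
- move=> i x xL; apply: le_trans (Rintegral_sub_le xL (Wi i)) _.
  by rewrite /A (bigD1 i)//= lerDl sumr_ge0.
pose z : 'rV[R]_N := \row_i Z i L.
pose v := - z *m invmx mono.
have vB k : `|v 0 k| <= C * A * S.
  rewrite mxE; apply: le_trans (ler_norm_sum _ _ _) _.
  rewrite mulr_sumr; apply: ler_sum => j _.
  rewrite normrM !mxE normrN; apply: ler_pM => //; first exact: ZB.
  by rewrite (bigD1 k)//= lerDl sumr_ge0.
have Z0 i : Z i 0 = 0 by rewrite ZE// v0 set_itv1 Rintegral_set1 addr0.
pose Y i x := Z i x + comb v i x.
have Yc i : cont_on 0 L (Y i) by apply: withinD.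
exists Y; split; first split => //.
- move=> i x xL; have xL' : x <= L by case/andP: xL.
  have ii Q : (forall j, cont_on 0 L (Q j)) ->
      mu.-integrable `[0, x] (EFin \o apply_system Q i).
    move=> Qc; apply: integrable_sub_itv xL' _; apply: within_integrable.
    exact: apply_system_cont.
  rewrite RintegralD//; [|exact: ii|exact: integrable_sub_itv (Wi i)].
  rewrite (@eq_Rintegral_itv _ _ _ (apply_system Y i)
    (fun s => apply_system Z i s + apply_system (comb v) i s)); last first.
    move=> s _; rewrite /apply_system -big_split/=; apply: eq_bigr => j _.
    by rewrite mulrDr.
  rewrite RintegralD//; [|exact: ii|exact: ii].
  rewrite /Y Z0 add0r comb0 ZE// comb_int// /volterra; ring.
- move=> i; rewrite /Y Z0 comb0 add0r combL /v -mulmxA mulVmx// mulmx1 !mxE.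
  by ring.
- move=> i x xL; apply: le_trans (ler_normD _ _) _; rewrite -/A mulrDl.
  apply: lerD; first exact: ZB.
  rewrite /comb; apply: le_trans (ler_norm_sum _ _ _) _.
  apply: (@le_trans _ _ (\sum_(k < N) (C * A * S * C))).
    apply: ler_sum => k _; rewrite normrM; apply: ler_pM => //.
    by case: (HPhi k) => _ _; apply.
  by rewrite sumr_const card_ord -[X in X <= _]mulr_natl -mulrA; lra.
Qed.

End System.
End Volterra.

(** * Periodic eigenvalues of a Hill operator: reality, positivity, discreteness *)

Section Hill.
Context {R : realType}.
Variables (L al : R) (V : R -> R).
Hypotheses (hL : 0 < L) (al0 : 0 < al) (Vc : cont_on 0 L V).
Implicit Types (f g y : R -> R) (x lam : R).
Local Notation mu := (@lebesgue_measure R).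
Local Notation I := (`[0, L]%classic : set R).

(** The eigenvalue equation - al y'' + V y = lam y on the circle. *)
Definition periodic_eigen lam y y1 : Prop :=
  [/\ solves 0 L (fun x => (V x - lam) / al) y y1, y 0 = y L & y1 0 = y1 L].

Lemma hill_coef_cont lam : cont_on 0 L (fun x => (V x - lam) / al).
Proof.
apply: withinM; last exact: within_cst.
by apply: withinB => //; exact: within_cst.
Qed.

(** Multiplication by y and integration by parts: the integral of
    (V - lam) y^2 + al y'^2 is zero. *)
Lemma hill_positive lam y y1 : (forall x, 0 <= x <= L -> lam < V x) ->
  periodic_eigen lam y y1 -> forall x, 0 <= x <= L -> y x = 0.
Proof.
move=> lV [s yL y1L].
have yc := solves_within s; have y1c := solves_within1 s.
have qc := @hill_coef_cont lam.
have yd x : 0 <= x <= L -> deriv_at x y (y1 x) by move=> /s[].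
have y1d x : 0 <= x <= L -> deriv_at x y1 ((V x - lam) / al * y x) by move=> /s[].
have y2c : cont_on 0 L (fun x => (V x - lam) / al * y x) by exact: withinM.
have := parts_segment (ltW hL) yd y1d y1c y2c.
rewrite yL y1L subrr sub0r => E.
have fc : cont_on 0 L (fun x => y x * ((V x - lam) / al * y x) + y1 x * y1 x).
  by apply: withinD; exact: withinM.
have q0 x : 0 <= x <= L -> 0 < (V x - lam) / al.
  by move=> xL; rewrite divr_gt0// subr_gt0 lV.
have f0 x : 0 <= x <= L -> 0 <= y x * ((V x - lam) / al * y x) + y1 x * y1 x.
  move=> xL; apply: addr_ge0; last by rewrite -expr2 sqr_ge0.
  by rewrite mulrCA -expr2; apply: mulr_ge0; [rewrite ltW// q0|rewrite sqr_ge0].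
have fi : \int[mu]_(x in I) (y x * ((V x - lam) / al * y x) + y1 x * y1 x) = 0.
  rewrite RintegralD//; last 2 first.
  - by apply: within_integrable; exact: withinM.
  - by apply: within_integrable; exact: withinM.
  by rewrite E addNr.
move=> x xL; have := within_integral_eq0 hL fc f0 fi xL.
have q := q0 x xL; have := sqr_ge0 (y1 x); have := sqr_ge0 (y x).
rewrite mulrCA -!expr2 => y20 y120 E2.
apply/eqP; rewrite -sqrf_eq0; apply/eqP.
have : (V x - lam) / al * y x ^+ 2 = 0.
  by have : 0 <= (V x - lam) / al * y x ^+ 2; [rewrite mulr_ge0// ltW|lra].
by move=> /eqP; rewrite mulf_eq0 gt_eqF//= => /eqP.
Qed.

(** Self-adjointness: the Wronskian of the real and imaginary parts is periodic
    and has the derivative - (li / al) (yr ^ 2 + yi ^ 2). *)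
Lemma hill_eigenvalue_real lr li yr yr1 yi yi1 : li != 0 ->
  (forall x, 0 <= x <= L -> deriv_at x yr (yr1 x) /\
    deriv_at x yr1 ((V x - lr) / al * yr x + li / al * yi x)) ->
  (forall x, 0 <= x <= L -> deriv_at x yi (yi1 x) /\
    deriv_at x yi1 ((V x - lr) / al * yi x - li / al * yr x)) ->
  yr 0 = yr L -> yr1 0 = yr1 L -> yi 0 = yi L -> yi1 0 = yi1 L ->
  forall x, 0 <= x <= L -> yr x = 0 /\ yi x = 0.
Proof.
move=> li0 sr si rL r1L iL i1L.
have rc : cont_on 0 L yr by apply: (@deriv_at_within _ _ _ _ yr1) => x /sr[].
have ic : cont_on 0 L yi by apply: (@deriv_at_within _ _ _ _ yi1) => x /si[].
pose q x := yr x * yr x + yi x * yi x.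
have qc : cont_on 0 L q by apply: withinD; exact: withinM.
have Wd x : 0 <= x <= L -> deriv_at x (fun x => yr x * yi1 x - yr1 x * yi x)
    (- (li / al) * q x).
  move=> xL; have [rd r1d] := sr x xL; have [id i1d] := si x xL.
  apply: deriv_at_eq; first by apply: deriveB_pt; apply: deriveM_pt; eassumption.
  by rewrite /q; ring.
have Wc : cont_on 0 L (fun x => - (li / al) * q x).
  by apply: withinM => //; exact: within_cst.
have := FTC_segment (ltW hL) Wd Wc.
rewrite RintegralZl//; last exact: within_integrable.
rewrite rL r1L iL i1L subrr => /eqP.
rewrite mulf_eq0 oppr_eq0 mulf_eq0 invr_eq0 (negbTE li0) (gt_eqF al0)/= => /eqP qi.
move=> x xL; have q0 t : 0 <= t <= L -> 0 <= q t.
  by move=> _; rewrite /q addr_ge0// -expr2; exact: sqr_ge0.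
have := within_integral_eq0 hL qc q0 qi xL.
have := sqr_ge0 (yr x); have := sqr_ge0 (yi x); rewrite /q -!expr2 => i0 r0 E.
by split; apply/eqP; rewrite -sqrf_eq0; apply/eqP; lra.
Qed.

(** The Wronskian of two periodic solutions is periodic. *)
Lemma periodic_eigen_orthogonal lam lam' y y1 z z1 : lam != lam' ->
  periodic_eigen lam y y1 -> periodic_eigen lam' z z1 ->
  \int[mu]_(x in I) (y x * z x) = 0.
Proof.
move=> ll [sy yL y1L] [sz zL z1L].
have yc := solves_within sy; have zc := solves_within sz.
have c0 : (lam - lam') / al != 0.
  by rewrite mulf_neq0 ?subr_eq0// invr_eq0 gt_eqF.
have Wd x : 0 <= x <= L -> deriv_at x (wronskian y y1 z z1)
    ((lam - lam') / al * (y x * z x)).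
  move=> xL; apply: deriv_at_eq; first exact: (wronskian_deriv sy sz xL).
  by cbv beta; field; rewrite gt_eqF.
have Wc : cont_on 0 L (fun x => (lam - lam') / al * (y x * z x)).
  by apply: withinM; [exact: within_cst|exact: withinM].
have := FTC_segment (ltW hL) Wd Wc.
rewrite RintegralZl//; last by apply: within_integrable; exact: withinM.
rewrite /wronskian yL y1L zL z1L subrr => /eqP.
by rewrite mulf_eq0 (negbTE c0)/= => /eqP.
Qed.

(** The one-dimensional Sobolev inequality: as |(f^2)'| is at most f^2 + f'^2, the value
    of f^2 at x exceeds that at t by at most the energy, and t is averaged out. *)
Lemma sup_le_energy f f1 x : (forall x, 0 <= x <= L -> deriv_at x f (f1 x)) ->
  cont_on 0 L f1 -> 0 <= x <= L ->
  L * f x ^+ 2 <= \int[mu]_(t in I) (f t * f t) +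
    L * \int[mu]_(t in I) (f t * f t + f1 t * f1 t).
Proof.
move=> fd f1c /andP[x0 xL]; have fc := deriv_at_within fd.
have ec : cont_on 0 L (fun t => f t * f t + f1 t * f1 t).
  by apply: withinD; exact: withinM.
have [P [P0 Pd]] := primitive_exists (ltW hL) ec.
rewrite [X in _ + L * X](FTC_segment (ltW hL) Pd ec) P0 subr0.
have e0 t : 0 <= f t * f t + f1 t * f1 t by rewrite addr_ge0// -expr2; exact: sqr_ge0.
have Pm s t : 0 <= s -> s <= t -> t <= L -> P s <= P t.
  move=> s0 st tL; apply: (segment_ge0_le st) => [u /andP[su ut]|u _]; last exact: e0.
  by apply: Pd; rewrite (le_trans s0) ?(le_trans ut).
have key t : 0 <= t <= L -> f x ^+ 2 <= f t * f t + P L.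
  move=> /andP[t0 tL].
  have [xt|tx] := leP x t.
    have : f x * f x + P x <= f t * f t + P t.
      apply: (@segment_ge0_le _ x t (fun s => f s * f s + P s)
        (fun s => (f1 s * f s + f s * f1 s) + (f s * f s + f1 s * f1 s)) xt).
        move=> s /andP[xs st]; have sL : 0 <= s <= L by rewrite (le_trans x0) ?(le_trans st).
        by apply: deriveD_pt; [apply: deriveM_pt; exact: fd|exact: Pd].
      by move=> s _; have := sqr_ge0 (f s + f1 s); lra.
    have := Pm 0 x; rewrite lexx P0 => /(_ isT x0 xL).
    have := Pm t L; rewrite lexx => /(_ t0 tL isT).
    by rewrite expr2; lra.
  have : - (f t * f t) + P t <= - (f x * f x) + P x.
    apply: (@segment_ge0_le _ t x (fun s => - (f s * f s) + P s)
      (fun s => - (f1 s * f s + f s * f1 s) + (f s * f s + f1 s * f1 s)) (ltW tx)).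
      move=> s /andP[xs st]; have sL : 0 <= s <= L by rewrite (le_trans t0) ?(le_trans st).
      by apply: deriveD_pt; [apply: deriveN_pt; apply: deriveM_pt; exact: fd|exact: Pd].
    by move=> s _; have := sqr_ge0 (f s - f1 s); lra.
  have := Pm 0 t; rewrite lexx P0 => /(_ isT t0 tL).
  have := Pm x L; rewrite lexx => /(_ x0 xL isT).
  by rewrite expr2; lra.
have ffi : mu.-integrable I (EFin \o (fun t => f t * f t)).
  by apply: within_integrable; exact: withinM.
have : \int[mu]_(t in I) (f x ^+ 2) <= \int[mu]_(t in I) (f t * f t + P L).
  apply: le_Rintegral_itv => //; first exact: integrable_itv_cst.
  by apply: integrable_itvD => //; exact: integrable_itv_cst.
rewrite RintegralD//; last exact: integrable_itv_cst.
by rewrite !(Rintegral_itv_cst _ (ltW hL)) subr0 mulrC [P L * L]mulrC.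
Qed.

Lemma deriv_at_sum n (f : 'I_n -> R -> R) (d : 'I_n -> R) x :
  (forall i, deriv_at x (f i) (d i)) ->
  deriv_at x (fun t => \sum_i f i t) (\sum_i d i).
Proof.
elim: n f d => [|n IH] f d fd.
  have -> : (fun t => \sum_i f i t) = (fun=> 0).
    by apply/funext => t; rewrite big_ord0.
  by rewrite big_ord0; exact: deriv_at_cst.
have -> : (fun t => \sum_i f i t) = (fun t => f ord0 t + \sum_i f (lift ord0 i) t).
  by apply/funext => t; rewrite big_ord_recl.
by rewrite big_ord_recl; apply: deriveD_pt => //; exact: IH.
Qed.

(** A family of [n] orthonormal eigenfunctions with eigenvalues in [-La, La]: on
    their span the energy, hence the sup norm, is bounded by the L2 norm.  For
    the combination sum_i y_i(x) y_i this reads sum_i y_i(x) ^ 2 <= C with a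
    constant C independent of n, and integration over x yields n <= C L. *)
Lemma eigenvalue_count La : exists K : R, forall n (lam : 'I_n -> R)
    (y y1 : 'I_n -> R -> R), injective lam -> (forall i, `|lam i| <= La) ->
  (forall i, periodic_eigen (lam i) (y i) (y1 i)) ->
  (forall i, \int[mu]_(x in I) (y i x * y i x) = 1) -> n%:R <= K.
Proof.
have [m m0 Vm] := within_bounded Vc.
pose K := L^-1 + 1 + (m + `|La|) / al.
have K0 : 0 <= K by rewrite !addr_ge0 ?divr_ge0 ?invr_ge0 ?addr_ge0 ?(ltW hL) ?(ltW al0).
exists (K * L) => n lam y y1 laminj lamB ye ynorm.
have yc i : cont_on 0 L (y i) by case: (ye i) => /solves_within.
have y1c i : cont_on 0 L (y1 i) by case: (ye i) => /solves_within1.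
have yyi i j : mu.-integrable I (EFin \o (fun x => y i x * y j x)).
  by apply: within_integrable; exact: withinM.
have orth i j : \int[mu]_(x in I) (y i x * y j x) = (i == j)%:R.
  have [->|ij] := eqVneq i j; first exact: ynorm.
  apply: (periodic_eigen_orthogonal _ (ye i) (ye j)).
  by rewrite (inj_eq laminj).
pose S x := \sum_i y i x ^+ 2.
have quad (c d : 'I_n -> R) :
    \int[mu]_(t in I) (\sum_i \sum_j c i * d j * (y i t * y j t)) = \sum_i c i * d i.
  rewrite Rintegral_itv_sum; last first.
    move=> i; apply: within_integrable; apply: cont_on_sum => j.
    by apply: withinM; [exact: within_cst|exact: withinM].
  apply: eq_bigr => i _; rewrite Rintegral_itv_sum; last first.
    by move=> j; exact: integrable_itvZ.
  rewrite (bigD1 i)//= RintegralZl// orth eqxx mulr1 big1 ?addr0// => j ji.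
  by rewrite RintegralZl// orth eq_sym (negbTE ji) mulr0.
have key x : 0 <= x <= L -> S x <= K.
  move=> xL; pose c i := y i x; pose f t := \sum_i c i * y i t.
  pose f1 t := \sum_i c i * y1 i t.
  pose f2 t := \sum_i c i * ((V t - lam i) / al * y i t).
  have fx : f x = S x by apply: eq_bigr => i _; rewrite expr2.
  have fd t : 0 <= t <= L -> deriv_at t f (f1 t).
    move=> tL; apply: deriv_at_sum => i; apply: deriveZ_pt.
    by case: (ye i) => /(_ t tL)[].
  have f1d t : 0 <= t <= L -> deriv_at t f1 (f2 t).
    move=> tL; apply: deriv_at_sum => i; apply: deriveZ_pt.
    by case: (ye i) => /(_ t tL)[].
  have fc := deriv_at_within fd; have f1c := deriv_at_within f1d.
  have f2c : cont_on 0 L f2.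
    apply: cont_on_sum => i; apply: withinM; first exact: within_cst.
    by apply: withinM => //; exact: hill_coef_cont.
  have ffi : mu.-integrable I (EFin \o (fun t => f t * f t)).
    by apply: within_integrable; exact: withinM.
  have f11i : mu.-integrable I (EFin \o (fun t => f1 t * f1 t)).
    by apply: within_integrable; exact: withinM.
  have ff : \int[mu]_(t in I) (f t * f t) = S x.
    rewrite (@eq_Rintegral_itv _ _ _ _
      (fun t => \sum_i \sum_j c i * c j * (y i t * y j t))).
      by rewrite quad; apply: eq_bigr => i _; rewrite expr2.
    move=> t _; rewrite /f mulr_suml; apply: eq_bigr => i _; rewrite mulr_sumr.
    by apply: eq_bigr => j _; ring.
  have fL : f L = f 0 by apply: eq_bigr => i _; case: (ye i) => _ ->.
  have f1L : f1 L = f1 0 by apply: eq_bigr => i _; case: (ye i) => _ _ ->.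
  have S0 t : 0 <= S t by rewrite sumr_ge0// => i _; rewrite sqr_ge0.
  have f11 : al * \int[mu]_(t in I) (f1 t * f1 t) <= (m + `|La|) * S x.
    have := parts_segment (ltW hL) fd f1d f1c f2c.
    rewrite fL f1L subrr sub0r => /eqP; rewrite -eqr_oppLR => /eqP <-.
    rewrite (@eq_Rintegral_itv _ _ _ (fun t => f t * f2 t) (fun t =>
      al^-1 * (V t * (f t * f t) -
        \sum_i \sum_j c i * (c j * lam j) * (y i t * y j t)))); last first.
      move=> t _; have -> : f2 t = al^-1 * (V t * f t - \sum_j c j * lam j * y j t).
        rewrite /f2 /f mulr_sumr -sumrB mulr_sumr; apply: eq_bigr => i _.
        by field; rewrite gt_eqF.
      rewrite mulrCA mulrBr; congr (_ * (_ - _)); first by rewrite mulrCA.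
      rewrite /f mulr_suml; apply: eq_bigr => i _; rewrite mulr_sumr.
      by apply: eq_bigr => j _; ring.
    have Vffi : mu.-integrable I (EFin \o (fun t => V t * (f t * f t))).
      by apply: within_integrable; apply: withinM => //; exact: withinM.
    have qi : mu.-integrable I (EFin \o (fun t =>
        \sum_i \sum_j c i * (c j * lam j) * (y i t * y j t))).
      apply: within_integrable; apply: cont_on_sum => i; apply: cont_on_sum => j.
      by apply: withinM; [exact: within_cst|exact: withinM].
    rewrite RintegralZl//; last exact: integrable_itvB.
    rewrite -mulrN mulrA divff ?gt_eqF// mul1r RintegralB// quad opprB.
    have h1 : \sum_i c i * (c i * lam i) <= `|La| * S x.
      rewrite /S mulr_sumr; apply: ler_sum => i _.
      rewrite mulrA -expr2 mulrC ler_wpM2r ?sqr_ge0//.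
      exact: le_trans (ler_norm _) (le_trans (lamB i) (ler_norm _)).
    have h2 : - (m * S x) <= \int[mu]_(t in I) (V t * (f t * f t)).
      rewrite -ff -mulNr -RintegralZl//; apply: le_Rintegral_itv => //.
        exact: integrable_itvZ.
      move=> t tL; rewrite -expr2 ler_wpM2r ?sqr_ge0//.
      by have := Vm t tL; rewrite ler_norml => /andP[].
    by lra.
  have := sup_le_energy fd f1c xL; rewrite fx RintegralD// ff => sup.
  have [Sx0|Sx0] := eqVneq (S x) 0; first by rewrite Sx0.
  have Sp : 0 < S x by rewrite lt_neqAle eq_sym Sx0 S0.
  have {}f11 : \int[mu]_(t in I) (f1 t * f1 t) <= (m + `|La|) / al * S x.
    by rewrite mulrAC ler_pdivlMr// mulrC.
  rewrite -(ler_pM2r Sp) -expr2 -(ler_pM2l hL) /K.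
  have -> : L * ((L^-1 + 1 + (m + `|La|) / al) * S x) =
      S x + L * (S x + (m + `|La|) / al * S x).
    by field; rewrite !gt_eqF.
  by apply: le_trans sup _; rewrite lerD2l ler_pM2l// lerD2l.
have Sc : cont_on 0 L S.
  apply: cont_on_sum => i; apply: (@within_eq _ _ _ (fun x => y i x * y i x)).
    by move=> t _; rewrite expr2.
  exact: withinM.
have -> : n%:R = \int[mu]_(x in I) S x.
  rewrite /S Rintegral_itv_sum; last first.
    by move=> i; have := yyi i i; congr (mu.-integrable _ _); apply/funext => t /=; rewrite expr2.
  rewrite (eq_bigr (fun=> 1)); first by rewrite sumr_const card_ord.
  move=> i _; rewrite -(ynorm i); apply: eq_Rintegral_itv => t _; exact: expr2.
have := le_Rintegral_itv (within_integrable Sc) (integrable_itv_cst L K) key.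
by rewrite (Rintegral_itv_cst _ (ltW hL)) subr0.
Qed.

End Hill.

(** * Square integrability and weak derivatives under linear combinations *)

Section PeriodCalculus.
Context {R : realType}.
Variable L : R.
Hypothesis hL : 0 < L.
Implicit Types (f g : R -> R) (x c : R).
Local Notation mu := (@lebesgue_measure R).
Local Notation I := (`[0, L]%classic : set R).

Lemma cont_on_ae0 f : cont_on 0 L f -> ae_eq mu I f (fun=> 0) ->
  forall x, 0 <= x <= L -> f x = 0.
Proof.
move=> fc f0; have ffc : cont_on 0 L (fun x => f x * f x) by exact: withinM.
have ffi : \int[mu]_(x in I) (f x * f x) = 0.
  rewrite (@ae_eq_Rintegral _ _ _ (fun=> 0)).
  - by rewrite (Rintegral_itv_cst _ (ltW hL)) mul0r.
  - exact: within_integrable.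
  - exact: integrable_itv_cst.
  - by apply: filterS f0 => x f0 xI; rewrite f0// mul0r.
have ff0 x : 0 <= x <= L -> 0 <= f x * f x by rewrite -expr2 sqr_ge0.
move=> x xL; have /eqP := within_integral_eq0 hL ffc ff0 ffi xL.
by rewrite mulf_eq0 orbb => /eqP.
Qed.

Lemma L2rB f g : L2r L f -> L2r L g -> L2r L (fun x => f x - g x).
Proof.
move=> fL gL; have := L2rD fL (L2rZ (-1) gL).
by congr (L2r L _); apply/funext => x; rewrite mulN1r.
Qed.

Lemma cauchy_schwarz_period f : L2r L f ->
  (\int[mu]_(x in I) `|f x|) ^+ 2 <= L * \int[mu]_(x in I) (f x ^+ 2).
Proof.
move=> fL; have fi := L2r_integrable fL; have [_ f2i] := fL.
have fni : mu.-integrable I (EFin \o (fun x => `|f x|)) by have := integrable_norm fi.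
set N := \int[mu]_(x in I) `|f x|; pose m := N / L.
have : 0 <= \int[mu]_(x in I) ((`|f x| - m) ^+ 2).
  by apply: Rintegral_itv_ge0 => x _; exact: sqr_ge0.
rewrite (@eq_Rintegral_itv _ _ _ _ (fun x => f x ^+ 2 - (2 * m) * `|f x| + m ^+ 2)).
  rewrite RintegralD//; last 2 first.
  - by apply: integrable_itvB => //; exact: integrable_itvZ.
  - exact: integrable_itv_cst.
  rewrite RintegralB//; last exact: integrable_itvZ.
  rewrite RintegralZl// (Rintegral_itv_cst _ (ltW hL)) subr0 -/N.
  set J := \int[mu]_(x in I) _ => H.
  have -> : N ^+ 2 = L * (2 * m * N - m ^+ 2 * L) by rewrite /m; field; rewrite gt_eqF.
  by rewrite ler_wpM2l ?(ltW hL)//; lra.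
by move=> x _; rewrite sqrrB real_normK ?num_real//; ring.
Qed.

Lemma weak_derive_comb n (c d : R) f f' g g' :
  mu.-integrable I (EFin \o f) -> mu.-integrable I (EFin \o f') ->
  mu.-integrable I (EFin \o g) -> mu.-integrable I (EFin \o g') ->
  real_weak_derive L n f f' -> real_weak_derive L n g g' ->
  real_weak_derive L n (fun x => c * f x + d * g x) (fun x => c * f' x + d * g' x).
Proof.
move=> fi f'i gi g'i fw gw th t.
have tc m := @test_per_cont _ _ th m 0 L t.
have t0 : cont_on 0 L th by exact: (tc 0%N).
have lin (u v w : R -> R) : mu.-integrable I (EFin \o u) ->
    mu.-integrable I (EFin \o v) -> cont_on 0 L w ->
    \int[mu]_(x in I) ((c * u x + d * v x) * w x) =
    c * \int[mu]_(x in I) (u x * w x) + d * \int[mu]_(x in I) (v x * w x).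
  move=> ui vi wc; have uw := integrable_itvM ui wc; have vw := integrable_itvM vi wc.
  rewrite -!RintegralZl// -RintegralD//; [|exact: integrable_itvZ|exact: integrable_itvZ].
  by apply: eq_Rintegral_itv => x _; ring.
by rewrite !lin// (fw th t) (gw th t); ring.
Qed.

End PeriodCalculus.

(** * Periodic complex functions and their second derivative *)

Section ComplexParts.
Context {R : realType}.
Implicit Types (z : R[i]) (c : R).

Lemma ReD z z' : complex.Re (z + z') = complex.Re z + complex.Re z'.
Proof. by case: z; case: z'. Qed.
Lemma ImD z z' : complex.Im (z + z') = complex.Im z + complex.Im z'.
Proof. by case: z; case: z'. Qed.
Lemma ReN z : complex.Re (- z) = - complex.Re z. Proof. by case: z. Qed.
Lemma ImN z : complex.Im (- z) = - complex.Im z. Proof. by case: z. Qed.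
Lemma ReM z z' : complex.Re (z * z') =
  complex.Re z * complex.Re z' - complex.Im z * complex.Im z'.
Proof. by case: z; case: z'. Qed.
Lemma ImM z z' : complex.Im (z * z') =
  complex.Re z * complex.Im z' + complex.Im z * complex.Re z'.
Proof. by case: z; case: z'. Qed.

Lemma Re_real c : complex.Re (c%:C)%C = c. Proof. by []. Qed.
Lemma Im_real c : complex.Im (c%:C)%C = 0. Proof. by []. Qed.

Definition ReImE := (ReD, ImD, ReN, ImN, ReM, ImM, Re_real, Im_real).

Lemma complex_eqP z z' : complex.Re z = complex.Re z' ->
  complex.Im z = complex.Im z' -> z = z'.
Proof. by case: z => a b; case: z' => a' b' /= -> ->. Qed.

Lemma normc_sqrE z : Normc.normc z ^+ 2 = complex.Re z ^+ 2 + complex.Im z ^+ 2.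
Proof. by case: z => a b /=; rewrite sqr_sqrtr// addr_ge0// sqr_ge0. Qed.

End ComplexParts.

Section Periodization.
Context {R : realType}.
Variable L : R.
Hypothesis hL : 0 < L.
Implicit Types (f g F : R -> R) (x : R).
Local Notation mu := (@lebesgue_measure R).
Local Notation I := (`[0, L]%classic : set R).

Definition period_wrap x : R := x - L * (Num.floor (x / L))%:~R.

Lemma period_wrap_id x : 0 <= x < L -> period_wrap x = x.
Proof.
move=> /andP[x0 xL]; rewrite /period_wrap (@floor_def _ _ 0) ?mulr0 ?subr0//.
by rewrite add0r divr_ge0 ?(ltW hL)//= ltr_pdivrMr// mul1r.
Qed.

Lemma period_wrapD x : period_wrap (x + L) = period_wrap x.
Proof.
rewrite /period_wrap mulrDl divff ?gt_eqF// floorDrz ?rpred1//.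
by rewrite floor1 intrD mulrDr mulr1 opprD addrACA subrr addr0.
Qed.

Lemma measurable_period_wrap : measurable_fun [set: R] period_wrap.
Proof.
apply: measurable_funB => //; apply: measurable_funM => //.
apply: (@nondecreasing_measurable _ setT (fun x : R => (Num.floor (x / L))%:~R)) => //.
move=> x y xy; rewrite ler_int; apply: le_floor.
by rewrite ler_pM2r// invr_gt0.
Qed.

(** The clamp does nothing on [0, L); it lets the measurability of the extension follow
    from the continuity of [F] on the segment. *)
Definition periodize F x : R := F (clamp 0 L (period_wrap x)).

Lemma periodize_periodic F : periodic (periodize F) L.
Proof. by move=> x; rewrite /periodize period_wrapD. Qed.

Lemma periodizeE F : F L = F 0 -> forall x, 0 <= x <= L -> periodize F x = F x.
Proof.
move=> FL x /andP[x0]; rewrite le_eqVlt => /predU1P[->|xL].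
  have -> : periodize F L = periodize F 0 by have := periodize_periodic F 0; rewrite add0r.
  by rewrite /periodize period_wrap_id ?lexx// clamp_id ?lexx ?ltW.
by rewrite /periodize period_wrap_id ?x0// clamp_id ?x0 ?ltW.
Qed.

Lemma measurable_periodize F : cont_on 0 L F -> measurable_fun [set: R] (periodize F).
Proof.
move=> Fc; apply: (@measurableT_comp _ _ _ _ _ _ (fun x => F (clamp 0 L x))).
  by apply: continuous_measurable_fun; exact: continuous_comp_clamp (ltW hL) Fc.
exact: measurable_period_wrap.
Qed.

Lemma periodize_bounded F : cont_on 0 L F ->
  exists M, forall x, `|periodize F x| <= M.
Proof.
move=> /within_bounded[M _ FM]; exists M => x; apply: FM.
exact: clamp_in (ltW hL).
Qed.

Lemma periodize_L2r F : cont_on 0 L F -> L2r L (periodize F).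
Proof.
move=> Fc; have [M FM] := periodize_bounded Fc.
by apply: (@L2r_bounded _ _ _ M) => //; exact: measurable_periodize.
Qed.

Definition re (f : R -> R[i]) x : R := complex.Re (f x).
Definition im (f : R -> R[i]) x : R := complex.Im (f x).

Lemma L2perP (f : R -> R[i]) : L2per L f <-> [/\ periodic f L, L2r L (re f) & L2r L (im f)].
Proof. by split=> -[p r i]; split => //; exact/L2r_LfunP. Qed.

Lemma eq_perP (f g : R -> R[i]) : eq_per L f g <->
  ae_eq mu I (re f) (re g) /\ ae_eq mu I (im f) (im g).
Proof.
split=> [fg|[r i]].
  by split; apply: filterS fg => x /[apply] e; rewrite /re /im e.
apply: filterS2 r i => x r i xI.
by apply: complex_eqP; [exact: r|exact: i].
Qed.

Definition cplx (f g : R -> R) : R -> R[i] := fun x => (f x +i* g x)%C.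

Lemma L2per_cplx f g : periodic f L -> periodic g L -> L2r L f -> L2r L g ->
  L2per L (cplx f g).
Proof.
move=> fp gp fl gl; apply/L2perP; split => //.
by move=> x; rewrite /cplx fp gp.
Qed.

Lemma dxxP (f : R -> R[i]) : H2per L f ->
  L2per L (dxx L f) /\ weak_derive L 2 f (dxx L f).
Proof.
move=> [_ /(_ 2%N isT)[g gL gw]].
by have := @xgetPex _ (fun=> 0) [set g | L2per L g /\ weak_derive L 2 f g]
  (ex_intro _ g (conj gL gw)).
Qed.

Lemma dxx_unique (f g : R -> R[i]) : H2per L f -> L2per L g ->
  weak_derive L 2 f g -> eq_per L (dxx L f) g.
Proof.
move=> fH gL [gr gi]; have [dL [dr di]] := dxxP fH.
move/L2perP: gL => [_ rg ig]; move/L2perP: dL => [_ rd id].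
by apply/eq_perP; split; [apply: weak_derive_unique dr gr|apply: weak_derive_unique di gi];
  rewrite ?hL//; exact: L2r_integrable.
Qed.

(** Integration by parts against test functions shows that the classical derivatives
    are weak derivatives. *)
Lemma H2per_intro (f g : R -> R[i]) c0 c1 d0 d1 F1 G1 : L2per L f -> L2per L g ->
  periodic_primitive2 L c0 c1 (re g) (re f) F1 ->
  periodic_primitive2 L d0 d1 (im g) (im f) G1 ->
  H2per L f /\ eq_per L (dxx L f) g.
Proof.
move=> fL gL pr pi; move/L2perP: (gL) => [_ rg ig].
have [r1 r2] := periodic_primitive2_weak hL (L2r_integrable rg) pr.
have [i1 i2] := periodic_primitive2_weak hL (L2r_integrable ig) pi.
case: pr => F1E _ F1L _; case: pi => G1E _ G1L _.
have F1c := primitive_cont hL (L2r_integrable rg) F1E.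
have G1c := primitive_cont hL (L2r_integrable ig) G1E.
have fH : H2per L f.
  split => // -[|[|[|//]]] _.
  - by exists f => //; split => th _; rewrite expr0 mul1r.
  - exists (cplx (periodize F1) (periodize G1)).
      by apply: L2per_cplx; try exact: periodize_periodic; exact: periodize_L2r.
    split => th t; [rewrite (r1 th t)|rewrite (i1 th t)]; congr (_ * _);
      by apply: eq_Rintegral_itv => x xL /=; rewrite periodizeE.
  - by exists g.
by split => //; apply: dxx_unique.
Qed.

End Periodization.

(** * Scalar weak and strong formulations *)

Section Scalar.
Context {R : realType}.
Variables (L al : R) (V : R -> R).
Hypotheses (hL : 0 < L) (al0 : 0 < al) (Vc : cont_on 0 L V).
Implicit Types (f g y : R -> R) (x lr li : R).
Local Notation mu := (@lebesgue_measure R).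
Local Notation I := (`[0, L]%classic : set R).

(** The real and imaginary parts of - al f'' + V f - (lr + i li) f = w in the sense of
    periodic distributions. *)
Definition weak_hill lr li fr fi wr wi : Prop := exists gr gi,
  [/\ mu.-integrable I (EFin \o fr), mu.-integrable I (EFin \o fi),
      mu.-integrable I (EFin \o gr), mu.-integrable I (EFin \o gi) &
   [/\ real_weak_derive L 2 fr gr, real_weak_derive L 2 fi gi,
      ae_eq mu I (fun x => al * gr x)
        (fun x => (V x - lr) * fr x + li * fi x - wr x) &
      ae_eq mu I (fun x => al * gi x)
        (fun x => (V x - lr) * fi x - li * fr x - wi x)]].

(** The same equation as a first order system in integral form, which makes sense for
    an integrable right hand side. *)
Record strong_hill lr li wr wi fr fr1 fi fi1 : Prop := StrongHill {
  sh_r1c : cont_on 0 L fr1;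
  sh_i1c : cont_on 0 L fi1;
  sh_rc : cont_on 0 L fr;
  sh_ic : cont_on 0 L fi;
  sh_r : forall x, 0 <= x <= L -> fr x = fr 0 + \int[mu]_(t in `[0, x]) fr1 t;
  sh_i : forall x, 0 <= x <= L -> fi x = fi 0 + \int[mu]_(t in `[0, x]) fi1 t;
  sh_r1 : forall x, 0 <= x <= L -> fr1 x = fr1 0 + \int[mu]_(t in `[0, x])
    ((V t - lr) / al * fr t + li / al * fi t - wr t / al);
  sh_i1 : forall x, 0 <= x <= L -> fi1 x = fi1 0 + \int[mu]_(t in `[0, x])
    ((V t - lr) / al * fi t - li / al * fr t - wi t / al);
  sh_rL : fr L = fr 0;
  sh_iL : fi L = fi 0;
  sh_r1L : fr1 L = fr1 0;
  sh_i1L : fi1 L = fi1 0 }.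

Lemma weak_hillB lr li fr fi gr gi wr wi vr vi :
  weak_hill lr li fr fi wr wi -> weak_hill lr li gr gi vr vi ->
  weak_hill lr li (fun x => fr x - gr x) (fun x => fi x - gi x)
    (fun x => wr x - vr x) (fun x => wi x - vi x).
Proof.
move=> [f2 [f3 [i1 i2 i3 i4 [w1 w2 e1 e2]]]] [g2 [g3 [j1 j2 j3 j4 [v1 v2 d1 d2]]]].
exists (fun x => f2 x - g2 x), (fun x => f3 x - g3 x).
have subE (f g : R -> R) : (fun x => 1 * f x + (-1) * g x) = (fun x => f x - g x).
  by apply/funext => x; rewrite mul1r mulN1r.
split; [exact: integrable_itvB..|]; split.
- by have := weak_derive_comb 1 (-1) i1 i3 j1 j3 w1 v1; rewrite !subE.
- by have := weak_derive_comb 1 (-1) i2 i4 j2 j4 w2 v2; rewrite !subE.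
- by apply: filterS2 e1 d1 => x e d xI; rewrite mulrBr e// d//; ring.
- by apply: filterS2 e2 d2 => x e d xI; rewrite mulrBr e// d//; ring.
Qed.

Lemma weak_hill_strong lr li fr fi wr wi :
  mu.-integrable I (EFin \o wr) -> mu.-integrable I (EFin \o wi) ->
  weak_hill lr li fr fi wr wi -> exists Fr Fr1 Fi Fi1,
  [/\ strong_hill lr li wr wi Fr Fr1 Fi Fi1, ae_eq mu I fr Fr & ae_eq mu I fi Fi].
Proof.
move=> wri wii [gr [gi [ir ii igr igi [dr di er ei]]]].
have [c0 [c1 [Fr [Fr1 [[Fr1E FrE Fr1L FrL] eFr]]]]] := weak2_regular hL ir igr dr.
have [d0 [d1 [Fi [Fi1 [[Fi1E FiE Fi1L FiL] eFi]]]]] := weak2_regular hL ii igi di.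
have Fr1c := primitive_cont hL igr Fr1E; have Fi1c := primitive_cont hL igi Fi1E.
have Frc := primitive_cont hL (within_integrable Fr1c) FrE.
have Fic := primitive_cont hL (within_integrable Fi1c) FiE.
have L00 : 0 <= (0 : R) <= L by rewrite lexx ltW.
have int0 (h : R -> R) : \int[mu]_(t in `[0, 0]) h t = 0.
  by rewrite set_itv1 Rintegral_set1.
have qc : cont_on 0 L (fun t => (V t - lr) / al) by exact: hill_coef_cont.
have i1 : mu.-integrable I (EFin \o (fun t => (V t - lr) / al * Fr t + li / al * Fi t - wr t / al)).
  apply: integrable_itvB.
    apply: within_integrable; apply: withinD; apply: withinM => //; exact: within_cst.
  have := integrable_itvZ al^-1 wri; congr (mu.-integrable _ _).
  by apply/funext => x /=; rewrite mulrC.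
have i2 : mu.-integrable I (EFin \o (fun t => (V t - lr) / al * Fi t - li / al * Fr t - wi t / al)).
  apply: integrable_itvB.
    apply: within_integrable; apply: withinB; apply: withinM => //; exact: within_cst.
  have := integrable_itvZ al^-1 wii; congr (mu.-integrable _ _).
  by apply/funext => x /=; rewrite mulrC.
have sub (h h' : R -> R) x : 0 <= x <= L -> mu.-integrable I (EFin \o h) ->
    mu.-integrable I (EFin \o h') -> ae_eq mu I h h' ->
    \int[mu]_(t in `[0, x]) h t = \int[mu]_(t in `[0, x]) h' t.
  move=> /andP[x0 xL] hi h'i hh'; apply: ae_eq_Rintegral.
  - exact: integrable_sub_itv hi.
  - exact: integrable_sub_itv h'i.
  - by apply: ae_eq_subset hh'; apply: subset_itvl; rewrite bnd_simp.
have al1 : al != 0 by rewrite gt_eqF.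
exists Fr, Fr1, Fi, Fi1; split => //; split => //.
- by move=> x xL; rewrite FrE// [Fr 0]FrE// int0 addr0.
- by move=> x xL; rewrite FiE// [Fi 0]FiE// int0 addr0.
- move=> x xL; rewrite Fr1E// [Fr1 0]Fr1E// int0 addr0; congr (_ + _).
  apply: sub => //; apply: filterS3 er eFr eFi => t er eFr eFi tI.
  by apply: (mulfI al1); rewrite er// eFr// eFi//; field.
- move=> x xL; rewrite Fi1E// [Fi1 0]Fi1E// int0 addr0; congr (_ + _).
  apply: sub => //; apply: filterS3 ei eFr eFi => t ei eFr eFi tI.
  by apply: (mulfI al1); rewrite ei// eFr// eFi//; field.
Qed.

(** For w = 0 the right hand sides are continuous and their primitives are
    differentiable, on both sides at the end points too. *)
Lemma strong_hill_classical lr li fr fr1 fi fi1 :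
  strong_hill lr li (fun=> 0) (fun=> 0) fr fr1 fi fi1 -> exists yr yr1 yi yi1,
  [/\ forall x, 0 <= x <= L ->
      [/\ yr x = fr x, yi x = fi x, yr1 x = fr1 x & yi1 x = fi1 x],
    forall x, 0 <= x <= L -> deriv_at x yr (yr1 x) /\
      deriv_at x yr1 ((V x - lr) / al * yr x + li / al * yi x),
    forall x, 0 <= x <= L -> deriv_at x yi (yi1 x) /\
      deriv_at x yi1 ((V x - lr) / al * yi x - li / al * yr x) &
    [/\ yr 0 = yr L, yr1 0 = yr1 L, yi 0 = yi L & yi1 0 = yi1 L]].
Proof.
case=> r1c i1c rc ic rE iE r1E i1E rL iL r1L i1L.
have qc : cont_on 0 L (fun t => (V t - lr) / al) by exact: hill_coef_cont.
pose hr t := (V t - lr) / al * fr t + li / al * fi t.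
pose hi t := (V t - lr) / al * fi t - li / al * fr t.
have hrc : cont_on 0 L hr.
  by apply: withinD; apply: withinM => //; exact: within_cst.
have hic : cont_on 0 L hi.
  by apply: withinB; apply: withinM => //; exact: within_cst.
have prim c (h f : R -> R) : cont_on 0 L h ->
    (forall x, 0 <= x <= L -> f x = c + \int[mu]_(t in `[0, x]) h t) ->
    exists y, (forall x, 0 <= x <= L -> y x = f x) /\
      forall x, 0 <= x <= L -> deriv_at x y (h x).
  move=> hc fE; have [P [P0 Pd]] := primitive_exists (ltW hL) hc.
  exists (fun x => c + P x); split => x xL.
    case/andP: (xL) => x0 xL'; rewrite fE// (@FTC_segment _ 0 x P h)// ?P0 ?subr0//.
      by move=> t /andP[t0 tx]; apply: Pd; rewrite t0 (le_trans tx).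
    exact: within_subitv (lexx _) xL' hc.
  by have := deriveD_pt (deriv_at_cst c x) (Pd x xL); rewrite add0r.
have [yr [yrE yrd]] := prim _ _ _ r1c rE.
have [yi [yiE yid]] := prim _ _ _ i1c iE.
have r1E' x : 0 <= x <= L -> fr1 x = fr1 0 + \int[mu]_(t in `[0, x]) hr t.
  move=> xL; rewrite r1E//; congr (_ + _); apply: eq_Rintegral_itv => t _.
  by rewrite mul0r subr0.
have i1E' x : 0 <= x <= L -> fi1 x = fi1 0 + \int[mu]_(t in `[0, x]) hi t.
  move=> xL; rewrite i1E//; congr (_ + _); apply: eq_Rintegral_itv => t _.
  by rewrite mul0r subr0.
have [yr1 [yr1E yr1d]] := prim _ _ _ hrc r1E'.
have [yi1 [yi1E yi1d]] := prim _ _ _ hic i1E'.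
have LL : 0 <= L <= L by rewrite lexx ltW.
have L00 : 0 <= (0 : R) <= L by rewrite lexx ltW.
exists yr, yr1, yi, yi1; split.
- by move=> x xL; rewrite yrE// yiE// yr1E// yi1E.
- move=> x xL; rewrite yr1E//; split; first exact: yrd.
  by rewrite yrE// yiE//; exact: yr1d.
- move=> x xL; rewrite yi1E//; split; first exact: yid.
  by rewrite yrE// yiE//; exact: yi1d.
- by rewrite !yrE// !yr1E// !yiE// !yi1E.
Qed.

Lemma periodic_eigen_strong lam y y1 : periodic_eigen L al V lam y y1 ->
  strong_hill lam 0 (fun=> 0) (fun=> 0) y y1 (fun=> 0) (fun=> 0).
Proof.
move=> [s yL y1L]; have yc := solves_within s; have y1c := solves_within1 s.
have qc : cont_on 0 L (fun t => (V t - lam) / al) by exact: hill_coef_cont.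
have sd x : 0 <= x <= L -> forall t, 0 <= t <= x -> 0 <= t <= L.
  by move=> /andP[_ xL] t /andP[t0 tx]; rewrite t0 (le_trans tx).
have c0 a b : cont_on a b (fun=> 0 : R) by exact: within_cst.
have i0 x (h : R -> R) : (forall t, h t = 0) -> 0 <= x <= L ->
    \int[mu]_(t in `[0, x]) h t = 0.
  move=> h0 /andP[x0 _]; rewrite (@eq_Rintegral_itv _ _ _ _ (fun=> 0)); last by move=> t _.
  by rewrite Rintegral_itv_cst// mul0r.
split => //.
- move=> x xL; have /andP[x0 xL'] := xL.
  rewrite (@FTC_segment _ 0 x y y1)//; first by rewrite subrKC.
    by move=> t /(sd x xL)/s[].
  exact: within_subitv (lexx _) xL' y1c.
- by move=> x xL; rewrite i0// addr0.
- move=> x xL; have /andP[x0 xL'] := xL.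
  rewrite (@eq_Rintegral_itv _ _ _ _ (fun t => (V t - lam) / al * y t)); last first.
    by move=> t _; rewrite !mul0r subr0 addr0.
  rewrite (@FTC_segment _ 0 x y1 _ x0)// ?subrKC//.
    by move=> t /(sd x xL)/s[].
  by apply: within_subitv (lexx _) xL' _; exact: withinM.
- by move=> x xL; rewrite i0 ?addr0// => t; rewrite !mulr0 !mul0r !subr0.
Qed.

Lemma strong_hill_eigen lam fr fr1 fi fi1 :
  strong_hill lam 0 (fun=> 0) (fun=> 0) fr fr1 fi fi1 -> exists yr yr1 yi yi1,
  [/\ forall x, 0 <= x <= L -> yr x = fr x /\ yi x = fi x,
    periodic_eigen L al V lam yr yr1 & periodic_eigen L al V lam yi yi1].
Proof.
move=> /strong_hill_classical[yr [yr1 [yi [yi1 [E sr si [rL r1L iL i1L]]]]]].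
exists yr, yr1, yi, yi1; split.
- by move=> x /E[].
- by split => // x xL; have := sr x xL; rewrite mul0r mul0r addr0.
- by split => // x xL; have := si x xL; rewrite mul0r mul0r subr0.
Qed.

(** The scalar problem as a first order real system of size 4 in the order
    (fr, fr', fi, fi'). *)
Lemma scalar_fredholm lr li :
  (forall fr fr1 fi fi1, strong_hill lr li (fun=> 0) (fun=> 0) fr fr1 fi fi1 ->
    forall x, 0 <= x <= L -> fr x = 0 /\ fi x = 0) ->
  exists2 C, 0 <= C & forall wr wi, mu.-integrable I (EFin \o wr) ->
    mu.-integrable I (EFin \o wi) -> exists fr fr1 fi fi1,
    strong_hill lr li wr wi fr fr1 fi fi1 /\ forall x, 0 <= x <= L ->
    `|fr x| <= C * (\int[mu]_(t in I) `|wr t| + \int[mu]_(t in I) `|wi t|) /\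
    `|fi x| <= C * (\int[mu]_(t in I) `|wr t| + \int[mu]_(t in I) `|wi t|).
Proof.
move=> hom.
have qc : cont_on 0 L (fun t => (V t - lr) / al) by exact: hill_coef_cont.
pose q t := (V t - lr) / al.
pose P (i j : 'I_4) : R -> R := match val i, val j with
  | 0, 1 => fun=> 1 | 1, 0 => q | 1, 2 => fun=> li / al
  | 2, 3 => fun=> 1 | 3, 2 => q | 3, 0 => fun=> - (li / al)
  | _, _ => fun=> 0 end.
have Pc i j : cont_on 0 L (P i j).
  by case: i => [[|[|[|[|//]]]] ?]; case: j => [[|[|[|[|//]]]] ?]; rewrite /P/=;
    try exact: within_cst; exact: qc.
pose i0 : 'I_4 := @Ordinal 4 0 isT. pose i1 : 'I_4 := @Ordinal 4 1 isT.
pose i2 : 'I_4 := @Ordinal 4 2 isT. pose i3 : 'I_4 := @Ordinal 4 3 isT.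
have sum4 (F : 'I_4 -> R) : \sum_i F i = F i0 + F i1 + F i2 + F i3.
  rewrite !big_ord_recl big_ord0 addr0 !addrA.
  by congr (F _ + F _ + F _ + F _); apply: val_inj.
have sysE Y t : [/\ apply_system P Y i0 t = Y i1 t,
    apply_system P Y i1 t = q t * Y i0 t + li / al * Y i2 t,
    apply_system P Y i2 t = Y i3 t &
    apply_system P Y i3 t = q t * Y i2 t - li / al * Y i0 t].
  by rewrite /apply_system !sum4 /P/=; split; ring.
have strong wr wi Y : periodic_solution L P (fun i => match val i with
    | 1 => fun t => - (wr t / al) | 3 => fun t => - (wi t / al) | _ => fun=> 0 end) Y ->
    strong_hill lr li wr wi (Y i0) (Y i1) (Y i2) (Y i3).
  move=> [Yc YE YL]; split => //.
  - move=> x xL; rewrite YE//=; congr (_ + _); apply: eq_Rintegral_itv => t _.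
    by have [-> _ _ _] := sysE Y t; rewrite addr0.
  - move=> x xL; rewrite YE//=; congr (_ + _); apply: eq_Rintegral_itv => t _.
    by have [_ _ -> _] := sysE Y t; rewrite addr0.
  - move=> x xL; rewrite YE//=; congr (_ + _); apply: eq_Rintegral_itv => t _.
    by have [_ -> _ _] := sysE Y t.
  - move=> x xL; rewrite YE//=; congr (_ + _); apply: eq_Rintegral_itv => t _.
    by have [_ _ _ ->] := sysE Y t.
have [|C C0 HC] := @fredholm_periodic _ _ hL _ P Pc.
  move=> Y Y0; have Z0 : strong_hill lr li (fun=> 0) (fun=> 0) (Y i0) (Y i1) (Y i2) (Y i3).
    apply: strong; case: Y0 => Yc YE YL; split => // i x xL.
    rewrite YE//; congr (_ + _); apply: eq_Rintegral_itv => t _.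
    by congr (_ + _); case: i => [[|[|[|[|//]]]] ?] /=; rewrite ?mul0r ?oppr0.
  have Yz := hom _ _ _ _ Z0.
  have [yr [yr1 [yi [yi1 [E sr si _]]]]] := strong_hill_classical Z0.
  (* where a solution vanishes, integration by parts kills its derivative *)
  have d0 (y y1 h : R -> R) : (forall x, 0 <= x <= L -> deriv_at x y (y1 x)) ->
      (forall x, 0 <= x <= L -> deriv_at x y1 (h x)) -> cont_on 0 L h ->
      (forall x, 0 <= x <= L -> y x = 0) -> forall x, 0 <= x <= L -> y1 x = 0.
    move=> yd y1d hc y0; have y1c := deriv_at_within y1d.
    have := parts_segment (ltW hL) yd y1d y1c hc.
    rewrite !y0 ?lexx ?(ltW hL)// !mul0r subrr sub0r.
    rewrite (@eq_Rintegral_itv _ _ _ _ (fun=> 0)); last first.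
      by move=> t tL; rewrite y0// mul0r.
    rewrite (Rintegral_itv_cst _ (ltW hL)) mul0r => /esym/eqP; rewrite oppr_eq0 => /eqP y1i.
    have q0 t : 0 <= t <= L -> 0 <= y1 t * y1 t by rewrite -expr2 sqr_ge0.
    have yyc : cont_on 0 L (fun t => y1 t * y1 t) by exact: withinM.
    move=> x xL; have /eqP := within_integral_eq0 hL yyc q0 y1i xL.
    by rewrite mulf_eq0 orbb => /eqP.
  have yrc : cont_on 0 L yr by apply: (@deriv_at_within _ _ _ _ yr1) => x /sr[].
  have yic : cont_on 0 L yi by apply: (@deriv_at_within _ _ _ _ yi1) => x /si[].
  have hrc : cont_on 0 L (fun x => (V x - lr) / al * yr x + li / al * yi x).
    by apply: withinD; apply: withinM => //; exact: within_cst.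
  have hic : cont_on 0 L (fun x => (V x - lr) / al * yi x - li / al * yr x).
    by apply: withinB; apply: withinM => //; exact: within_cst.
  have r1z : forall x, 0 <= x <= L -> yr1 x = 0.
    apply: (d0 yr yr1 _ _ _ hrc); [by move=> x /sr[]|by move=> x /sr[]|].
    by move=> x xL; have [-> _ _ _] := E x xL; have [] := Yz x xL.
  have i1z : forall x, 0 <= x <= L -> yi1 x = 0.
    apply: (d0 yi yi1 _ _ _ hic); [by move=> x /si[]|by move=> x /si[]|].
    by move=> x xL; have [_ -> _ _] := E x xL; have [] := Yz x xL.
  move=> i x xL; have [e0 e2 e1 e3] := E x xL; have [z0 z2] := Yz x xL.
  case: i => [[|[|[|[|//]]]] ip].
  - by rewrite (_ : Ordinal ip = i0)//; exact: val_inj.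
  - by rewrite (_ : Ordinal ip = i1) -?e1 ?r1z//; exact: val_inj.
  - by rewrite (_ : Ordinal ip = i2)//; exact: val_inj.
  - by rewrite (_ : Ordinal ip = i3) -?e3 ?i1z//; exact: val_inj.
exists (C / al); first by rewrite divr_ge0// ltW.
move=> wr wi wri wii.
have scal w : mu.-integrable I (EFin \o w) -> mu.-integrable I (EFin \o (fun t => - (w t / al))).
  move=> wint; have := integrable_itvZ (- al^-1) wint; congr (mu.-integrable _ _).
  by apply/funext => x /=; rewrite mulNr mulrC.
have norm_scal w : mu.-integrable I (EFin \o w) ->
    \int[mu]_(t in I) `|- (w t / al)| = al^-1 * \int[mu]_(t in I) `|w t|.
  move=> wint; rewrite -RintegralZl//; last by have := integrable_norm wint.
  apply: eq_Rintegral_itv => t _.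
  by rewrite normrN normrM mulrC gtr0_norm// invr_gt0.
have z0 : mu.-integrable I (EFin \o (fun=> 0)) by exact: integrable_itv_cst.
have n0 : \int[mu]_(t in I) `|(0 : R)| = 0.
  by rewrite normr0 (Rintegral_itv_cst _ (ltW hL)) mul0r.
have [|Y [YP YB]] := HC (fun i => match val i with
    | 1 => fun t => - (wr t / al) | 3 => fun t => - (wi t / al) | _ => fun=> 0 end).
  by case=> [[|[|[|[|//]]]] ip] //=; exact: scal.
exists (Y i0), (Y i1), (Y i2), (Y i3); split; first exact: strong.
move=> x xL; have := YB i0 x xL; have := YB i2 x xL.
by rewrite sum4/= n0 !norm_scal// add0r addr0 -mulrDr mulrA.
Qed.

End Scalar.

(** * Reduction of the system to two scalar operators *)

Section Reduction.
Context {R : realType}.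
Variables (L a b B : R) (phi : R -> R).
Hypotheses (hL : 0 < L) (ha : a < 0) (hB : B * B = 2).
Hypotheses (phic : continuous phi) (phiper : periodic phi L).
Implicit Types (x : R) (u v w : cfun2 R) (l : R[i]).
Local Notation mu := (@lebesgue_measure R).
Local Notation I := (`[0, L]%classic : set R).
Local Notation D := (H2per2 L).

Definition sys_op : cfun2 R -> cfun2 R :=
  lin_op L a b a 0 phi (fun x => B * phi x).
Local Notation A := sys_op.

Let al := - a.
Let al0 : 0 < al. Proof. by rewrite oppr_gt0. Qed.

(** The potentials on the eigenlines (1, B) and (B, -1) of the matrix (0 B; B 1). *)
Definition pot1 x : R := 1 + 2 * phi x.
Definition pot2 x : R := 1 - phi x.

Let phi_cont c d : cont_on c d phi. Proof. exact: continuous_subspaceT. Qed.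

Lemma pot1_cont : cont_on 0 L pot1.
Proof. by apply: withinD; [exact: within_cst|apply: withinM => //; exact: within_cst]. Qed.

Lemma pot2_cont : cont_on 0 L pot2.
Proof. by apply: withinB => //; exact: within_cst. Qed.

(** Equality modulo the relation B^2 = 2; [t] is the cofactor that [ring] cannot
    guess. *)
Lemma modulo_B t (p q : R) : p - q = (B * B - 2) * t -> p = q.
Proof. by rewrite hB subrr mul0r => /subr0_eq. Qed.

(** Up to the factor 3 these are the coordinates along (1, B) and (B, -1); the factors 1
    and -1 give them the shape c f + d g of the lemmas on combinations. *)
Definition coordY (f g : R -> R) x : R := 1 * f x + B * g x.
Definition coordZ (f g : R -> R) x : R := B * f x + (-1) * g x.

Lemma shift2_parts l u x :
  let lr := complex.Re l in let li := complex.Im l in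
  [/\ re (shift2 A l u).1 x = re u.1 x + a * re (dxx L u.1) x +
        B * phi x * re u.2 x - (lr * re u.1 x - li * im u.1 x),
      im (shift2 A l u).1 x = im u.1 x + a * im (dxx L u.1) x +
        B * phi x * im u.2 x - (lr * im u.1 x + li * re u.1 x),
      re (shift2 A l u).2 x = B * phi x * re u.1 x + re u.2 x +
        a * re (dxx L u.2) x + phi x * re u.2 x - (lr * re u.2 x - li * im u.2 x) &
      im (shift2 A l u).2 x = B * phi x * im u.1 x + im u.2 x +
        a * im (dxx L u.2) x + phi x * im u.2 x - (lr * im u.2 x + li * re u.2 x)].
Proof.
rewrite /re /im /shift2 /sub2 /scale2 /sys_op /lin_op; cbn [fst snd].
rewrite !ReImE; cbv zeta.
move: (complex.Re l) (complex.Im l) (complex.Re (u.1 x)) (complex.Im (u.1 x))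
  (complex.Re (u.2 x)) (complex.Im (u.2 x)) (complex.Re (dxx L u.1 x))
  (complex.Im (dxx L u.1 x)) (complex.Re (dxx L u.2 x)) (complex.Im (dxx L u.2 x)).
by move=> lr li r1 i1 r2 i2 s1 j1 s2 j2; split; ring.
Qed.

Lemma phi_mul_L2r f : L2r L f -> L2r L (fun x => phi x * f x).
Proof.
move=> fL; have [M _ HM] := within_bounded (@phi_cont 0 L).
apply: (L2rM_bounded fL) HM.
exact: continuous_measurable_fun.
Qed.

Lemma L2per_lin (f g h : R -> R) (c d e : R) : L2r L f -> L2r L g -> L2r L h ->
  L2r L (fun x => c * f x + d * g x + e * h x).
Proof. by move=> fL gL hL'; do 2?[apply: L2rD]; exact: L2rZ. Qed.

Lemma shift2_L2 l u : D u -> L2per2 L (shift2 A l u).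
Proof.
move=> [u1 u2].
have [/L2perP[p1 r1 i1] _] := u1; have [/L2perP[p2 r2 i2] _] := u2.
have [/L2perP[q1 s1 j1] _] := dxxP u1; have [/L2perP[q2 s2 j2] _] := dxxP u2.
split; apply/L2perP; split.
- by move=> x /=; rewrite p1 p2 q1 q2 phiper.
- have -> : re (shift2 A l u).1 = fun x => (1 - complex.Re l) * re u.1 x + a * re (dxx L u.1) x +
      1 * (complex.Im l * im u.1 x + 0 * re u.1 x + B * (phi x * re u.2 x)).
    by apply/funext => x; have [-> _ _ _] := shift2_parts l u x; ring.
  by apply: L2per_lin => //; apply: L2per_lin => //; exact: phi_mul_L2r.
- have -> : im (shift2 A l u).1 = fun x => (1 - complex.Re l) * im u.1 x + a * im (dxx L u.1) x +
      1 * (- complex.Im l * re u.1 x + 0 * re u.1 x + B * (phi x * im u.2 x)).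
    by apply/funext => x; have [_ -> _ _] := shift2_parts l u x; ring.
  by apply: L2per_lin => //; apply: L2per_lin => //; exact: phi_mul_L2r.
- by move=> x /=; rewrite p1 p2 q1 q2 phiper.
- have -> : re (shift2 A l u).2 = fun x => (1 - complex.Re l) * re u.2 x + a * re (dxx L u.2) x +
      1 * (complex.Im l * im u.2 x + B * (phi x * re u.1 x) + 1 * (phi x * re u.2 x)).
    by apply/funext => x; have [_ _ -> _] := shift2_parts l u x; ring.
  by apply: L2per_lin => //; apply: L2per_lin => //; exact: phi_mul_L2r.
- have -> : im (shift2 A l u).2 = fun x => (1 - complex.Re l) * im u.2 x + a * im (dxx L u.2) x +
      1 * (- complex.Im l * re u.2 x + B * (phi x * im u.1 x) + 1 * (phi x * im u.2 x)).
    by apply/funext => x; have [_ _ _ ->] := shift2_parts l u x; ring.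
  by apply: L2per_lin => //; apply: L2per_lin => //; exact: phi_mul_L2r.
Qed.

Lemma eq_per2P u v : eq_per2 L u v <->
  [/\ ae_eq mu I (re u.1) (re v.1), ae_eq mu I (im u.1) (im v.1),
      ae_eq mu I (re u.2) (re v.2) & ae_eq mu I (im u.2) (im v.2)].
Proof.
split=> [[/eq_perP[? ?] /eq_perP[? ?]]|[? ? ? ?]]; first by split.
by split; apply/eq_perP.
Qed.

(** (1, B) and (B, -1) are eigenvectors of (0 B; B 1) for 2 and -1, so the
    coordinates along them decouple. *)
Lemma system_weak l u w : D u -> L2per2 L w -> eq_per2 L (shift2 A l u) w ->
  weak_hill L al pot1 (complex.Re l) (complex.Im l)
    (coordY (re u.1) (re u.2)) (coordY (im u.1) (im u.2))
    (coordY (re w.1) (re w.2)) (coordY (im w.1) (im w.2)) /\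
  weak_hill L al pot2 (complex.Re l) (complex.Im l)
    (coordZ (re u.1) (re u.2)) (coordZ (im u.1) (im u.2))
    (coordZ (re w.1) (re w.2)) (coordZ (im w.1) (im w.2)).
Proof.
move=> [u1 u2] _ /eq_per2P[er1 ei1 er2 ei2].
have [/L2perP[_ /L2r_integrable r1 /L2r_integrable i1] _] := u1.
have [/L2perP[_ /L2r_integrable r2 /L2r_integrable i2] _] := u2.
have [/L2perP[_ /L2r_integrable s1 /L2r_integrable j1] [wr1 wi1]] := dxxP u1.
have [/L2perP[_ /L2r_integrable s2 /L2r_integrable j2] [wr2 wi2]] := dxxP u2.
have comb (c d : R) f g : mu.-integrable I (EFin \o f) -> mu.-integrable I (EFin \o g) ->
    mu.-integrable I (EFin \o (fun x => c * f x + d * g x)).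
  by move=> fi gi; apply: integrable_itvD; exact: integrable_itvZ.
split.
- exists (coordY (re (dxx L u.1)) (re (dxx L u.2))), (coordY (im (dxx L u.1)) (im (dxx L u.2))).
  split; [exact: comb|exact: comb|exact: comb|exact: comb|split].
  + exact: (weak_derive_comb 1 B r1 s1 r2 s2 wr1 wr2).
  + exact: (weak_derive_comb 1 B i1 j1 i2 j2 wi1 wi2).
  + apply: filterS2 er1 er2 => x er1 er2 xI; rewrite /coordY -er1// -er2//.
    have [-> _ -> _] := shift2_parts l u x; rewrite /pot1 /al.
    by apply: (@modulo_B (phi x * re u.1 x)); ring.
  + apply: filterS2 ei1 ei2 => x ei1 ei2 xI; rewrite /coordY -ei1// -ei2//.
    have [_ -> _ ->] := shift2_parts l u x; rewrite /pot1 /al.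
    by apply: (@modulo_B (phi x * im u.1 x)); ring.
- exists (coordZ (re (dxx L u.1)) (re (dxx L u.2))), (coordZ (im (dxx L u.1)) (im (dxx L u.2))).
  split; [exact: comb|exact: comb|exact: comb|exact: comb|split].
  + exact: (weak_derive_comb B (-1) r1 s1 r2 s2 wr1 wr2).
  + exact: (weak_derive_comb B (-1) i1 j1 i2 j2 wi1 wi2).
  + apply: filterS2 er1 er2 => x er1 er2 xI; rewrite /coordZ -er1// -er2//.
    have [-> _ -> _] := shift2_parts l u x; rewrite /pot2 /al.
    by apply: (@modulo_B (phi x * re u.2 x)); ring.
  + apply: filterS2 ei1 ei2 => x ei1 ei2 xI; rewrite /coordZ -ei1// -ei2//.
    have [_ -> _ ->] := shift2_parts l u x; rewrite /pot2 /al.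
    by apply: (@modulo_B (phi x * im u.2 x)); ring.
Qed.

Lemma coord_inv (f g : R -> R) x :
  f x = (coordY f g x + B * coordZ f g x) / 3 /\
  g x = (B * coordY f g x - coordZ f g x) / 3.
Proof.
rewrite /coordY /coordZ; split.
  by apply: (@modulo_B (- (f x / 3))); field.
by apply: (@modulo_B (- (g x / 3))); field.
Qed.

(** The inverse of (coordY, coordZ). *)
Definition decoupled (Y Z : R -> R) : (R -> R) * (R -> R) :=
  (fun x => 3^-1 * Y x + B / 3 * Z x, fun x => B / 3 * Y x + (- 3^-1) * Z x).

Lemma primitive_comb (c d : R) f f1 g g1 x : 0 <= x <= L ->
  mu.-integrable I (EFin \o f1) -> mu.-integrable I (EFin \o g1) ->
  f x = f 0 + \int[mu]_(t in `[0, x]) f1 t ->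
  g x = g 0 + \int[mu]_(t in `[0, x]) g1 t ->
  c * f x + d * g x = c * f 0 + d * g 0 +
    \int[mu]_(t in `[0, x]) (c * f1 t + d * g1 t).
Proof.
move=> /andP[_ xL] fi gi -> ->.
have fxi := integrable_sub_itv xL fi; have gxi := integrable_sub_itv xL gi.
rewrite RintegralD//; last 2 first.
- by have := integrableZl _ c fxi; exact.
- by have := integrableZl _ d gxi; exact.
by rewrite !RintegralZl//; ring.
Qed.

(** The solutions live on [0, L]; their equal end values allow a periodic extension,
    which has the prescribed second derivative and is therefore in the domain. *)
Lemma system_strong l w Yr Yr1 Yi Yi1 Zr Zr1 Zi Zi1 : L2per2 L w ->
  strong_hill L al pot1 (complex.Re l) (complex.Im l)
    (coordY (re w.1) (re w.2)) (coordY (im w.1) (im w.2)) Yr Yr1 Yi Yi1 ->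
  strong_hill L al pot2 (complex.Re l) (complex.Im l)
    (coordZ (re w.1) (re w.2)) (coordZ (im w.1) (im w.2)) Zr Zr1 Zi Zi1 ->
  exists u, [/\ D u, eq_per2 L (shift2 A l u) w &
    forall x, 0 <= x <= L -> [/\ re u.1 x = (decoupled Yr Zr).1 x,
      im u.1 x = (decoupled Yi Zi).1 x, re u.2 x = (decoupled Yr Zr).2 x &
      im u.2 x = (decoupled Yi Zi).2 x]].
Proof.
move=> [/L2perP[pw1 wr1 wi1] /L2perP[pw2 wr2 wi2]] sY sZ.
set lr := complex.Re l in sY sZ *; set li := complex.Im l in sY sZ *.
have al1 : al != 0 by rewrite gt_eqF.
have a0 : a != 0 by rewrite lt_eqF.
have cc (c d : R) f g : cont_on 0 L f -> cont_on 0 L g ->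
    cont_on 0 L (fun x => c * f x + d * g x).
  by move=> fc gc; apply: withinD; apply: withinM => //; exact: within_cst.
have [rY1 iY1 rY iY] := And4 (sh_r1c sY) (sh_i1c sY) (sh_rc sY) (sh_ic sY).
have [rZ1 iZ1 rZ iZ] := And4 (sh_r1c sZ) (sh_i1c sZ) (sh_rc sZ) (sh_ic sZ).
pose per := periodize L.
pose f1 := per (decoupled Yr Zr).1; pose g1 := per (decoupled Yi Zi).1.
pose f2 := per (decoupled Yr Zr).2; pose g2 := per (decoupled Yi Zi).2.
have f1E : forall x, 0 <= x <= L -> f1 x = (decoupled Yr Zr).1 x.
  by apply: periodizeE => //=; rewrite (sh_rL sY) (sh_rL sZ).
have g1E : forall x, 0 <= x <= L -> g1 x = (decoupled Yi Zi).1 x.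
  by apply: periodizeE => //=; rewrite (sh_iL sY) (sh_iL sZ).
have f2E : forall x, 0 <= x <= L -> f2 x = (decoupled Yr Zr).2 x.
  by apply: periodizeE => //=; rewrite (sh_rL sY) (sh_rL sZ).
have g2E : forall x, 0 <= x <= L -> g2 x = (decoupled Yi Zi).2 x.
  by apply: periodizeE => //=; rewrite (sh_iL sY) (sh_iL sZ).
have f1L : L2r L f1 by apply: periodize_L2r => //; exact: cc.
have g1L : L2r L g1 by apply: periodize_L2r => //; exact: cc.
have f2L : L2r L f2 by apply: periodize_L2r => //; exact: cc.
have g2L : L2r L g2 by apply: periodize_L2r => //; exact: cc.
have f1p : periodic f1 L by exact: periodize_periodic.
have g1p : periodic g1 L by exact: periodize_periodic.
have f2p : periodic f2 L by exact: periodize_periodic.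
have g2p : periodic g2 L by exact: periodize_periodic.
(* the second derivatives that the equations prescribe *)
pose h1 x := al^-1 * (f1 x + B * phi x * f2 x - (lr * f1 x - li * g1 x) - re w.1 x).
pose k1 x := al^-1 * (g1 x + B * phi x * g2 x - (lr * g1 x + li * f1 x) - im w.1 x).
pose h2 x := al^-1 * (B * phi x * f1 x + f2 x + phi x * f2 x - (lr * f2 x - li * g2 x) - re w.2 x).
pose k2 x := al^-1 * (B * phi x * g1 x + g2 x + phi x * g2 x - (lr * g2 x + li * f2 x) - im w.2 x).
have h1L : L2r L h1.
  apply: L2rZ; apply: L2rB => //.
  have := L2per_lin (1 - lr) B li f1L (phi_mul_L2r f2L) g1L.
  by congr (L2r L _); apply/funext => x; ring.
have k1L : L2r L k1.
  apply: L2rZ; apply: L2rB => //.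
  have := L2per_lin (1 - lr) B (- li) g1L (phi_mul_L2r g2L) f1L.
  by congr (L2r L _); apply/funext => x; ring.
have h2L : L2r L h2.
  apply: L2rZ; apply: L2rB => //.
  have := L2per_lin (1 - lr) 1 1 f2L (L2rD (L2rZ B (phi_mul_L2r f1L)) (phi_mul_L2r f2L)) (L2rZ li g2L).
  by congr (L2r L _); apply/funext => x; ring.
have k2L : L2r L k2.
  apply: L2rZ; apply: L2rB => //.
  have := L2per_lin (1 - lr) 1 1 g2L (L2rD (L2rZ B (phi_mul_L2r g1L)) (phi_mul_L2r g2L)) (L2rZ (- li) f2L).
  by congr (L2r L _); apply/funext => x; ring.
have h1p : periodic h1 L by move=> x; rewrite /h1 /re f1p f2p g1p phiper pw1.
have k1p : periodic k1 L by move=> x; rewrite /k1 /im f1p g1p g2p phiper pw1.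
have h2p : periodic h2 L by move=> x; rewrite /h2 /re f1p f2p g2p phiper pw2.
have k2p : periodic k2 L by move=> x; rewrite /k2 /im f2p g1p g2p phiper pw2.
have rhs (V p q s : R -> R) (c : R) : cont_on 0 L V -> cont_on 0 L p -> cont_on 0 L q ->
    L2r L s -> mu.-integrable I (EFin \o (fun t => (V t - lr) / al * p t + c * q t - s t / al)).
  move=> Vc pc qc sL; apply: integrable_itvB.
    apply: within_integrable; apply: withinD; apply: withinM => //; try exact: within_cst.
    by apply: withinM; [apply: withinB => //; exact: within_cst|exact: within_cst].
  have := integrable_itvZ al^-1 (L2r_integrable sL); congr (mu.-integrable _ _).
  by apply/funext => x /=; rewrite mulrC.
have wYr : L2r L (coordY (re w.1) (re w.2)) by apply: L2rD; exact: L2rZ.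
have wYi : L2r L (coordY (im w.1) (im w.2)) by apply: L2rD; exact: L2rZ.
have wZr : L2r L (coordZ (re w.1) (re w.2)) by apply: L2rD; exact: L2rZ.
have wZi : L2r L (coordZ (im w.1) (im w.2)) by apply: L2rD; exact: L2rZ.
have rYi := rhs _ _ _ _ (li / al) pot1_cont rY iY wYr.
have rZi := rhs _ _ _ _ (li / al) pot2_cont rZ iZ wZr.
have iYi := rhs _ _ _ _ (- (li / al)) pot1_cont iY rY wYi.
have iZi := rhs _ _ _ _ (- (li / al)) pot2_cont iZ rZ wZi.
have mN (s t : R) : - s * t = - (s * t) by rewrite mulNr.
pose PP := periodic_primitive2 L.
have prim (c d : R) (F h p p1 p2 q q1 q2 : R -> R) :
    (forall x, 0 <= x <= L -> F x = c * p x + d * q x) ->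
    (forall x, 0 <= x <= L -> h x = c * p2 x + d * q2 x) ->
    cont_on 0 L p1 -> cont_on 0 L q1 ->
    mu.-integrable I (EFin \o p2) -> mu.-integrable I (EFin \o q2) ->
    (forall x, 0 <= x <= L -> p x = p 0 + \int[mu]_(t in `[0, x]) p1 t) ->
    (forall x, 0 <= x <= L -> q x = q 0 + \int[mu]_(t in `[0, x]) q1 t) ->
    (forall x, 0 <= x <= L -> p1 x = p1 0 + \int[mu]_(t in `[0, x]) p2 t) ->
    (forall x, 0 <= x <= L -> q1 x = q1 0 + \int[mu]_(t in `[0, x]) q2 t) ->
    p L = p 0 -> q L = q 0 -> p1 L = p1 0 -> q1 L = q1 0 ->
    PP (c * p 0 + d * q 0) (c * p1 0 + d * q1 0) h F (fun x => c * p1 x + d * q1 x).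
  move=> FE hE p1c q1c p2i q2i pE qE p1E q1E pL qL p1L q1L; split.
  - move=> x xL; rewrite (primitive_comb c d xL p2i q2i (p1E x xL) (q1E x xL)).
    congr (_ + _); apply: eq_Rintegral_itv => t /andP[t0 tx].
    by rewrite hE// t0 (le_trans tx)//; case/andP: xL.
  - move=> x xL; rewrite FE//.
    exact: (primitive_comb c d xL (within_integrable p1c) (within_integrable q1c)
      (pE x xL) (qE x xL)).
  - by rewrite p1L q1L.
  - by rewrite !FE ?lexx ?(ltW hL)// pL qL.
have sYi x : 0 <= x <= L -> Yi1 x = Yi1 0 + \int[mu]_(t in `[0, x])
    ((pot1 t - lr) / al * Yi t + (- (li / al)) * Yr t - coordY (im w.1) (im w.2) t / al).
  move=> xL; rewrite (sh_i1 sY)//; congr (_ + _); apply: eq_Rintegral_itv => t _.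
  by rewrite mN.
have sZi x : 0 <= x <= L -> Zi1 x = Zi1 0 + \int[mu]_(t in `[0, x])
    ((pot2 t - lr) / al * Zi t + (- (li / al)) * Zr t - coordZ (im w.1) (im w.2) t / al).
  move=> xL; rewrite (sh_i1 sZ)//; congr (_ + _); apply: eq_Rintegral_itv => t _.
  by rewrite mN.
have P1 : PP (3^-1 * Yr 0 + (B / 3) * Zr 0) (3^-1 * Yr1 0 + (B / 3) * Zr1 0) h1 f1
    (fun x => 3^-1 * Yr1 x + (B / 3) * Zr1 x).
  apply: (@prim 3^-1 (B / 3) f1 h1 Yr Yr1 _ Zr Zr1 _ f1E _ rY1 rZ1 rYi rZi
    (sh_r sY) (sh_r sZ) (sh_r1 sY) (sh_r1 sZ) (sh_rL sY) (sh_rL sZ) (sh_r1L sY) (sh_r1L sZ)).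
  move=> x xL; rewrite /h1 f1E// f2E// g1E// /pot1 /pot2 /coordY /coordZ /=.
  by apply: (@modulo_B ((phi x * Yr x + re w.1 x) / (3 * al))); field.
have P2 : PP ((B / 3) * Yr 0 + (- 3^-1) * Zr 0) ((B / 3) * Yr1 0 + (- 3^-1) * Zr1 0) h2 f2
    (fun x => (B / 3) * Yr1 x + (- 3^-1) * Zr1 x).
  apply: (@prim (B / 3) (- 3^-1) f2 h2 Yr Yr1 _ Zr Zr1 _ f2E _ rY1 rZ1 rYi rZi
    (sh_r sY) (sh_r sZ) (sh_r1 sY) (sh_r1 sZ) (sh_rL sY) (sh_rL sZ) (sh_r1L sY) (sh_r1L sZ)).
  move=> x xL; rewrite /h2 f1E// f2E// g2E// /pot1 /pot2 /coordY /coordZ /=.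
  by apply: (@modulo_B ((phi x * Zr x + re w.2 x) / (3 * al))); field.
have Q1 : PP (3^-1 * Yi 0 + (B / 3) * Zi 0) (3^-1 * Yi1 0 + (B / 3) * Zi1 0) k1 g1
    (fun x => 3^-1 * Yi1 x + (B / 3) * Zi1 x).
  apply: (@prim 3^-1 (B / 3) g1 k1 Yi Yi1 _ Zi Zi1 _ g1E _ iY1 iZ1 iYi iZi
    (sh_i sY) (sh_i sZ) sYi sZi (sh_iL sY) (sh_iL sZ) (sh_i1L sY) (sh_i1L sZ)).
  move=> x xL; rewrite /k1 f1E// g1E// g2E// /pot1 /pot2 /coordY /coordZ /=.
  by apply: (@modulo_B ((phi x * Yi x + im w.1 x) / (3 * al))); field.
have Q2 : PP ((B / 3) * Yi 0 + (- 3^-1) * Zi 0) ((B / 3) * Yi1 0 + (- 3^-1) * Zi1 0) k2 g2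
    (fun x => (B / 3) * Yi1 x + (- 3^-1) * Zi1 x).
  apply: (@prim (B / 3) (- 3^-1) g2 k2 Yi Yi1 _ Zi Zi1 _ g2E _ iY1 iZ1 iYi iZi
    (sh_i sY) (sh_i sZ) sYi sZi (sh_iL sY) (sh_iL sZ) (sh_i1L sY) (sh_i1L sZ)).
  move=> x xL; rewrite /k2 f2E// g1E// g2E// /pot1 /pot2 /coordY /coordZ /=.
  by apply: (@modulo_B ((phi x * Zi x + im w.2 x) / (3 * al))); field.
have [u1H /eq_perP[dr1 di1]] := @H2per_intro _ _ hL (cplx f1 g1) (cplx h1 k1) _ _ _ _ _ _
    (L2per_cplx f1p g1p f1L g1L) (L2per_cplx h1p k1p h1L k1L) P1 Q1.
have [u2H /eq_perP[dr2 di2]] := @H2per_intro _ _ hL (cplx f2 g2) (cplx h2 k2) _ _ _ _ _ _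
    (L2per_cplx f2p g2p f2L g2L) (L2per_cplx h2p k2p h2L k2L) P2 Q2.
exists (cplx f1 g1, cplx f2 g2); split => //; last first.
  by move=> x xL; split; [exact: f1E|exact: g1E|exact: f2E|exact: g2E].
apply/eq_per2P; split.
- apply: filterS dr1 => x dr1 xI.
  have [-> _ _ _] := shift2_parts l (cplx f1 g1, cplx f2 g2) x.
  by rewrite /= dr1// /re /im /cplx /= /h1 /al; field.
- apply: filterS di1 => x di1 xI.
  have [_ -> _ _] := shift2_parts l (cplx f1 g1, cplx f2 g2) x.
  by rewrite /= di1// /re /im /cplx /= /k1 /al; field.
- apply: filterS dr2 => x dr2 xI.
  have [_ _ -> _] := shift2_parts l (cplx f1 g1, cplx f2 g2) x.
  by rewrite /= dr2// /re /im /cplx /= /h2 /al; field.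
- apply: filterS di2 => x di2 xI.
  have [_ _ _ ->] := shift2_parts l (cplx f1 g1, cplx f2 g2) x.
  by rewrite /= di2// /re /im /cplx /= /k2 /al; field.
Qed.

End Reduction.

(** * Eigenvalues and resolvent set of the system *)

Section Spectral.
Context {R : realType}.
Variables (L a b B : R) (phi : R -> R).
Hypotheses (hL : 0 < L) (ha : a < 0) (hB : B * B = 2).
Hypotheses (phic : continuous phi) (phiper : periodic phi L).
Implicit Types (x : R) (u v w : cfun2 R) (l : R[i]).
Local Notation mu := (@lebesgue_measure R).
Local Notation I := (`[0, L]%classic : set R).
Local Notation D := (H2per2 L).
Local Notation A := (sys_op L a b B phi).

Let al := - a.
Let al0 : 0 < al. Proof. by rewrite oppr_gt0. Qed.

Local Notation strong0 V l := (strong_hill L al V (complex.Re l) (complex.Im l)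
  (fun=> 0) (fun=> 0)).

Lemma eigenspace_shift l u : eigenspace2 L D A l u <->
  D u /\ eq_per2 L (shift2 A l u) zero2.
Proof.
split=> -[uD [e1 e2]]; split => //; split.
- by apply: filterS e1 => x e xI; apply/eqP; rewrite subr_eq0; apply/eqP; exact: e.
- by apply: filterS e2 => x e xI; apply/eqP; rewrite subr_eq0; apply/eqP; exact: e.
- by apply: filterS e1 => x e xI; apply/eqP; rewrite -subr_eq0; apply/eqP; exact: e.
- by apply: filterS e2 => x e xI; apply/eqP; rewrite -subr_eq0; apply/eqP; exact: e.
Qed.

Lemma zero2_L2per : L2per2 L (@zero2 R).
Proof.
by split; apply/L2perP; split => //; exact: (L2r0 L).
Qed.

Let coord0 : [/\ coordY B (re (@zero2 R).1) (re zero2.2) = (fun=> 0),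
  coordY B (im (@zero2 R).1) (im zero2.2) = (fun=> 0),
  coordZ B (re (@zero2 R).1) (re zero2.2) = (fun=> 0) &
  coordZ B (im (@zero2 R).1) (im zero2.2) = (fun=> 0)].
Proof.
by split; apply/funext => x; rewrite /coordY /coordZ /re /im /=; ring.
Qed.

Lemma strong_hill_zero V l : strong0 V l (fun=> 0) (fun=> 0) (fun=> 0) (fun=> 0).
Proof.
have i0 x (h : R -> R) : (forall t, h t = 0) -> 0 <= x <= L ->
    \int[mu]_(t in `[0, x]) h t = 0.
  move=> h0 /andP[x0 _]; rewrite (@eq_Rintegral_itv _ _ _ _ (fun=> 0)); last by move=> t _.
  by rewrite Rintegral_itv_cst// mul0r.
by split => //; try exact: within_cst; move=> x xL; rewrite i0 ?addr0// => t; ring.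
Qed.

Lemma coord_ae_eq u v :
  ae_eq mu I (coordY B (re u.1) (re u.2)) (coordY B (re v.1) (re v.2)) ->
  ae_eq mu I (coordY B (im u.1) (im u.2)) (coordY B (im v.1) (im v.2)) ->
  ae_eq mu I (coordZ B (re u.1) (re u.2)) (coordZ B (re v.1) (re v.2)) ->
  ae_eq mu I (coordZ B (im u.1) (im u.2)) (coordZ B (im v.1) (im v.2)) ->
  eq_per2 L u v.
Proof.
move=> rY iY rZ iZ; apply/eq_per2P.
split.
- apply: filterS2 rY rZ => x rY rZ xI.
  have [-> _] := coord_inv hB (re u.1) (re u.2) x; rewrite rY// rZ//.
  by have [<- _] := coord_inv hB (re v.1) (re v.2) x.
- apply: filterS2 iY iZ => x iY iZ xI.
  have [-> _] := coord_inv hB (im u.1) (im u.2) x; rewrite iY// iZ//.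
  by have [<- _] := coord_inv hB (im v.1) (im v.2) x.
- apply: filterS2 rY rZ => x rY rZ xI.
  have [_ ->] := coord_inv hB (re u.1) (re u.2) x; rewrite rY// rZ//.
  by have [_ <-] := coord_inv hB (re v.1) (re v.2) x.
- apply: filterS2 iY iZ => x iY iZ xI.
  have [_ ->] := coord_inv hB (im u.1) (im u.2) x; rewrite iY// iZ//.
  by have [_ <-] := coord_inv hB (im v.1) (im v.2) x.
Qed.

Lemma eigenspace_strong l u : eigenspace2 L D A l u ->
  exists Yr Yr1 Yi Yi1 Zr Zr1 Zi Zi1,
  [/\ strong0 (pot1 phi) l Yr Yr1 Yi Yi1, strong0 (pot2 phi) l Zr Zr1 Zi Zi1,
    ae_eq mu I (coordY B (re u.1) (re u.2)) Yr /\
    ae_eq mu I (coordY B (im u.1) (im u.2)) Yi &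
    ae_eq mu I (coordZ B (re u.1) (re u.2)) Zr /\
    ae_eq mu I (coordZ B (im u.1) (im u.2)) Zi].
Proof.
move=> /eigenspace_shift[uD ue]; have [c1 c2 c3 c4] := coord0.
have [] := system_weak hB uD zero2_L2per ue; rewrite c1 ?c2 c3 ?c4.
have z := integrable_itv_cst L 0.
move=> /(weak_hill_strong hL al0 (pot1_cont phic) z z)[Yr [Yr1 [Yi [Yi1 [sY eYr eYi]]]]].
move=> /(weak_hill_strong hL al0 (pot2_cont phic) z z)[Zr [Zr1 [Zi [Zi1 [sZ eZr eZi]]]]].
by exists Yr, Yr1, Yi, Yi1, Zr, Zr1, Zi, Zi1.
Qed.

Lemma strong_eigenspace l Yr Yr1 Yi Yi1 Zr Zr1 Zi Zi1 :
  strong0 (pot1 phi) l Yr Yr1 Yi Yi1 -> strong0 (pot2 phi) l Zr Zr1 Zi Zi1 ->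
  exists u, eigenspace2 L D A l u /\
    forall x, 0 <= x <= L -> [/\ re u.1 x = (decoupled B Yr Zr).1 x,
      im u.1 x = (decoupled B Yi Zi).1 x, re u.2 x = (decoupled B Yr Zr).2 x &
      im u.2 x = (decoupled B Yi Zi).2 x].
Proof.
move=> sY sZ; have [c1 c2 c3 c4] := coord0.
have [||u [uD ue uE]] := @system_strong _ _ _ b _ _ hL ha hB phic phiper l zero2
    Yr Yr1 Yi Yi1 Zr Zr1 Zi Zi1 zero2_L2per.
- by rewrite c1 ?c2.
- by rewrite c3 ?c4.
by exists u; split => //; apply/eigenspace_shift.
Qed.

(** A nonzero solution of one of the scalar problems, paired with 0 for the other,
    would be an eigenfunction of the system. *)
Lemma not_eigenvalue_strong0 l : ~ is_eigenvalue L D A l ->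
  (forall Yr Yr1 Yi Yi1, strong0 (pot1 phi) l Yr Yr1 Yi Yi1 ->
    forall x, 0 <= x <= L -> Yr x = 0 /\ Yi x = 0) /\
  (forall Zr Zr1 Zi Zi1, strong0 (pot2 phi) l Zr Zr1 Zi Zi1 ->
    forall x, 0 <= x <= L -> Zr x = 0 /\ Zi x = 0).
Proof.
move=> nl.
have key u : eigenspace2 L D A l u -> eq_per2 L u zero2.
  by move=> ul; apply: contrapT => u0; apply: nl; exists u.
have t0 : 3^-1 != 0 :> R by rewrite invr_eq0.
have cancel3 (f g : R -> R) : cont_on 0 L f ->
    (forall x, 0 <= x <= L -> g x = 3^-1 * f x) -> ae_eq mu I g (fun=> 0) ->
    forall x, 0 <= x <= L -> f x = 0.
  move=> fc gf g0; apply: cont_on_ae0 => //.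
  apply: filterS g0 => x g0 xI; move: (xI); rewrite /= in_itv/= => xL.
  by apply: (mulfI t0); rewrite mulr0 -gf// g0.
split.
- move=> Yr Yr1 Yi Yi1 sY x xL.
  have [u [ul uE]] := strong_eigenspace sY (strong_hill_zero (pot2 phi) l).
  have /eq_per2P[r1 i1 _ _] := key u ul; split.
  + apply: (cancel3 _ (re u.1) (sh_rc sY)) xL => //.
    by move=> t tL; have [-> _ _ _] := uE t tL; rewrite /= mulr0 addr0.
  + apply: (cancel3 _ (im u.1) (sh_ic sY)) xL => //.
    by move=> t tL; have [_ -> _ _] := uE t tL; rewrite /= mulr0 addr0.
- move=> Zr Zr1 Zi Zi1 sZ x xL.
  have [u [ul uE]] := strong_eigenspace (strong_hill_zero (pot1 phi) l) sZ.
  have /eq_per2P[_ _ r2 i2] := key u ul; split.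
  + apply: (cancel3 _ (fun t => - re u.2 t) (sh_rc sZ)) xL.
      by move=> t tL; have [_ _ -> _] := uE t tL; rewrite /= mulr0 add0r mulNr opprK.
    by apply: filterS r2 => t r2 tI; rewrite r2// oppr0.
  + apply: (cancel3 _ (fun t => - im u.2 t) (sh_ic sZ)) xL.
      by move=> t tL; have [_ _ _ ->] := uE t tL; rewrite /= mulr0 add0r mulNr opprK.
    by apply: filterS i2 => t i2 tI; rewrite i2// oppr0.
Qed.

Let coord_L2 w : L2per2 L w ->
  [/\ L2r L (coordY B (re w.1) (re w.2)), L2r L (coordY B (im w.1) (im w.2)),
      L2r L (coordZ B (re w.1) (re w.2)) & L2r L (coordZ B (im w.1) (im w.2))].
Proof.
by move=> [/L2perP[_ r1 i1] /L2perP[_ r2 i2]]; split; apply: L2rD; exact: L2rZ.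
Qed.

Lemma shift2_injective l : ~ is_eigenvalue L D A l -> forall u v, D u -> D v ->
  eq_per2 L (shift2 A l u) (shift2 A l v) -> eq_per2 L u v.
Proof.
move=> /not_eigenvalue_strong0[hom1 hom2] u v uD vD uv.
have wL := @shift2_L2 _ _ a b B _ phic phiper l _ vD.
have vv : eq_per2 L (shift2 A l v) (shift2 A l v) by split; exact: ae_eq_refl.
have [yu zu] := system_weak hB uD wL uv.
have [yv zv] := system_weak hB vD wL vv.
have z := integrable_itv_cst L 0.
have zz (f : R -> R) : (fun x => f x - f x) = (fun=> 0).
  by apply/funext => x; rewrite subrr.
have fin V fr fi gr gi : cont_on 0 L V ->
    (forall Fr Fr1 Fi Fi1, strong0 V l Fr Fr1 Fi Fi1 ->
      forall x, 0 <= x <= L -> Fr x = 0 /\ Fi x = 0) ->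
    weak_hill L al V (complex.Re l) (complex.Im l) (fun x => fr x - gr x)
      (fun x => fi x - gi x) (fun=> 0) (fun=> 0) ->
    ae_eq mu I fr gr /\ ae_eq mu I fi gi.
  move=> Vc hom /(weak_hill_strong hL al0 Vc z z)[Fr [Fr1 [Fi [Fi1 [sF er ei]]]]].
  have F0 := hom _ _ _ _ sF.
  split.
  - apply: filterS er => x er xI; apply: subr0_eq; rewrite er//.
    by move: xI; rewrite /= in_itv/= => /F0[].
  - apply: filterS ei => x ei xI; apply: subr0_eq; rewrite ei//.
    by move: xI; rewrite /= in_itv/= => /F0[].
have := weak_hillB yu yv; rewrite !zz => /(fin _ _ _ _ _ (pot1_cont phic) hom1)[e1 e2].
have := weak_hillB zu zv; rewrite !zz => /(fin _ _ _ _ _ (pot2_cont phic) hom2)[e3 e4].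
exact: coord_ae_eq.
Qed.

(** The Fredholm bound is in terms of L1 norms; on a period they are controlled by
    [norm2]. *)
Definition L1sum w : R := \int[mu]_(t in I) `|re w.1 t| + \int[mu]_(t in I) `|im w.1 t| +
  (\int[mu]_(t in I) `|re w.2 t| + \int[mu]_(t in I) `|im w.2 t|).

Let B2 : `|B| <= 2.
Proof.
rewrite -(@ler_pXn2r _ 2) ?nnegrE// real_normK ?num_real// expr2 hB.
by rewrite expr2; lra.
Qed.

Lemma shift2_surjective_bound l : ~ is_eigenvalue L D A l ->
  exists2 C, 0 <= C & forall w, L2per2 L w -> exists u,
  [/\ D u, eq_per2 L (shift2 A l u) w & forall x, 0 <= x <= L ->
    [/\ `|re u.1 x| <= C * L1sum w, `|im u.1 x| <= C * L1sum w,
        `|re u.2 x| <= C * L1sum w & `|im u.2 x| <= C * L1sum w]].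
Proof.
move=> /not_eigenvalue_strong0[hom1 hom2].
have [C1 C10 H1] := scalar_fredholm hL al0 (pot1_cont phic) hom1.
have [C2 C20 H2] := scalar_fredholm hL al0 (pot2_cont phic) hom2.
exists (2 * (C1 + C2)); first by rewrite mulr_ge0// addr_ge0.
move=> w wL; have [wYr wYi wZr wZi] := coord_L2 wL.
have [Yr [Yr1 [Yi [Yi1 [sY bY]]]]] := H1 _ _ (L2r_integrable wYr) (L2r_integrable wYi).
have [Zr [Zr1 [Zi [Zi1 [sZ bZ]]]]] := H2 _ _ (L2r_integrable wZr) (L2r_integrable wZi).
have [u [uD ue uE]] := @system_strong _ _ _ b _ _ hL ha hB phic phiper l w
  Yr Yr1 Yi Yi1 Zr Zr1 Zi Zi1 wL sY sZ.
exists u; split => //.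
case: wL => /L2perP[_ /L2r_integrable r1 /L2r_integrable i1]
  /L2perP[_ /L2r_integrable r2 /L2r_integrable i2].
have nint f : mu.-integrable I (EFin \o f) -> mu.-integrable I (EFin \o (fun x => `|f x|)).
  by move=> fi; have := integrable_norm fi.
have comb c d f g : `|c| <= 2 -> `|d| <= 2 -> mu.-integrable I (EFin \o f) ->
    mu.-integrable I (EFin \o g) ->
    \int[mu]_(t in I) `|c * f t + d * g t| <=
      2 * (\int[mu]_(t in I) `|f t| + \int[mu]_(t in I) `|g t|).
  move=> c2 d2 fi gi; have fni := nint _ fi; have gni := nint _ gi.
  rewrite -RintegralD// -RintegralZl//; last exact: integrable_itvD.
  apply: le_Rintegral_itv.
  - by apply: nint; apply: integrable_itvD; exact: integrable_itvZ.
  - by apply: integrable_itvZ; exact: integrable_itvD.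
  - move=> x _; apply: le_trans (ler_normD _ _) _; rewrite mulrDr !normrM.
    by apply: lerD; rewrite ler_wpM2r.
have n1 : `|1| <= 2 :> R by rewrite normr1 ler1n.
have nN1 : `|-1| <= 2 :> R by rewrite normrN.
have Y1 := comb 1 B (re w.1) (re w.2) n1 B2 r1 r2.
have Y2 := comb 1 B (im w.1) (im w.2) n1 B2 i1 i2.
have Z1 := comb B (-1) (re w.1) (re w.2) B2 nN1 r1 r2.
have Z2 := comb B (-1) (im w.1) (im w.2) B2 nN1 i1 i2.
have YS : \int[mu]_(t in I) `|coordY B (re w.1) (re w.2) t| +
    \int[mu]_(t in I) `|coordY B (im w.1) (im w.2) t| <= 2 * L1sum w.
  by apply: le_trans (lerD Y1 Y2) _; rewrite -mulrDr addrACA.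
have ZS : \int[mu]_(t in I) `|coordZ B (re w.1) (re w.2) t| +
    \int[mu]_(t in I) `|coordZ B (im w.1) (im w.2) t| <= 2 * L1sum w.
  by apply: le_trans (lerD Z1 Z2) _; rewrite -mulrDr addrACA.
have dec (S y z : R) : `|y| <= C1 * (2 * S) -> `|z| <= C2 * (2 * S) ->
    `|3^-1 * y + B / 3 * z| <= 2 * (C1 + C2) * S /\
    `|B / 3 * y + (- 3^-1) * z| <= 2 * (C1 + C2) * S.
  clear -B2; move=> yb zb; have p3 : `|3^-1| = 3^-1 :> R by rewrite ger0_norm.
  have By : `|B * y| <= 2 * `|y| by rewrite normrM ler_wpM2r.
  have Bz : `|B * z| <= 2 * `|z| by rewrite normrM ler_wpM2r.
  have y0 := normr_ge0 y; have z0 := normr_ge0 z.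
  split; apply: le_trans (ler_normD _ _) _.
  - by rewrite [B / 3 * z]mulrAC [`|_ / 3|]normrM [`|3^-1 * y|]normrM p3; lra.
  - rewrite mulNr normrN [B / 3 * y]mulrAC [`|_ / 3|]normrM [`|3^-1 * z|]normrM p3.
    by lra.
move=> x xL; have [-> -> -> ->] := uE x xL.
have [y1 y2] := bY x xL; have [z1 z2] := bZ x xL.
have wd (C S T : R) q : 0 <= C -> S <= T -> q <= C * S -> q <= C * T.
  by move=> c0 st /le_trans; apply; rewrite ler_wpM2l.
have {}y1 := wd _ _ _ _ C10 YS y1; have {}y2 := wd _ _ _ _ C10 YS y2.
have {}z1 := wd _ _ _ _ C20 ZS z1; have {}z2 := wd _ _ _ _ C20 ZS z2.
by have [d1 d2] := dec _ _ _ y1 z1; have [d3 d4] := dec _ _ _ y2 z2.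
Qed.

Lemma norm2E u : norm2 L u = Num.sqrt (\int[mu]_(x in I)
  (re u.1 x ^+ 2 + im u.1 x ^+ 2 + (re u.2 x ^+ 2 + im u.2 x ^+ 2))).
Proof.
by congr Num.sqrt; apply: eq_Rintegral => x _; rewrite !normc_sqrE.
Qed.

(** The bound of [shift2_surjective_bound] holds for one solution; by injectivity that
    is the given one, almost everywhere. *)
Lemma not_eigenvalue_resolvent l : ~ is_eigenvalue L D A l ->
  resolvent_set L D A l.
Proof.
move=> nl; have inj := shift2_injective nl.
have [C C0 HC] := shift2_surjective_bound nl.
split => //.
  by move=> w wL; have [u [uD ue _]] := HC w wL; exists u.
pose K := 4 * (C * L).
exists K => u uD; pose w := shift2 A l u.
have wL : L2per2 L w by exact: shift2_L2.
have [v [vD vw vB]] := HC w wL.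
have /eq_per2P[e1 e2 e3 e4] : eq_per2 L u v.
  by apply: inj => //; case: vw => v1 v2; split; exact: ae_eq_sym.
have sq u' : L2per2 L u' -> mu.-integrable I (EFin \o (fun x =>
    re u'.1 x ^+ 2 + im u'.1 x ^+ 2 + (re u'.2 x ^+ 2 + im u'.2 x ^+ 2))).
  move=> [/L2perP[_ [_ ?] [_ ?]] /L2perP[_ [_ ?] [_ ?]]].
  by apply: integrable_itvD; exact: integrable_itvD.
have uL : L2per2 L u by case: uD => -[? _] [? _].
have vL : L2per2 L v by case: vD => -[? _] [? _].
rewrite !norm2E.
rewrite (@ae_eq_Rintegral _ _ _ _ (sq _ uL) (sq _ vL)); last first.
  by apply: filterS2 (filterI e1 e2) (filterI e3 e4) => x [r1 i1] [r2 i2] xI;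
    rewrite r1// i1// r2// i2.
set Iw := \int[mu]_(x in I) (re (shift2 A l u).1 x ^+ 2 + _ + _).
have [/L2perP[_ r1 i1] /L2perP[_ r2 i2]] := wL.
set N := L1sum w in vB.
have N2 : N ^+ 2 <= 4 * (L * Iw).
  have c1 := cauchy_schwarz_period hL r1; have c2 := cauchy_schwarz_period hL i1.
  have c3 := cauchy_schwarz_period hL r2; have c4 := cauchy_schwarz_period hL i2.
  case: (r1) (i1) (r2) (i2) => [_ s1] [_ s2] [_ s3] [_ s4].
  have -> : Iw = \int[mu]_(x in I) (re w.1 x ^+ 2) + \int[mu]_(x in I) (im w.1 x ^+ 2) +
      (\int[mu]_(x in I) (re w.2 x ^+ 2) + \int[mu]_(x in I) (im w.2 x ^+ 2)).
    by rewrite -!RintegralD//; exact: integrable_itvD.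
  rewrite /N /L1sum; move: c1 c2 c3 c4.
  move: (\int[mu]_(t in I) `|re w.1 t|) (\int[mu]_(t in I) `|im w.1 t|) => n1 n2.
  move: (\int[mu]_(t in I) `|re w.2 t|) (\int[mu]_(t in I) `|im w.2 t|) => n3 n4 c1 c2 c3 c4.
  have := sqr_ge0 (n1 - n2); have := sqr_ge0 (n3 - n4); have := sqr_ge0 (n1 + n2 - (n3 + n4)).
  by move: c1 c2 c3 c4; rewrite !expr2; lra.
have CN0 : 0 <= C * N by apply: le_trans (normr_ge0 (re v.1 0)) _; have [] := vB 0 _; rewrite ?lexx ?(ltW hL).
have K0 : 0 <= K by rewrite !mulr_ge0// ltW.
rewrite -[leRHS]/(K * Num.sqrt Iw) -[in leRHS](ger0_norm K0) -sqrtr_sqr -sqrtrM ?sqr_ge0//.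
apply: ler_wsqrtr.
have le1 : \int[mu]_(x in I) (re v.1 x ^+ 2 + im v.1 x ^+ 2 + (re v.2 x ^+ 2 + im v.2 x ^+ 2)) <=
    4 * (C * N) ^+ 2 * (L - 0).
  rewrite -Rintegral_itv_cst ?(ltW hL)//; apply: le_Rintegral_itv.
  - exact: sq.
  - exact: integrable_itv_cst.
  move=> x /vB[v1 v2 v3 v4].
  have sqb (t : R) : `|t| <= C * N -> t ^+ 2 <= (C * N) ^+ 2.
    by move=> tb; rewrite -(real_normK (num_real t)) lerXn2r ?nnegrE.
  by have := sqb _ v1; have := sqb _ v2; have := sqb _ v3; have := sqb _ v4; lra.
apply: le_trans le1 _; rewrite subr0 exprMn.
have CL : 0 <= C ^+ 2 * L by rewrite mulr_ge0 ?sqr_ge0// ltW.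
have := ler_wpM2l CL N2; rewrite /K; nra.
Qed.

End Spectral.

(** * The spectrum has no limit point *)

Section Discreteness.
Context {R : realType}.
Variables (L a b B : R) (phi : R -> R).
Hypotheses (hL : 0 < L) (ha : a < 0) (hB : B * B = 2).
Hypotheses (phic : continuous phi) (phiper : periodic phi L).
Implicit Types (x lam : R) (u v w : cfun2 R) (l : R[i]).
Local Notation mu := (@lebesgue_measure R).
Local Notation I := (`[0, L]%classic : set R).
Local Notation D := (H2per2 L).
Local Notation A := (sys_op L a b B phi).

Let al := - a.
Let al0 : 0 < al. Proof. by rewrite oppr_gt0. Qed.

Definition hill_eigenvalues V : set R := [set lam | exists y y1,
  periodic_eigen L al V lam y y1 /\ exists2 x, 0 <= x <= L & y x != 0].

Lemma hill_eigenvalue_unit V lam : cont_on 0 L V -> hill_eigenvalues V lam ->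
  exists yy : (R -> R) * (R -> R), periodic_eigen L al V lam yy.1 yy.2 /\
    \int[mu]_(x in I) (yy.1 x * yy.1 x) = 1.
Proof.
move=> Vc [y [y1 [[sy yL y1L] [x xL yx0]]]].
have yc := solves_within sy.
have yyc : cont_on 0 L (fun x => y x * y x) by exact: withinM.
pose J := \int[mu]_(x in I) (y x * y x).
have yy0 t : 0 <= t <= L -> 0 <= y t * y t by rewrite -expr2 sqr_ge0.
have J0 : 0 < J.
  rewrite lt_neqAle eq_sym Rintegral_itv_ge0// andbT.
  apply/eqP => J0; have /eqP := within_integral_eq0 hL yyc yy0 J0 xL.
  by rewrite mulf_eq0 orbb (negbTE yx0).
pose c := (Num.sqrt J)^-1.
exists (fun t => c * y t + 0 * y t, fun t => c * y1 t + 0 * y1 t); split => /=.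
  by split; [exact: solves_comb|rewrite yL|rewrite y1L].
rewrite (@eq_Rintegral_itv _ _ _ _ (fun t => J^-1 * (y t * y t))).
  by rewrite RintegralZl ?mulVf ?gt_eqF//; exact: within_integrable.
move=> t _; have <- : c * c = J^-1 by rewrite /c -invfM -expr2 sqr_sqrtr// ltW.
by ring.
Qed.

Lemma hill_eigenvalues_finite V La : cont_on 0 L V ->
  finite_set (hill_eigenvalues V `&` [set lam | `|lam| <= La]).
Proof.
move=> Vc; apply: contrapT => /infiniteP/pcard_leP[f].
have [K HK] := eigenvalue_count hL al0 Vc La.
have fin n : (hill_eigenvalues V `&` [set lam | `|lam| <= La]) (f n) by exact: funS.
have /choice[yy yyP] n := hill_eigenvalue_unit Vc (fin n).1.
have : (Num.trunc K).+1%:R <= K; last by rewrite leNgt truncnS_gt.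
apply: (HK _ (fun i => f i) (fun i => (yy i).1) (fun i => (yy i).2)).
- by move=> i j ij; apply/val_inj; apply: (@inj _ _ _ f) ij; rewrite inE.
- by move=> i; exact: (fin i).2.
- by move=> i; have [] := yyP i.
- by move=> i; have [] := yyP i.
Qed.

Let ae_eq_trans_on (f g h : R -> R) : ae_eq mu I f g ->
  (forall x, 0 <= x <= L -> h x = g x) -> ae_eq mu I f h.
Proof.
move=> fg gh; apply: filterS fg => x fg xI; by rewrite fg// gh//; move: xI; rewrite /= in_itv.
Qed.

Lemma eigenspace_periodic lam u : eigenspace2 L D A (lam%:C)%C u ->
  exists Yr Yr1 Yi Yi1 Zr Zr1 Zi Zi1,
  [/\ periodic_eigen L al (pot1 phi) lam Yr Yr1 /\
      periodic_eigen L al (pot1 phi) lam Yi Yi1,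
      periodic_eigen L al (pot2 phi) lam Zr Zr1 /\
      periodic_eigen L al (pot2 phi) lam Zi Zi1,
    ae_eq mu I (coordY B (re u.1) (re u.2)) Yr /\
    ae_eq mu I (coordY B (im u.1) (im u.2)) Yi &
    ae_eq mu I (coordZ B (re u.1) (re u.2)) Zr /\
    ae_eq mu I (coordZ B (im u.1) (im u.2)) Zi].
Proof.
move=> /(eigenspace_strong hL ha hB phic)[Yr [Yr1 [Yi [Yi1 [Zr [Zr1 [Zi [Zi1]]]]]]]].
move=> [sY sZ [e1 e2] [e3 e4]].
have [yr [yr1 [yi [yi1 [Ey p1 p2]]]]] := strong_hill_eigen hL (pot1_cont phic) sY.
have [zr [zr1 [zi [zi1 [Ez p3 p4]]]]] := strong_hill_eigen hL (pot2_cont phic) sZ.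
exists yr, yr1, yi, yi1, zr, zr1, zi, zi1; split; split => //.
- by apply: ae_eq_trans_on e1 _ => x /Ey[].
- by apply: ae_eq_trans_on e2 _ => x /Ey[].
- by apply: ae_eq_trans_on e3 _ => x /Ez[].
- by apply: ae_eq_trans_on e4 _ => x /Ez[].
Qed.

Lemma coord_ae_eq0 u :
  ae_eq mu I (coordY B (re u.1) (re u.2)) (fun=> 0) ->
  ae_eq mu I (coordY B (im u.1) (im u.2)) (fun=> 0) ->
  ae_eq mu I (coordZ B (re u.1) (re u.2)) (fun=> 0) ->
  ae_eq mu I (coordZ B (im u.1) (im u.2)) (fun=> 0) ->
  eq_per2 L u zero2.
Proof.
move=> e1 e2 e3 e4; apply: (coord_ae_eq hB).
- by apply: filterS e1 => x /[apply] ->; rewrite /coordY /re /= !mulr0 addr0.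
- by apply: filterS e2 => x /[apply] ->; rewrite /coordY /im /= !mulr0 addr0.
- by apply: filterS e3 => x /[apply] ->; rewrite /coordZ /re /= !mulr0 addr0.
- by apply: filterS e4 => x /[apply] ->; rewrite /coordZ /im /= !mulr0 addr0.
Qed.

(** If [l] is not real, both scalar problems have only the zero solution; if it is
    real, one of the two coordinates is a nonzero scalar eigenfunction. *)
Lemma system_eigenvalue l : is_eigenvalue L D A l -> exists2 lam : R,
  l = (lam%:C)%C & (hill_eigenvalues (pot1 phi) `|` hill_eigenvalues (pot2 phi)) lam.
Proof.
move=> [u [ul u0]]; have [li0|li0] := eqVneq (complex.Im l) 0; last first.
  have [Yr [Yr1 [Yi [Yi1 [Zr [Zr1 [Zi [Zi1]]]]]]]] := eigenspace_strong hL ha hB phic ul.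
  move=> [sY sZ [e1 e2] [e3 e4]]; exfalso; apply: u0.
  have zero V Fr Fr1 Fi Fi1 : cont_on 0 L V -> strong_hill L al V (complex.Re l)
      (complex.Im l) (fun=> 0) (fun=> 0) Fr Fr1 Fi Fi1 ->
      forall x, 0 <= x <= L -> 0 = Fr x /\ 0 = Fi x.
    move=> Vc /(strong_hill_classical hL Vc)[yr [yr1 [yi [yi1 [E sr si [p1 p2 p3 p4]]]]]].
    move=> x xL; have [<- <- _ _] := E x xL.
    by have [-> ->] := hill_eigenvalue_real hL al0 li0 sr si p1 p2 p3 p4 xL.
  have zY := zero _ _ _ _ _ (pot1_cont phic) sY; have zZ := zero _ _ _ _ _ (pot2_cont phic) sZ.
  apply: coord_ae_eq0.
  - by apply: ae_eq_trans_on e1 _ => x /zY[].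
  - by apply: ae_eq_trans_on e2 _ => x /zY[].
  - by apply: ae_eq_trans_on e3 _ => x /zZ[].
  - by apply: ae_eq_trans_on e4 _ => x /zZ[].
have lE : l = ((complex.Re l)%:C)%C by apply: complex_eqP.
exists (complex.Re l) => //; apply: contrapT => nl; apply: u0; rewrite lE in ul.
have [Yr [Yr1 [Yi [Yi1 [Zr [Zr1 [Zi [Zi1]]]]]]]] := eigenspace_periodic ul.
move=> [[pYr pYi] [pZr pZi] [e1 e2] [e3 e4]].
have zero V y y1 : ~ hill_eigenvalues V (complex.Re l) ->
    periodic_eigen L al V (complex.Re l) y y1 -> forall x, 0 <= x <= L -> 0 = y x.
  move=> nV py x xL; apply/esym/eqP/negPn/negP => yx.
  by apply: nV; exists y, y1; split => //; exists x.
have n1 : ~ hill_eigenvalues (pot1 phi) (complex.Re l) by move=> h; apply: nl; left.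
have n2 : ~ hill_eigenvalues (pot2 phi) (complex.Re l) by move=> h; apply: nl; right.
apply: coord_ae_eq0.
- exact: ae_eq_trans_on e1 (zero _ _ _ n1 pYr).
- exact: ae_eq_trans_on e2 (zero _ _ _ n1 pYi).
- exact: ae_eq_trans_on e3 (zero _ _ _ n2 pZr).
- exact: ae_eq_trans_on e4 (zero _ _ _ n2 pZi).
Qed.

Lemma spectrum_eigenvalue : spectrum L D A `<=` is_eigenvalue L D A.
Proof.
move=> l ls; apply: contrapT => nl; apply: ls.
exact: (not_eigenvalue_resolvent hL ha hB phic phiper nl).
Qed.

(** A ball meets the spectrum in the image of a bounded set of scalar eigenvalues, which
    is finite, and finite sets have no limit point. *)
Lemma eigenvalues_discrete (S : set R[i]) : S `<=` is_eigenvalue L D A ->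
  limit_point (S : set (R[i]^o)%C) = set0.
Proof.
move=> SE; rewrite -subset0 => p pS.
pose La := `|complex.Re p| + 1.
pose F : set (R[i]^o)%C := [set (lam%:C)%C | lam in
  (hill_eigenvalues (pot1 phi) `|` hill_eigenvalues (pot2 phi)) `&` [set lam | `|lam| <= La]].
have Ffin : finite_set F.
  apply: finite_image; rewrite setIUl finite_setU.
  by split; apply: hill_eigenvalues_finite; [exact: pot1_cont|exact: pot2_cont].
have Fp : nbhs (p : (R[i]^o)%C) (~` (F `\ p)).
  apply: open_nbhs_nbhs; split; last by move=> [_]; apply.
  have T1 : accessible_space (R[i]^o)%C.
    by apply: hausdorff_accessible; exact: norm_hausdorff.
  by apply: closed_openC; apply: (accessible_finite_set_closed.1 T1); exact: finite_setD.
have pB := @nbhsx_ballx _ (R[i]^o)%C p 1 ltr01.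
have [l [lp Sl [lF lB]]] := pS _ (filterI Fp pB).
apply: lF; split; last by move=> e; rewrite e eqxx in lp.
have [lam lE hlam] := system_eigenvalue (SE _ Sl).
exists lam => //; split => //=.
move: lB; rewrite -ball_normE /= => lB.
have := le_lt_trans (normc_ge_Re _) lB.
rewrite lE ReD ReN /= ltcR => h; rewrite /La.
have := ler_normD (complex.Re p) (lam - complex.Re p); rewrite subrKC distrC; lra.
Qed.

End Discreteness.

(** * Nonpositive eigenvalues *)

Section NonpositiveEigenvalue.
Context {R : realType}.
Variables (L a b B : R) (phi : R -> R).
Hypotheses (hL : 0 < L) (ha : a < 0) (hB : B * B = 2).
Hypotheses (phic : continuous phi) (phiper : periodic phi L).
Hypothesis phi_neg : forall x, phi x < 0.
Implicit Types (x : R) (u v w : cfun2 R).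
Local Notation mu := (@lebesgue_measure R).
Local Notation I := (`[0, L]%classic : set R).
Local Notation D := (H2per2 L).
Local Notation A := (sys_op L a b B phi).

Let al0 : 0 < - a. Proof. by rewrite oppr_gt0. Qed.

Variable lam : R.
Hypothesis lam0 : lam <= 0.

(** Since 1 - phi > 1, only the coordinate along (1, B) can be nonzero. *)
Lemma eigenspace_first_coord u : eigenspace2 L D A (lam%:C)%C u ->
  exists Yr Yr1 Yi Yi1,
  [/\ periodic_eigen L (- a) (pot1 phi) lam Yr Yr1,
    periodic_eigen L (- a) (pot1 phi) lam Yi Yi1,
    ae_eq mu I (coordY B (re u.1) (re u.2)) Yr /\
    ae_eq mu I (coordY B (im u.1) (im u.2)) Yi &
    ae_eq mu I (coordZ B (re u.1) (re u.2)) (fun=> 0) /\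
    ae_eq mu I (coordZ B (im u.1) (im u.2)) (fun=> 0)].
Proof.
move=> /(eigenspace_periodic hL ha hB phic)[Yr [Yr1 [Yi [Yi1 [Zr [Zr1 [Zi [Zi1]]]]]]]].
move=> [[pYr pYi] [pZr pZi] eY [e3 e4]].
exists Yr, Yr1, Yi, Yi1; split => //.
have lamV x : 0 <= x <= L -> lam < pot2 phi x.
  by move=> _; rewrite /pot2; have := phi_neg x; have := lam0; lra.
split; [apply: filterS e3|apply: filterS e4] => x e xI; rewrite e//.
- by apply: (hill_positive hL al0 (pot2_cont phic) lamV pZr); move: xI; rewrite /= in_itv.
- by apply: (hill_positive hL al0 (pot2_cont phic) lamV pZi); move: xI; rewrite /= in_itv.
Qed.

Lemma not_eigenvalue_of_scalar :
  (forall y y1, periodic_eigen L (- a) (pot1 phi) lam y y1 ->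
    forall x, 0 <= x <= L -> y x = 0) ->
  ~ is_eigenvalue L D A (lam%:C)%C.
Proof.
move=> zero [u [/eigenspace_first_coord[Yr [Yr1 [Yi [Yi1 [pr pi [e1 e2] [e3 e4]]]]]] u0]].
apply: u0; apply: (coord_ae_eq0 hB) => //.
- by apply: filterS e1 => x e xI; rewrite e//; apply: (zero _ _ pr); move: xI; rewrite /= in_itv.
- by apply: filterS e2 => x e xI; rewrite e//; apply: (zero _ _ pi); move: xI; rewrite /= in_itv.
Qed.

(** Over the complex numbers the eigenspace is a line when the real and the imaginary
    part of the coordinate along (1, B) are real multiples of the same function. *)
Lemma simple_eigenvalue_of_scalar h h1 x0 :
  periodic_eigen L (- a) (pot1 phi) lam h h1 -> 0 <= x0 <= L -> h x0 != 0 ->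
  (forall y y1, periodic_eigen L (- a) (pot1 phi) lam y y1 ->
    exists c, forall x, 0 <= x <= L -> y x = c * h x) ->
  simple_eigenvalue L D A (lam%:C)%C.
Proof.
move=> ph x0L hx0 ray.
have [e [eE ev]] := @strong_eigenspace _ _ _ b _ _ hL ha hB phic phiper (lam%:C)%C
  _ _ _ _ _ _ _ _ (periodic_eigen_strong (pot1_cont phic) ph)
  (strong_hill_zero L a (pot2 phi) (lam%:C)%C).
have hc : cont_on 0 L h by case: ph => s _ _; exact: solves_within s.
exists e.
  split => // /eq_per2P[e1 _ _ _].
  have hz : ae_eq mu I h (fun=> 0).
    apply: filterS e1 => x ex xI; move: (ex xI); move: xI; rewrite /= in_itv/= => xL.
    have [-> _ _ _] := ev x xL; rewrite /= mulr0 addr0 => /eqP.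
    by rewrite mulf_eq0 invr_eq0 pnatr_eq0/= => /eqP.
  by rewrite (cont_on_ae0 hL hc hz x0L) eqxx in hx0.
move=> u /eigenspace_first_coord[Yr [Yr1 [Yi [Yi1 [pr pi [e1 e2] [e3 e4]]]]]].
have [cr crE] := ray _ _ pr; have [ci ciE] := ray _ _ pi.
exists (cr +i* ci)%C.
have xIL x : `[0, L]%classic x -> 0 <= x <= L by rewrite /= in_itv.
have zev x : 0 <= x <= L -> [/\ re (scale2 (cr +i* ci)%C e).1 x = cr * h x / 3,
    im (scale2 (cr +i* ci)%C e).1 x = ci * h x / 3,
    re (scale2 (cr +i* ci)%C e).2 x = B * (cr * h x / 3) &
    im (scale2 (cr +i* ci)%C e).2 x = B * (ci * h x / 3)].
  move=> /ev; rewrite /re /im /scale2 /decoupled /= !ReImE /= => -[-> -> -> ->].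
  by split; field.
apply: (coord_ae_eq hB).
- apply: filterS e1 => x ex xI; rewrite ex//; have xL := xIL _ xI; rewrite crE// /coordY.
  by have [-> _ -> _] := zev x xL; apply: (@modulo_B _ _ hB (- (cr * h x / 3))); field.
- apply: filterS e2 => x ex xI; rewrite ex//; have xL := xIL _ xI; rewrite ciE// /coordY.
  by have [_ -> _ ->] := zev x xL; apply: (@modulo_B _ _ hB (- (ci * h x / 3))); field.
- apply: filterS e3 => x ex xI; rewrite ex//; have xL := xIL _ xI; rewrite /coordZ.
  by have [-> _ -> _] := zev x xL; ring.
- apply: filterS e4 => x ex xI; rewrite ex//; have xL := xIL _ xI; rewrite /coordZ.
  by have [_ -> _ ->] := zev x xL; ring.
Qed.

End NonpositiveEigenvalue.

Section CnoidalEigenvalues.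
Context {R : realType}.
Variables (L k b B : R).
Hypotheses (hL : 0 < L) (hk : 0 < k < 1) (hB : B * B = 2).
Implicit Types (x lam : R).
Local Notation mu := (@lebesgue_measure R).
Local Notation I := (`[0, L]%classic : set R).
Local Notation D := (H2per2 L).
Local Notation phi := (wave L k).
Local Notation A := (sys_op L (coef_a L k) b B phi).
Local Notation lf := (lame_value k (be_minus k)).

Lemma coef_a_lt0 : coef_a L k < 0.
Proof. by rewrite -oppr_gt0; exact: wave_al_gt0. Qed.

Lemma wave_continuous : continuous phi.
Proof. by move=> x; exact: deriv_at_continuous (wave_derive hL hk x). Qed.

Let H := wave_ground_state hL hk.
Let l2 : 2 * half_period L = L.
Proof. by rewrite /half_period; field. Qed.

Lemma deriv_at_unique (f : R -> R) x d d' : deriv_at x f d -> deriv_at x f d' -> d = d'.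
Proof. by move=> /deriv_at_derive1 <- /deriv_at_derive1 <-. Qed.

Let ends0 : 0 <= (0 : R) <= L. Proof. by rewrite lexx ltW. Qed.
Let endsL : 0 <= L <= L. Proof. by rewrite lexx ltW. Qed.

Lemma ground_state_periodic :
  periodic_eigen L (- coef_a L k) (pot1 phi) lf (ground_state L k) (lame_even1 L k (be_minus k)).
Proof.
have fs : solves 0 L (fun x => (pot1 phi x - lf) / - coef_a L k) (ground_state L k)
    (lame_even1 L k (be_minus k)) by have := gs_f H; rewrite l2.
have fsym x : ground_state L k (L - x) = ground_state L k x by rewrite -[X in X - x]l2 (gs_fsym H).
split => //; first by rewrite -fsym subr0.
have [d0 _] := fs 0 ends0; have [dL _] := fs L endsL.
have : deriv_at 0 (fun t => ground_state L k (L - t)) (- lame_even1 L k (be_minus k) L).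
  by apply: deriv_at_reflect; rewrite subr0.
rewrite (_ : (fun t => _) = ground_state L k); last exact/funext.
move=> /(deriv_at_unique d0); rewrite (gs_f10 H) => /eqP.
by rewrite eq_sym oppr_eq0 => /eqP ->.
Qed.

Lemma wave1_periodic : periodic (wave1 L k) L.
Proof.
move=> x; have e : deriv_at x (fun t => phi (t + L)) (wave1 L k (x + L) * (1 + 0)).
  apply: (@derive_comp_pt _ phi (fun t => t + L)); first exact: wave_derive.
  by apply: deriveD_pt; [exact: deriv_at_id|exact: deriv_at_cst].
have := deriv_at_unique e; rewrite (_ : (fun t => _) = phi); last first.
  by apply/funext => t; rewrite wave_periodic.
by move=> /(_ _ (wave_derive hL hk x)); rewrite addr0 mulr1.
Qed.

Lemma wave2_periodic : periodic (wave2 L k) L.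
Proof.
move=> x; have e : deriv_at x (fun t => wave1 L k (t + L)) (wave2 L k (x + L) * (1 + 0)).
  apply: (@derive_comp_pt _ (wave1 L k) (fun t => t + L)); first exact: wave1_derive.
  by apply: deriveD_pt; [exact: deriv_at_id|exact: deriv_at_cst].
have := deriv_at_unique e; rewrite (_ : (fun t => _) = wave1 L k); last first.
  by apply/funext => t; rewrite wave1_periodic.
by move=> /(_ _ (wave1_derive L hk x)); rewrite addr0 mulr1.
Qed.

Lemma wave1_periodic_eigen :
  periodic_eigen L (- coef_a L k) (pot1 phi) 0 (wave1 L k) (wave2 L k).
Proof.
split; last 2 first.
- by have := wave1_periodic 0; rewrite add0r.
- by have := wave2_periodic 0; rewrite add0r.
apply: (@solves_eq _ _ _ (fun x => wave_pot L k x / wave_al L k)) ; last exact: wave1_solves.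
by move=> x _; rewrite subr0.
Qed.

Let to_l lam y y1 : periodic_eigen L (- coef_a L k) (pot1 phi) lam y y1 ->
  [/\ solves 0 (2 * half_period L) (fun x => (wave_pot L k x - lam) / wave_al L k) y y1,
    y 0 = y (2 * half_period L) & y1 0 = y1 (2 * half_period L)].
Proof. by rewrite l2. Qed.

Lemma simple_ground_eigenvalue : simple_eigenvalue L D A (lf%:C)%C.
Proof.
have lf0 := lame_value_minus_lt0 hk.
apply: (@simple_eigenvalue_of_scalar _ _ _ b _ _ hL coef_a_lt0 hB wave_continuous
  (wave_periodic hL hk) (wave_lt0 hL hk) _ (ltW lf0) _ _ 0 ground_state_periodic ends0).
  by rewrite gt_eqF// (gs_f0 H).
move=> y y1 /to_l[s p p1]; have [c cE] := ground_solution H s p p1 lf0 erefl.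
by exists c => x xL; rewrite cE// l2.
Qed.

Lemma negative_eigenvalue_unique lam : lam < 0 ->
  is_eigenvalue L D A (lam%:C)%C -> lam = lf.
Proof.
move=> lam0 le; apply/eqP/negPn/negP => lamf.
suff : ~ is_eigenvalue L D A (lam%:C)%C by apply.
apply: (not_eigenvalue_of_scalar hL coef_a_lt0 hB wave_continuous (wave_lt0 hL hk) (ltW lam0)).
move=> y y1 /to_l[s p p1] x xL; apply: (negative_solution_eq0 H s p p1) => //.
by rewrite l2.
Qed.

Lemma simple_zero_eigenvalue : simple_eigenvalue L D A 0.
Proof.
have lf0 := lame_value_minus_lt0 hk.
have m0 : 0 < L / 4 < half_period L by move: hL; rewrite /half_period; lra.
apply: (@simple_eigenvalue_of_scalar _ _ _ b _ _ hL coef_a_lt0 hB wave_continuous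
  (wave_periodic hL hk) (wave_lt0 hL hk) 0 (lexx 0) _ _ (L / 4) wave1_periodic_eigen).
- by apply/andP; split; move: hL; lra.
- by rewrite gt_eqF// wave1_gt0.
move=> y y1 /to_l[s p p1]; have [c cE] := kernel_solution H s p p1 erefl (negbT (lt_eqF lf0)).
by exists c => x xL; rewrite cE// l2.
Qed.

Lemma wave1_continuous : continuous (wave1 L k).
Proof. by move=> x; exact: deriv_at_continuous (wave1_derive L hk x). Qed.

Let wave1_H2 c : let f := (cplx (fun x => c * wave1 L k x) (fun=> 0)) in
  H2per L f /\ eq_per L (dxx L f)
    (cplx (fun x => c * (wave_pot L k x / wave_al L k * wave1 L k x)) (fun=> 0)).
Proof.
have L2c f : continuous f -> L2r L f.
  move=> fc; have /within_bounded[M _ fM] : cont_on 0 L f by exact: continuous_subspaceT.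
  by apply: (@L2r_bounded _ _ _ M) => //; exact: continuous_measurable_fun.
have potc : continuous (wave_pot L k).
  move=> x; apply: cvgD; first exact: cvg_cst.
  by apply: cvgM; [exact: cvg_cst|exact: wave_continuous].
have gc : continuous (fun x => c * (wave_pot L k x / wave_al L k * wave1 L k x)).
  move=> x; apply: cvgM; first exact: cvg_cst.
  apply: cvgM; last exact: wave1_continuous.
  by apply: cvgM; [exact: potc|exact: cvg_cst].
have fc : continuous (fun x => c * wave1 L k x).
  by move=> x; apply: cvgM; [exact: cvg_cst|exact: wave1_continuous].
have i0 x : 0 <= x <= L -> 0 = 0 + \int[mu]_(t in `[0, x]) (0 : R).
  by move=> /andP[x0 _]; rewrite Rintegral_itv_cst// mul0r addr0.
have FTC f f1 : (forall t, deriv_at t f (f1 t)) -> continuous f1 ->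
    forall x, 0 <= x <= L -> f x = f 0 + \int[mu]_(t in `[0, x]) f1 t.
  move=> fd f1c x /andP[x0 _]; rewrite (@FTC_segment _ 0 x f f1) ?subrKC//.
  exact: continuous_subspaceT.
have F1 : forall x, 0 <= x <= L -> c * wave1 L k x = c * wave1 L k 0 +
    \int[mu]_(t in `[0, x]) (c * wave2 L k t).
  apply: (FTC (fun x => c * wave1 L k x) (fun x => c * wave2 L k x)).
    by move=> t; apply: deriveZ_pt; exact: wave1_derive.
  move=> x; apply: cvgM; first exact: cvg_cst.
  by apply: (@deriv_at_continuous _ _ x (wave_pot L k x / wave_al L k * wave1 L k x));
    have [] := @wave1_solves _ _ _ hL hk x x x; rewrite ?lexx.
have F2 : forall x, 0 <= x <= L -> c * wave2 L k x = c * wave2 L k 0 +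
    \int[mu]_(t in `[0, x]) (c * (wave_pot L k t / wave_al L k * wave1 L k t)).
  apply: (FTC (fun x => c * wave2 L k x)
    (fun x => c * (wave_pot L k x / wave_al L k * wave1 L k x))); last exact: gc.
  by move=> t; apply: deriveZ_pt; have [] := @wave1_solves _ _ _ hL hk t t t; rewrite ?lexx.
apply: (H2per_intro hL (c0 := c * wave1 L k 0) (c1 := c * wave2 L k 0)
   (d0 := 0) (d1 := 0) (F1 := fun x => c * wave2 L k x) (G1 := fun=> 0)).
- by apply: L2per_cplx => //; [move=> x; rewrite wave1_periodic|exact: L2c|exact: L2r0].
- apply: L2per_cplx => //; [|exact: L2c|exact: L2r0].
  by move=> x; rewrite wave1_periodic /wave_pot wave_periodic.
- split; [exact: F2|exact: F1| |].
  + by have := wave2_periodic 0; rewrite add0r => ->.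
  + by have := wave1_periodic 0; rewrite add0r /re /cplx /= => ->.
- by split.
Qed.

(** Translation invariance of the travelling wave system puts (phi', B phi') in
    the kernel. *)
Lemma wave1_eigenfunction : eigenfunction L D A 0
  (fun x => (wave1 L k x)%:C, fun x => (B * wave1 L k x)%:C)%C.
Proof.
have al0 := gt_eqF (wave_al_gt0 hL hk).
have m0 : 0 < L / 4 < half_period L by move: hL; rewrite /half_period; lra.
have [H1 /eq_perP[r1 i1]] := wave1_H2 1; have [H2 /eq_perP[r2 i2]] := wave1_H2 B.
have E1 : (fun x => (wave1 L k x)%:C)%C = cplx (fun x => 1 * wave1 L k x) (fun=> 0).
  by apply/funext => x; rewrite /cplx mul1r.
split; last first.
  move=> /eq_per2P[w0 _ _ _].
  have wc : cont_on 0 L (wave1 L k).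
    by apply: continuous_subspaceT; exact: wave1_continuous.
  have x4 : 0 <= L / 4 <= L by apply/andP; split; move: hL; lra.
  by have /eqP := cont_on_ae0 hL wc w0 x4; rewrite gt_eqF// wave1_gt0.
apply/eigenspace_shift; split; first by split => //; rewrite E1.
rewrite E1; apply/eq_per2P; set u := (_, _).
have aE : coef_a L k = - wave_al L k by rewrite opprK.
split.
- apply: filterS r1 => x r1 xI.
  have [-> _ _ _] := shift2_parts L (coef_a L k) b B phi 0 u x.
  rewrite [re (dxx L u.1) x]r1// /u /re /im /cplx /= aE /wave_pot.
  by apply: (@modulo_B _ _ hB (phi x * wave1 L k x)); field; rewrite al0.
- apply: filterS i1 => x i1 xI.
  have [_ -> _ _] := shift2_parts L (coef_a L k) b B phi 0 u x.
  by rewrite [im (dxx L u.1) x]i1// /u /re /im /cplx /=; ring.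
- apply: filterS r2 => x r2 xI.
  have [_ _ -> _] := shift2_parts L (coef_a L k) b B phi 0 u x.
  rewrite [re (dxx L u.2) x]r2// /u /re /im /cplx /= aE /wave_pot.
  by field; rewrite al0.
- apply: filterS i2 => x i2 xI.
  have [_ _ _ ->] := shift2_parts L (coef_a L k) b B phi 0 u x.
  by rewrite [im (dxx L u.2) x]i2// /u /re /im /cplx /=; ring.
Qed.

End CnoidalEigenvalues.

Local Open Scope complex_scope.

Theorem proposition4p12 (R : realType) (L k omega B a b c d : R)
    (phi psi : R -> R)
    (hL : 0 < L) (hk : 0 < k < 1) (homega : omega = 0)
    (hB : B = Num.sqrt 2 \/ B = - Num.sqrt 2)
    (ha : a = coef_a L k) (hc : c = a) (hb : b = 6^-1 - a) (hd : d = b)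
    (hphi : phi = cnoidal L k a) (hpsi : psi = (fun x => B * phi x)) :
  let A := lin_op L a b c omega phi psi in
  let D := H2per2 L in
  exists l0 : R,
    [/\ (l0 < 0 /\ simple_eigenvalue L D A l0%:C),
        (forall l : R, l < 0 -> is_eigenvalue L D A l%:C -> l = l0),
        (simple_eigenvalue L D A 0 /\
         eigenfunction L D A 0
           (fun x => (derive1 phi x)%:C, fun x => (B * derive1 phi x)%:C))
      & let S := spectrum L D A `\` [set l0%:C; 0] in
        S `<=` is_eigenvalue L D A /\
        limit_point (S : set (R[i]^o)) = set0].
Proof.
have BB : B * B = 2.
  by case: hB => ->; rewrite ?mulrNN -expr2 sqr_sqrtr.
have phiE : phi = wave L k by rewrite hphi ha.
have AE : lin_op L a b c omega phi psi = sys_op L (coef_a L k) b B (wave L k).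
  by rewrite hpsi hc homega phiE ha.
have dphi : derive1 phi = wave1 L k.
  by rewrite phiE; apply/funext => x; exact: deriv_at_derive1 (wave_derive hL hk x).
rewrite /= AE dphi.
have SE : spectrum L (H2per2 L) (sys_op L (coef_a L k) b B (wave L k)) `<=`
    is_eigenvalue L (H2per2 L) (sys_op L (coef_a L k) b B (wave L k)).
  exact: (spectrum_eigenvalue hL (coef_a_lt0 hL hk) BB (wave_continuous hL hk)
    (wave_periodic hL hk)).
exists (lame_value k (be_minus k)); split.
- by split; [exact: lame_value_minus_lt0|exact: simple_ground_eigenvalue].
- by move=> l; exact: negative_eigenvalue_unique.
- by split; [exact: simple_zero_eigenvalue|exact: wave1_eigenfunction].
split; first by move=> l [/SE].
apply: (@eigenvalues_discrete _ _ _ b _ _ hL (coef_a_lt0 hL hk) BB (wave_continuous hL hk)).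
by move=> l [/SE].
Qed.
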